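(* Let $n\ge 2$. Let $\{Y_k\}_{k\in\mathbb{N}}$ be a sequence such that, for every $k$, $Y_k$ is a real spherical harmonic of degree $k$ on $\mathbb{S}_{n-1}$ with $\|Y_k\|_{L^2(\mathbb{S}_{n-1})}=1$, and such that \[ \|Y_k\|_{L^\infty(\mathbb{S}_{n-1})}=O(\sqrt{\ln k})\quad\text{as }k\to\infty . \] Let $a_k:=j^{-2}$ if $k=2^j$ for some $j\in\mathbb{N}\setminus\{0\}$, and $a_k:=0$ if $k\neq 2^j$ for all $j\in\mathbb{N}\setminus\{0\}$. Define \[ u(x):=\sum_{k=0}^\infty a_k\,|x|^k\,Y_k\!\left(\frac{x}{|x|}\right)\quad\text{for }x\in\overline{\mathbb{B}_n}\setminus\{0\},\qquad u(0):=a_0Y_0 . \] Then $u$ is harmonic in $\mathbb{B}_n$, continuous on $\overline{\mathbb{B}_n}$, and does not belong to $H^{\sigma+1/2}(\mathbb{B}_n)$ for any $\sigma>0$. Moreover, $u$ does not belong to $C^{0,\epsilon}(\overline{\mathbb{B}_n})$ for any $\epsilon>0$.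
   Context: $\mathbb{N}$ includes $0$. $\mathbb{B}_n$ is the open unit ball of $\mathbb{R}^n$ centered at the origin and $\mathbb{S}_{n-1}:=\partial\mathbb{B}_n$. A (real) spherical harmonic of degree $k$ is the restriction to $\mathbb{S}_{n-1}$ of a harmonic homogeneous real polynomial of degree $k$ in $x_1,\dots,x_n$ (for $k=0$, a constant, identified with its value). $H^s$ denotes the usual $L^2$-based Sobolev space of (possibly fractional) order $s$. $C^{0,\epsilon}$ denotes the space of H\''older continuous functions with exponent $\epsilon$. *)

(* Defs.v *)
From HB Require Import structures.
From mathcomp Require Import all_boot all_order all_algebra.
From mathcomp Require Import all_classical all_reals all_analysis.
From mathcomp Require Import measurable_realfun.
From mathcomp Require Import (canonicals, coercions) mpoly.

Set Implicit Arguments.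
Unset Strict Implicit.
Unset Printing Implicit Defensive.

Import Order.TTheory GRing.Theory Num.Theory.
Import numFieldNormedType.Exports.

Local Open Scope classical_set_scope.
Local Open Scope ring_scope.

(* R^n is 'rV[R]_n.  Its built-in norm is the sup norm (same topology);
   metric notions below use the Euclidean norm enorm. *)

(* 'rV[R]_n carries the sigma-algebra generated by the coordinate maps (as
   n.-tuple does in the library); for finite n this is the Borel one. *)
Section rV_measurable.
Context (R : realType) (n : nat).

Let coor (i : 'I_n) (x : 'rV[R]_n) : measurableTypeR R := x ord0 i.

Let rV_set0 : g_sigma_preimage coor set0.
Proof. exact: sigma_algebra0. Qed.

Let rV_setC A : g_sigma_preimage coor A -> g_sigma_preimage coor (~` A).
Proof. exact: sigma_algebraC. Qed.

Let rV_bigcup (F : (set 'rV[R]_n)^nat) :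
  (forall i, g_sigma_preimage coor (F i)) ->
  g_sigma_preimage coor (\bigcup_i F i).
Proof. exact: sigma_algebra_bigcup. Qed.

HB.instance Definition _ := @isMeasurable.Build default_measure_display
  'rV[R]_n (g_sigma_preimage coor) rV_set0 rV_setC rV_bigcup.

Lemma measurable_coor (i : 'I_n) :
  measurable_fun [set: 'rV[R]_n] (fun x => x ord0 i : measurableTypeR R).
Proof.
move=> _ Y mY; rewrite setTI; apply: sub_sigma_algebra => /=.
rewrite -bigcup_seq/=; exists i => /=; first by rewrite mem_index_enum.
by exists Y => //; rewrite setTI.
Qed.

Lemma measurable_fun_rV d (T : measurableType d) (f : T -> 'rV[R]_n) :
  (forall i, measurable_fun [set: T] (fun t => f t ord0 i : measurableTypeR R))
  -> measurable_fun [set: T] f.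
Proof.
move=> mf.
have sub : <<s \big[setU/set0]_(i < n)
    preimage_set_system setT (coor i) measurable >> `<=`
    [set A : set 'rV[R]_n | measurable (f @^-1` A)].
  apply: smallest_sub.
    split => /=.
    - by rewrite preimage_set0.
    - by move=> A mA; rewrite setTD -preimage_setC; exact: measurableC.
    - move=> F mF; rewrite preimage_bigcup; exact: bigcup_measurable.
  rewrite -bigcup_seq/= => A [i _ [B mB <-]] /=.
  by rewrite setTI; have := mf i measurableT B mB; rewrite setTI.
by move=> _ A mA; rewrite setTI; exact: sub.
Qed.

End rV_measurable.

Section lebesgue_rV.
Context (R : realType).

Definition vcons n (p : measurableTypeR R * 'rV[R]_n) : 'rV[R]_n.+1 :=
  \row_i if unlift ord0 i is Some j then p.2 ord0 j else p.1.

Lemma measurable_vcons n : measurable_fun setT (@vcons n).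
Proof.
apply: measurable_fun_rV => i; have [j ->|->] := unliftP ord0 i.
  rewrite (_ : (fun _ => _) = (fun x : 'rV[R]_n => x ord0 j) \o snd).
    exact: measurableT_comp (measurable_coor j) measurable_snd.
  by apply/funext => p; rewrite mxE liftK.
rewrite (_ : (fun _ => _) = fst); first exact: measurable_fst.
by apply/funext => p; rewrite mxE unlift_none.
Qed.

Definition vuncons n (x : 'rV[R]_n.+1) : measurableTypeR R * 'rV[R]_n :=
  (x ord0 ord0, \row_j x ord0 (lift ord0 j)).

Lemma vconsK n : cancel (@vcons n) (@vuncons n).
Proof.
case=> a x; rewrite /vuncons mxE unlift_none; congr pair.
by apply/rowP => j; rewrite !mxE liftK.
Qed.

Lemma vunconsK n : cancel (@vuncons n) (@vcons n).
Proof.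
move=> x; apply/rowP => i; rewrite mxE.
by have [j ->|->] := unliftP ord0 i; rewrite ?mxE.
Qed.

Lemma measurable_vuncons n : measurable_fun setT (@vuncons n).
Proof.
apply/measurable_fun_pairP; split; first exact: measurable_coor.
apply: measurable_fun_rV => j.
rewrite (_ : (fun _ => _) = (fun x : 'rV[R]_n.+1 => x ord0 (lift ord0 j))).
  exact: measurable_coor.
by apply/funext => x /=; rewrite mxE.
Qed.

Section lebesgue_succ.
Context n (m : {sigma_finite_measure set 'rV[R]_n -> \bar R}).

Definition lebesgue_succ : set 'rV[R]_n.+1 -> \bar R :=
  pushforward (lebesgue_measure \x m)%E (@vcons n).

Let pm : {measure set 'rV[R]_n.+1 -> \bar R} :=
  measure_function_pushforward__canonical__measure_function_Measure
    (lebesgue_measure \x m)%E (@measurable_vcons n).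

HB.instance Definition _ := Measure.copy lebesgue_succ pm.

Let lebesgue_succ_sigma_finite : sigma_finite setT lebesgue_succ.
Proof.
have /sigma_finiteP[F [TF ndF Foo]] := sigma_finiteT (@lebesgue_measure R).
have /sigma_finiteP[G [TG ndG Goo]] := sigma_finiteT m.
exists (fun i => @vuncons n @^-1` (F i `*` G i)).
  apply/esym/seteqP; split=> // x _.
  have : setT (vuncons x).1 by []. rewrite TF => -[i _ Fi].
  have : setT (vuncons x).2 by []. rewrite TG => -[j _ Gj].
  exists (maxn i j) => //; split.
  - by move: Fi; exact/subsetPset/ndF/leq_maxl.
  - by move: Gj; exact/subsetPset/ndG/leq_maxr.
move=> i; have [mF Fi] := Foo i; have [mG Gi] := Goo i; split.
  rewrite -[X in measurable X]setTI; apply: measurable_vuncons => //.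
  exact: measurableX.
rewrite /lebesgue_succ /pushforward -comp_preimage.
rewrite (_ : _ \o _ = id); last by apply/funext => p /=; rewrite vconsK.
by rewrite preimage_id product_measure1E// lte_mul_pinfty// ge0_fin_numE.
Qed.

HB.instance Definition _ := Measure_isSigmaFinite.Build _ _ _
  lebesgue_succ lebesgue_succ_sigma_finite.

End lebesgue_succ.

Fixpoint lebesgue_rV n : {sigma_finite_measure set 'rV[R]_n -> \bar R} :=
  if n is n'.+1 then lebesgue_succ (lebesgue_rV n') else \d_(0 : 'rV[R]_0).

End lebesgue_rV.

Section geometry.
Context (R : realType) (n : nat).
Implicit Types x y : 'rV[R]_n.

Definition enorm x : R := Num.sqrt (\sum_i x ord0 i ^+ 2).

Definition unit_ball : set 'rV[R]_n := [set x | enorm x < 1].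
Definition unit_cball : set 'rV[R]_n := [set x | enorm x <= 1].
Definition unit_sphere : set 'rV[R]_n := [set x | enorm x = 1].

Definition normalize x : 'rV[R]_n := (enorm x)^-1 *: x.

Lemma measurable_enorm : measurable_fun [set: 'rV[R]_n] enorm.
Proof.
apply: (measurableT_comp (continuous_measurable_fun (@sqrt_continuous R))).
apply: measurable_sum => i.
by apply: measurable_funX; exact: measurable_coor.
Qed.

Lemma measurable_unit_ball : measurable unit_ball.
Proof.
have -> : unit_ball = enorm @^-1` `]-oo, 1[.
  by apply/seteqP; split=> x /=; rewrite in_itv.
by rewrite -[X in measurable X]setTI; exact: measurable_enorm.
Qed.

Lemma measurable_normalize : measurable_fun [set: 'rV[R]_n] normalize.
Proof.
apply: measurable_fun_rV => i.
rewrite (_ : (fun _ => _) = (fun x => enorm x `^ (-1) * x ord0 i)); last first.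
  by apply/funext => x; rewrite mxE powR_inv1// sqrtr_ge0.
apply: measurable_funM; last exact: measurable_coor.
exact: (measurableT_comp (measurable_powR _) measurable_enorm).
Qed.

(* Surface measure: sigma(A) = n * lambda_n {x | |x| < 1, x / |x| \in A}. *)
Definition sphere_measure : set 'rV[R]_n -> \bar R := fun A =>
  (n%:R%:E * pushforward (mrestr (@lebesgue_rV R n) measurable_unit_ball)
               normalize A)%E.

HB.instance Definition _ := Measure.copy sphere_measure
  (mscale (n%:R)%:nng
    (measure_function_pushforward__canonical__measure_function_Measure
      (mrestr (@lebesgue_rV R n) measurable_unit_ball) measurable_normalize)).

Definition sphere_Lnorm (p : \bar R) (f : 'rV[R]_n -> R) : \bar R :=
  'N[sphere_measure]_p[EFin \o (f \_ unit_sphere)].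

(* Meaningful for f constant on the sphere. *)
Definition sphere_value (f : 'rV[R]_n -> R) : R :=
  get [set c | forall x, unit_sphere x -> f x = c].

(* Functions on the sphere are represented by functions on R^n whose values
   off the sphere are irrelevant. *)
Definition spherical_harmonic (k : nat) (f : 'rV[R]_n -> R) :=
  exists p : mpoly.mpoly n R,
    [/\ p \is mpoly.ishomog1 k (@mpoly.mdeg n),
        \sum_(i < n) mpoly.mderiv i (mpoly.mderiv i p) = 0
      & forall x, unit_sphere x ->
          f x = mpoly.meval (fun i => x ord0 i) p].

End geometry.

Section calculus.
Context (R : realType) (n : nat).
Implicit Types (f g : 'rV[R]_n -> R) (U : set 'rV[R]_n).

Definition partial (i : 'I_n) f : 'rV[R]_n -> R :=
  fun x => 'D_(delta_mx ord0 i) f x.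

(* Higher partial derivatives are indexed by sequences of directions; for
   C^k functions only the multiplicities, i.e. the multi-index, matter. *)
Definition partials (l : seq 'I_n) f : 'rV[R]_n -> R := foldr partial f l.

Definition class_C (k : nat) U f :=
  (forall l i x, (size l < k)%N -> U x ->
     derivable (partials l f) x (delta_mx ord0 i)) /\
  (forall l x, (size l <= k)%N -> U x -> {for x, continuous (partials l f)}).

Definition harmonic_on U f :=
  class_C 2 U f /\ forall x, U x -> \sum_(i < n) partials [:: i; i] f x = 0.

Definition holder_on (eps : R) U f :=
  exists C : R, forall x y, U x -> U y ->
    `|f x - f y| <= C * enorm (x - y) `^ eps.

(* C_c^oo(U) *)
Definition test_function U (phi : 'rV[R]_n -> R) :=
  [/\ forall k, class_C k setT phi,
      compact (closure [set x | phi x != 0])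
    & closure [set x | phi x != 0] `<=` U].

Definition square_integrable U f :=
  measurable_fun U f /\
  (\int[@lebesgue_rV R n]_(x in U) (f x ^+ 2)%:E < +oo)%E.

(* For l = [::] this says that g = f almost everywhere on U. *)
Definition weak_partials (l : seq 'I_n) U f g :=
  forall phi, test_function U phi ->
    (\int[@lebesgue_rV R n]_(x in U) (f x * partials l phi x)%:E =
     ((-1) ^+ size l)%:E *
     \int[@lebesgue_rV R n]_(x in U) (g x * phi x)%:E)%E.

(* Square of the Gagliardo seminorm of order theta. *)
Definition gagliardo (theta : R) U g : \bar R :=
  (\int[@lebesgue_rV R n]_(x in U) \int[@lebesgue_rV R n]_(y in U)
     ((g x - g y) ^+ 2 / enorm (x - y) `^ (n%:R + 2 * theta))%:E)%E.

(* Sobolev-Slobodeckij space H^s(U), s = m + theta >= 0 with m the integer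
   part: all weak derivatives of order <= m are in L^2(U) and, when s is not
   an integer, those of order m have finite Gagliardo seminorm of order
   theta. *)
Definition sobolev_H (s : R) U f :=
  square_integrable U f /\
  forall l : seq 'I_n, (size l <= Num.truncn s)%N ->
    exists g, [/\ square_integrable U g,
      weak_partials l U f g
    & size l = Num.truncn s -> (Num.truncn s)%:R < s ->
      (gagliardo (s - (Num.truncn s)%:R) U g < +oo)%E].

End calculus.

Definition solid_series (R : realType) (n : nat) (a : nat -> R)
    (Y : nat -> 'rV[R]_n -> R) (x : 'rV[R]_n) : R^nat :=
  series (fun k => a k * enorm x ^+ k * Y k (normalize x)).

(* Its values outside the closed unit ball are irrelevant. *)
Definition solid_sum (R : realType) (n : nat) (a : nat -> R)
    (Y : nat -> 'rV[R]_n -> R) (x : 'rV[R]_n) : R :=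
  if x == 0 then a 0%N * sphere_value (Y 0%N)
  else limn (solid_series a Y x).

(* Main.v *)
(** Write [u] as the sum of [a_k p_k], where [p_k] is the homogeneous harmonic
    polynomial which restricts to [Y_k].  Since [a_k sup |Y_k| = O(j^(-3/2))] for
    [k = 2^j], the series converges uniformly on the closed ball; interior gradient
    bounds for harmonic polynomials, uniform in the degree, allow differentiating it
    term by term.

    Polynomials [p_j] and [p_k] of different degrees are orthogonal for every radial
    weight, so testing [u] against [psi_k(|x|^2) p_k], where [psi_k] is a bump of
    width [1/k] near the sphere, isolates [a_k].  With [r = 1 - 1/k], the difference
    [u(x) - u(r x)] tested in this way is of size [a_k / k], whereas it is
    [O(k^(-1-eps))] if [u] is Hoelder of exponent [eps], and [O(k^(-1-sigma))] if [u]
    has finite Gagliardo seminorm of order [sigma + 1/2 < 1].  When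
    [sigma + 1/2 >= 1], testing the weak gradient against [x psi_k(|x|^2) p_k] gives
    [a_k = O(k^(-1/2))].  Each bound contradicts [a_k = j^(-2)] for [k = 2^j]. *)

Require Import Defs.
From HB Require Import structures.
From mathcomp Require Import all_boot all_order all_algebra.
From mathcomp Require Import all_classical all_reals all_analysis.
From mathcomp Require Import measurable_realfun ess_sup_inf.
From mathcomp Require Import (canonicals, coercions) mpoly.
From mathcomp Require Import ring lra.

Set Implicit Arguments.
Unset Strict Implicit.
Unset Printing Implicit Defensive.

Import Order.TTheory GRing.Theory Num.Theory.
Import numFieldNormedType.Exports.

Local Open Scope classical_set_scope.
Local Open Scope ring_scope.


(** * Lebesgue measure under affine maps *)

Section affine.
Context (R : realType).

(** A function [g] supplied by [sobolev_H] is known only through integrals against test functions,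
    and these have compact support in the open ball. This is why the bumps stop at |x|^2 = 1 -
    1/(2k), short of the sphere, and why g(r x) is tested by moving the dilation onto the bump,
    which remains a test function.

    The bump of mode k has L^1 norm and squared L^2 norm of order at most 1/k, while its pairing
    with p_k is at least a constant times 1/k; in the two arguments by dilation a common factor 1/k
    therefore cancels. Shrinking by 1 - 1/k is the scale at which p_k loses a fixed fraction of its
    size, since (1 - 1/k)^k <= 1/2. What remains is j^(-2) against 2^(-j d) for a fixed d > 0: along
    k = 2^j the coefficient is a power of log k, small enough to absorb sqrt(ln k) in a convergent
    series, yet larger than any negative power of k.

    Spherical integrals are replaced by integrals over the ball of functions constant along rays.
    Dilation alone gives the mass of every ball and shell, and the unit L^2 norm on the sphere
    becomes the mass 1/n. *)

Definition affR (r v : R) (x : measurableTypeR R) : measurableTypeR R := r * x + v.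

Lemma measurable_affR r v : measurable_fun setT (affR r v).
Proof. by apply: measurable_funD => //; apply: measurable_funM. Qed.

(** The pushforward by the affine map, multiplied by r, agrees with Lebesgue measure on half-open
    intervals, so uniqueness of Lebesgue measure applies. *)
Lemma lebesgue_measure_affR (r v : R) (A : set (measurableTypeR R)) :
  0 < r -> measurable A ->
  lebesgue_measure (affR r v @^-1` A) = (r^-1%:E * lebesgue_measure A)%E.
Proof.
move=> r0 mA.
have rn0 : (0 <= r) by exact: ltW.
pose m1 := measure_function_pushforward__canonical__measure_function_Measure
   (@lebesgue_measure R) (measurable_affR r v).
pose m2 := mscale (NngNum rn0) m1.
have H : forall X, ocitv X -> @lebesgue_measure R X = m2 X.
  move=> _ [[a b]] _ <-.
  rewrite /m2 /mscale /= /pushforward.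
  have -> : affR r v @^-1` `]a, b]%classic = `](a - v) / r, (b - v) / r]%classic.
    apply/seteqP; split => x /=; rewrite !in_itv /= /affR.
      by move=> /andP[ax xb]; rewrite ltr_pdivrMr// ler_pdivlMr// mulrC; lra.
    by rewrite ltr_pdivrMr// ler_pdivlMr// mulrC; lra.
  rewrite !lebesgue_measure_itv /= !lte_fin.
  rewrite ltr_pM2r ?invr_gt0// ltrD2r; case: ifPn => ab; last by rewrite mule0.
  by rewrite -!EFinD -EFinM; congr EFin; field; rewrite gt_eqF.
have := lebesgue_measure_unique H mA.
rewrite /m2 /mscale /= => ->.
by rewrite muleA -EFinM mulVf ?mul1e// gt_eqF.
Qed.

Definition aff n (r : R) (v : 'rV[R]_n) (x : 'rV[R]_n) : 'rV[R]_n := r *: x + v.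

Lemma measurable_aff n r (v : 'rV[R]_n) : measurable_fun setT (aff r v).
Proof.
apply: measurable_fun_rV => i.
rewrite (_ : (fun _ => _) = (fun x : 'rV[R]_n => r * x ord0 i + v ord0 i)).
  apply: measurable_funD => //; apply: measurable_funM => //.
  exact: measurable_coor.
by apply/funext => x; rewrite !mxE.
Qed.

(** Induction on the dimension, following the construction of [lebesgue_rV] as an iterated product:
    the rescaled pushforward has the right value on rectangles, and product measures are determined
    by rectangles. *)
Lemma lebesgue_rV_aff n (r : R) (v : 'rV[R]_n) (A : set 'rV[R]_n) :
  0 < r -> measurable A ->
  lebesgue_rV R n (aff r v @^-1` A) = ((r^-1 ^+ n)%:E * lebesgue_rV R n A)%E.
Proof.
move=> r0.
elim: n v A => [v A mA|n IHn v A mA].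
  rewrite expr0 mul1e /= ; congr (_ _).
  by apply/seteqP; split=> x /=; rewrite [aff r v x]thinmx0 [x]thinmx0.
pose v1 := (vuncons v).1; pose v2 := (vuncons v).2.
pose g (p : measurableTypeR R * 'rV[R]_n) := (affR r v1 p.1, aff r v2 p.2).
have mg : measurable_fun setT g.
  apply/measurable_fun_pairP; split.
    exact: measurableT_comp (measurable_affR _ _) measurable_fst.
  exact: measurableT_comp (measurable_aff _ _) measurable_snd.
have vg p : vcons (g p) = aff r v (vcons p).
  apply/rowP => i; rewrite !mxE /=.
  by case: unliftP => [j ->|->] //=; rewrite /aff /affR !mxE.
have rn0 : 0 <= r ^+ n.+1 by rewrite exprn_ge0// ltW.
pose m1 := measure_function_pushforward__canonical__measure_function_Measure
   (lebesgue_measure \x (lebesgue_rV R n))%E mg.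
pose m2 := mscale (NngNum rn0) m1.
have H X Y : measurable X -> measurable Y ->
    m2 (X `*` Y) = (lebesgue_measure X * lebesgue_rV R n Y)%E.
  move=> mX mY; rewrite /m2 /mscale /= /pushforward.
  have -> : g @^-1` (X `*` Y) = (affR r v1 @^-1` X) `*` (aff r v2 @^-1` Y) by [].
  rewrite product_measure1E; last 2 first.
  - by rewrite -[X in measurable X]setTI; exact: measurable_affR.
  - by rewrite -[X in measurable X]setTI; exact: measurable_aff.
  rewrite [X in (_ * (X * _))%E](lebesgue_measure_affR v1 r0 mX) [X in (_ * (_ * X))%E](IHn v2 Y mY).
  rewrite muleACA -EFinM (muleA (r ^+ n.+1)%:E) -EFinM -[RHS]mul1e; congr (_%:E * _)%E; rewrite exprS.
  by rewrite exprVn; field;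
  rewrite expf_neq0 gt_eqF.
have := product_measure_unique H.
move=> /(_ (vcons (n:=n) @^-1` A)).
have mA' : measurable (vcons (n:=n) @^-1` A).
  by rewrite -[X in measurable X]setTI; exact: measurable_vcons.
move=> /(_ mA').
rewrite /m2 /mscale /= /lebesgue_succ /pushforward => ->.
rewrite /mscale /m1 /= /pushforward (_ : g @^-1` _ = vcons (n:=n) @^-1` (aff r v @^-1` A)); last first.
  by apply/seteqP; split => p /=; rewrite vg.
by rewrite muleA -EFinM -exprMn mulVf ?expr1n ?mul1e// gt_eqF.
Qed.

Lemma ge0_integral_aff n (r : R) (v : 'rV[R]_n) (f : 'rV[R]_n -> \bar R) :
  0 < r -> measurable_fun setT f -> (forall x, 0 <= f x)%E ->
  (\int[lebesgue_rV R n]_x f (r *: x + v)%R =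
   (r^-1 ^+ n)%:E * \int[lebesgue_rV R n]_x f x)%E.
Proof.
move=> r0 mf f0.
have rn0 : 0 <= r^-1 ^+ n by rewrite exprn_ge0// invr_ge0 ltW.
transitivity (\int[pushforward (lebesgue_rV R n) (aff r v)]_x f x)%E.
  rewrite ge0_integral_pushforward//=; first exact: measurable_aff.
transitivity (\int[mscale (NngNum rn0) (lebesgue_rV R n)]_x f x)%E.
  apply: eq_measure_integral => //= [|_ A mA _]; first exact: measurable_aff.
  by rewrite -[RHS](lebesgue_rV_aff v r0 mA).
by rewrite ge0_integral_mscale.
Qed.

(** Cubes play the part of small balls in lower bounds, since their measure is explicit in an
    iterated product. *)
Definition cube n (c : 'rV[R]_n) (d : R) : set 'rV[R]_n :=
  [set x | forall i, `|x ord0 i - c ord0 i| < d].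

Lemma measurable_cube n (c : 'rV[R]_n) d : measurable (cube c d).
Proof.
rewrite (_ : cube c d = \bigcap_(i in [set: 'I_n])
    ((fun x : 'rV[R]_n => x ord0 i : measurableTypeR R) @^-1` `]c ord0 i - d, c ord0 i + d[)).
  apply: fin_bigcap_measurable => // i _.
  by rewrite -[X in measurable X]setTI; apply: measurable_coor.
apply/seteqP; split => x /= H i; first by move=> _; rewrite /= in_itv /= -ltr_distlC distrC.
by have := H i I; rewrite /= in_itv /= -ltr_distlC distrC.
Qed.

Lemma lebesgue_rV_cube n (c : 'rV[R]_n) (d : R) : 0 < d ->
  lebesgue_rV R n (cube c d) = ((d *+ 2) ^+ n)%:E.
Proof.
move=> d0; elim: n c => [c|n IHn c].
  by rewrite /= diracE mem_set ?expr0//= => -[].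
rewrite /= /lebesgue_succ /pushforward.
have -> : vcons (n:=n) @^-1` (cube c d) =
    `]c ord0 ord0 - d, c ord0 ord0 + d[%classic `*` cube (vuncons c).2 d.
  apply/seteqP; split => -[a x] /=.
    move=> H; split.
      by have := H ord0; rewrite mxE unlift_none /= in_itv /= -ltr_distlC distrC.
    by move=> i /=; have := H (lift ord0 i); rewrite !mxE liftK.
  move=> [+ H] i; rewrite in_itv /= -ltr_distlC distrC => ad.
  rewrite mxE; case: unliftP => [j ->|->] //=.
  by have := H j; rewrite mxE.
rewrite product_measure1E; [|by []|exact: measurable_cube].
rewrite IHn [X in (X * _)%E]lebesgue_measure_itv /= lte_fin ltrD2l gtrN//= -EFinD -EFinM exprS; congr EFin.
by congr (_ * _); rewrite mulr2n; ring.
Qed.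

End affine.


(** * Euclidean norm and balls *)

Section euclid.
Context (R : realType) (n : nat).
Implicit Types x y v : 'rV[R]_n.

Definition sqn x : R := \sum_i x ord0 i ^+ 2.

Lemma sqn_ge0 x : 0 <= sqn x.
Proof. by apply: sumr_ge0 => i _; rewrite sqr_ge0. Qed.

Lemma enormE x : enorm x = Num.sqrt (sqn x). Proof. by []. Qed.

Lemma enorm_ge0 x : 0 <= enorm x. Proof. exact: sqrtr_ge0. Qed.

Lemma sqr_enorm x : enorm x ^+ 2 = sqn x.
Proof. by rewrite sqr_sqrtr// sqn_ge0. Qed.

Lemma sqnZ (r : R) x : sqn (r *: x) = r ^+ 2 * sqn x.
Proof. by rewrite /sqn mulr_sumr; apply: eq_bigr => i _; rewrite mxE exprMn. Qed.

Lemma enormZ (r : R) x : enorm (r *: x) = `|r| * enorm x.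
Proof. by rewrite !enormE sqnZ sqrtrM ?sqr_ge0// sqrtr_sqr. Qed.

Lemma enorm0 : enorm (0 : 'rV[R]_n) = 0.
Proof. by rewrite -(scale0r 0) enormZ normr0 mul0r. Qed.

Lemma enorm_eq0 x : enorm x = 0 -> x = 0.
Proof.
move=> /eqP; rewrite sqrtr_eq0 => x0.
have /eqP : sqn x == 0 by rewrite eq_le x0 sqn_ge0.
rewrite /sqn => /eqP; rewrite psumr_eq0; last by move=> i _; rewrite sqr_ge0.
move=> /allP H; apply/rowP => i; rewrite mxE.
by have := H i (mem_index_enum _); rewrite sqrf_eq0 => /eqP.
Qed.

Lemma le_coor_enorm x i : `|x ord0 i| <= enorm x.
Proof.
rewrite -sqrtr_sqr ler_sqrt ?sqn_ge0// /sqn (bigD1 i)//= lerDl.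
by apply: sumr_ge0 => j _; rewrite sqr_ge0.
Qed.

Lemma sqn_comb (p q : R) x y : sqn (p *: x - q *: y) =
  p ^+ 2 * sqn x - 2 * p * q * (\sum_i x ord0 i * y ord0 i) + q ^+ 2 * sqn y.
Proof.
rewrite /sqn !mulr_sumr -sumrB -big_split /=.
by apply: eq_bigr => i _; rewrite !mxE; ring.
Qed.

Lemma cauchy_schwarz x y :
  (\sum_i x ord0 i * y ord0 i) ^+ 2 <= sqn x * sqn y.
Proof.
set a := \sum_i _.
have [y0|y0] := eqVneq (sqn y) 0.
  have /enorm_eq0 yE : enorm y = 0 by rewrite enormE y0 sqrtr0.
  rewrite /a big1 ?expr0n ?mulr_ge0 ?sqn_ge0// => i _.
  by rewrite yE mxE mulr0.
have yp : 0 < sqn y by rewrite lt_def y0 sqn_ge0.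
have : 0 <= sqn (sqn y *: x - a *: y) by exact: sqn_ge0.
have -> : sqn (sqn y *: x - a *: y) = sqn y * (sqn x * sqn y - a ^+ 2).
  rewrite sqn_comb -/a; ring.
by rewrite pmulr_rge0// subr_ge0.
Qed.

Lemma ler_enormD x y : enorm (x + y) <= enorm x + enorm y.
Proof.
rewrite -(@ler_pXn2r _ 2)// ?nnegrE ?addr_ge0 ?enorm_ge0//.
rewrite sqrrD !sqr_enorm.
have -> : sqn (x + y) = sqn x + (\sum_i x ord0 i * y ord0 i) *+ 2 + sqn y.
  rewrite /sqn -mulr_natl mulr_sumr -!big_split /=; apply: eq_bigr => i _.
  by rewrite !mxE; ring.
rewrite lerD2r lerD2l lerMn2r /=.
apply: le_trans (ler_norm _) _.
rewrite -sqrtr_sqr /enorm -sqrtrM ?sqn_ge0// ler_sqrt ?mulr_ge0 ?sqn_ge0//.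
exact: cauchy_schwarz.
Qed.

Lemma enorm_le_sum x : enorm x <= \sum_i `|x ord0 i|.
Proof.
have s0 : 0 <= \sum_i `|x ord0 i| by apply: sumr_ge0.
rewrite -(@ler_pXn2r _ 2)// ?nnegrE ?enorm_ge0// sqr_enorm expr2 mulr_suml.
apply: ler_sum => i _; rewrite -real_normK ?num_real// expr2.
by rewrite ler_wpM2l// (bigD1 i)//= lerDl sumr_ge0.
Qed.

Lemma enormN x : enorm (- x) = enorm x.
Proof. by rewrite -scaleN1r enormZ normrN1 mul1r. Qed.

Definition eball (r : R) : set 'rV[R]_n := [set x | enorm x < r].

Lemma measurable_eball r : measurable (eball r).
Proof.
have -> : eball r = @enorm R n @^-1` `]-oo, r[.
  by apply/seteqP; split=> x /=; rewrite in_itv.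
by rewrite -[X in measurable X]setTI; exact: measurable_enorm.
Qed.

Lemma eball_cube r : eball r `<=` cube 0 r.
Proof.
move=> x xr i; rewrite mxE subr0; exact: le_lt_trans (le_coor_enorm _ _) xr.
Qed.

Local Notation mu := (lebesgue_rV R n).

Lemma cube_fin c (r : R) : 0 < r -> (mu (cube c r) < +oo)%E.
Proof. by move=> r0; rewrite lebesgue_rV_cube// ltry. Qed.

Lemma eball_fin r : (mu (eball r) < +oo)%E.
Proof.
have r1 : 0 < `|r| + 1 by rewrite ltr_pwDr.
apply: le_lt_trans (cube_fin 0 r1); apply: le_measure; rewrite ?inE.
- exact: measurable_eball.
- exact: measurable_cube.
- move=> x xr; apply: eball_cube => /=; apply: lt_le_trans xr _.
  by rewrite (le_trans (ler_norm _))// lerDl.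
Qed.

Lemma bounded_integrable (A : set 'rV[R]_n) (f : 'rV[R]_n -> R) C : measurable A ->
  (mu A < +oo)%E -> measurable_fun A f -> (forall x, A x -> `|f x| <= C) ->
  mu.-integrable A (EFin \o f).
Proof.
move=> mA Af mf fC; apply: measurable_bounded_integrable => //.
exists C; split; first exact: num_real.
by move=> y Cy x Ax /=; apply: le_trans (fC x Ax) (ltW Cy).
Qed.

Lemma unit_ball_fin : (mu (@unit_ball R n) < +oo)%E.
Proof. exact: eball_fin. Qed.

Lemma ball_integrable (f : 'rV[R]_n -> R) C :
  measurable_fun (@unit_ball R n) f -> (forall x, unit_ball x -> `|f x| <= C) ->
  mu.-integrable (@unit_ball R n) (EFin \o f).
Proof.
move=> mf fC; apply: bounded_integrable mf fC; last exact: unit_ball_fin.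
exact: measurable_unit_ball.
Qed.

End euclid.

(** * Directional derivatives and integration by parts *)

Section line.
Context (R : realType) (n : nat).
Implicit Types (F : 'rV[R]_n -> R) (x v : 'rV[R]_n).

(** Both difference quotients are the same function of h. One-variable calculus thus becomes
    available along lines. *)
Lemma is_derive_line F x v d (t : R) :
  is_derive (x + t *: v) v F d <-> is_derive t 1 (fun s => F (x + s *: v)) d.
Proof.
have E : (fun h : R => h^-1 *: ((F \o shift (x + t *: v)) (h *: v) - F (x + t *: v))) =
    (fun h : R => h^-1 *: (((fun s => F (x + s *: v)) \o shift t) (h *: 1) - F (x + t *: v))).
  apply/funext => h /=; congr (_ *: (F _ - _)).
  by rewrite /= [h *: 1]mulr1 scalerDl addrCA.
split=> -[D1 D2]; split.
- by rewrite /derivable -E.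
- by rewrite -D2 /derive E.
- by rewrite /derivable E.
- by rewrite -D2 /derive E.
Qed.

Lemma is_derive_line0 F x v d :
  is_derive x v F d <-> is_derive (0 : R) 1 (fun s => F (x + s *: v)) d.
Proof. by rewrite -is_derive_line scale0r addr0. Qed.

Lemma is_derive_coor x v (i : 'I_n) : is_derive x v (fun y => y ord0 i) (v ord0 i).
Proof.
apply/is_derive_line0.
rewrite (_ : (fun _ => _) = (cst (x ord0 i) + v ord0 i *: (@idfun R)))%R; last first.
  by apply/funext => s; rewrite !mxE /= mulrC.
by apply: is_derive_eq; rewrite add0r -[RHS]mulr1.
Qed.

Lemma is_derive_comp1 (f : R -> R) (F : 'rV[R]_n -> R) x v df dF :
  is_derive (F x) (1 : R) f df -> is_derive x v F dF ->
  is_derive x v (f \o F) (df * dF).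
Proof.
move=> Df /is_derive_line0 DF; apply/is_derive_line0.
have E : F x = (fun s : R => F (x + s *: v)) 0 by rewrite scale0r addr0.
rewrite E in Df.
have := @is_derive1_comp _ f (fun s : R => F (x + s *: v)) 0 df dF Df DF.
by rewrite mulrC.
Qed.

Lemma line_MVT F dF x v (h : R) : 0 < h ->
  (forall y, is_derive y v F (dF y)) ->
  exists2 t, 0 < t < h & F (x + h *: v) - F x = h * dF (x + t *: v).
Proof.
move=> h0 D.
have D' (t : R) : is_derive t 1 (fun s => F (x + s *: v)) (dF (x + t *: v)).
  by apply/is_derive_line.
have [] := @MVT R (fun s => F (x + s *: v)) (fun t => dF (x + t *: v)) 0 h h0.
- apply: derivable_within_continuous => t t01.
  by have [] := D' t.
move=> t; rewrite in_itv /= => th; rewrite scale0r addr0 subr0 => ->.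
by exists t => //; rewrite mulrC.
Qed.

End line.

Section ibp.
Context (R : realType) (n : nat).
Local Notation mu := (lebesgue_rV R n).
Implicit Types (F dF : 'rV[R]_n -> R).

Lemma measurable_comp_aff d (T : measurableType d) (f : 'rV[R]_n -> T) (r : R) (v : 'rV[R]_n) :
  measurable_fun setT f -> measurable_fun setT (fun x : 'rV[R]_n => f (r *: x + v)).
Proof. by move=> mf; exact: measurableT_comp mf (measurable_aff r v). Qed.

Lemma integrable_aff (f : 'rV[R]_n -> \bar R) (r : R) (v : 'rV[R]_n) : 0 < r ->
  mu.-integrable setT f -> mu.-integrable setT (fun x : 'rV[R]_n => f (r *: x + v)).
Proof.
move=> r0 /integrableP[mf foo]; apply/integrableP; split.
  exact: measurable_comp_aff.
have := @ge0_integral_aff R n r v (abse \o f) r0 (measurableT_comp (@abse_measurable _ _) mf) (fun x => abse_ge0 _).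
move=> /= ->.
by rewrite lte_mul_pinfty// lee_fin exprn_ge0// invr_ge0 ltW.
Qed.

Lemma integral_aff (f : 'rV[R]_n -> \bar R) (r : R) (v : 'rV[R]_n) : 0 < r ->
  mu.-integrable setT f ->
  (\int[mu]_x f (r *: x + v)%R = (r^-1 ^+ n)%:E * \int[mu]_x f x)%E.
Proof.
move=> r0 intf; have /integrableP[mf _] := intf.
rewrite integralE [in RHS]integralE muleBr//; last first.
  by apply: fin_num_adde_defr; exact: integrable_pos_fin_num.
congr (_ - _)%E.
  rewrite -(ge0_integral_aff v r0 (measurable_funepos mf) (@funepos_ge0 _ _ f)).
  by apply: eq_integral => x _; rewrite !funeposE.
rewrite -(ge0_integral_aff v r0 (measurable_funeneg mf) (@funeneg_ge0 _ _ f)).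
by apply: eq_integral => x _; rewrite !funenegE.
Qed.

Lemma measurable_translate d (T : measurableType d) (f : 'rV[R]_n -> T) (v : 'rV[R]_n) :
  measurable_fun setT f -> measurable_fun setT (fun x : 'rV[R]_n => f (x + v)).
Proof.
move=> /(measurable_comp_aff 1 v); congr (measurable_fun _ _).
by apply/funext => x; rewrite scale1r.
Qed.

Lemma integrable_translate (f : 'rV[R]_n -> \bar R) (v : 'rV[R]_n) :
  mu.-integrable setT f -> mu.-integrable setT (fun x : 'rV[R]_n => f (x + v)).
Proof.
move=> /(integrable_aff v ltr01); congr (integrable _ _ _).
by apply/funext => x; rewrite scale1r.
Qed.

Lemma integral_translate (f : 'rV[R]_n -> \bar R) (v : 'rV[R]_n) :
  mu.-integrable setT f ->
  (\int[mu]_x f (x + v)%R = \int[mu]_x f x)%E.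
Proof.
move=> /(integral_aff v ltr01); rewrite invr1 expr1n mul1e => <-.
by apply: eq_integral => x _; rewrite scale1r.
Qed.

Definition ev (i : 'I_n) : 'rV[R]_n := delta_mx ord0 i.

Lemma enorm_ev i : enorm (ev i) = 1.
Proof.
rewrite /enorm (bigD1 i)//= big1 ?addr0.
  by rewrite mxE !eqxx expr1n sqrtr1.
by move=> j ji; rewrite mxE (negbTE ji) andbF expr0n.
Qed.

(** Translation invariance makes the integral of every difference quotient vanish; dominated
    convergence passes to the derivative, the domination coming from the mean value theorem. [F] is
    differentiable across the sphere, so no boundary term appears. *)
Lemma integral_partial_eq0 F dF i (C : R) :
  measurable_fun setT F -> measurable_fun setT dF ->
  (forall x, is_derive x (ev i) F (dF x)) ->
  (forall x, `|dF x| <= C) ->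
  (forall x, ~ unit_ball x -> F x = 0) ->
  (forall x, ~ unit_ball x -> dF x = 0) ->
  mu.-integrable (@unit_ball R n) (EFin \o F) ->
  (\int[mu]_(x in @unit_ball R n) (dF x)%:E = 0)%E.
Proof.
move=> mF mdF D dFC F0 dF0 iF.
have C0 : 0 <= C := le_trans (normr_ge0 _) (dFC 0).
have iFT : mu.-integrable setT (EFin \o F).
  have /(integrable_mkcond _ (@measurable_unit_ball R n)) := iF.
  rewrite (_ : _ \_ _ = EFin \o F)//; apply/funext => x; rewrite /restrict /=.
  by case: ifPn => // /negP xB; rewrite F0// => xB'; apply: xB; rewrite inE.
pose hh (m : nat) : R := m.+1%:R^-1.
have hh0 m : 0 < hh m by rewrite invr_gt0.
have hh1 m : hh m <= 1 by rewrite invf_le1// ler1n.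
have mshift m : measurable_fun setT (fun x : 'rV[R]_n => F (x + hh m *: ev i)).
  by apply: measurable_translate.
pose g (m : nat) (x : 'rV[R]_n) : \bar R := ((hh m)^-1 * (F (x + hh m *: ev i) - F x))%:E.
(* The shifts have length at most 1, so a difference quotient vanishes unless |x| < 2. *)
pose G := (fun x : 'rV[R]_n => (C * \1_(cube 0 2) x)%:E).
have mg m : measurable_fun setT (g m).
  apply/measurable_EFinP; apply: measurable_funM => //.
  by apply: measurable_funB => //; exact: mshift.
have g_shift m x : F (x + hh m *: ev i) - F x != 0 -> cube 0 2 x.
  move=> FF; have [xB|xB] := pselect (unit_ball x).
    by apply: eball_cube; apply: lt_trans xB _; rewrite ltr1n.
  have [xB'|xB'] := pselect (unit_ball (x + hh m *: ev i)); last first.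
    by move: FF; rewrite !F0// subrr eqxx.
  apply: eball_cube => /=.
  rewrite -[x](addrK (hh m *: ev i)).
  apply: le_lt_trans (ler_enormD _ _) _; rewrite enormN enormZ enorm_ev mulr1 (ger0_norm (ltW _))//.
  by have := hh1 m; move: xB'; rewrite /unit_ball /=; lra.
have g_le m x : (`|g m x| <= G x)%E.
  rewrite /g /G /= lee_fin indicE.
  have [E|E] := eqVneq (F (x + hh m *: ev i) - F x) 0.
    by rewrite E mulr0 normr0 mulr_ge0.
  rewrite mem_set ?mulr1; last exact: g_shift E.
  have [t _ ->] := line_MVT x (hh0 m) D.
  by rewrite mulrA mulVf ?mul1r// gt_eqF.
have int_g m : (\int[mu]_x g m x = 0)%E.
  rewrite /g; under eq_integral do rewrite EFinM EFinB.
  have iS : mu.-integrable setT (fun x : 'rV[R]_n => (F (x + hh m *: ev i))%:E).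
    exact: (integrable_translate (hh m *: ev i) iFT).
  rewrite integralZl//; last exact: (integrableB measurableT iS iFT).
  rewrite integralB//.
  rewrite (integral_translate (hh m *: ev i) iFT) subee ?mule0//.
  exact: integrable_fin_num.
have [] := @dominated_convergence _ _ R mu setT measurableT g (fun x => (dF x)%:E) G.
- by move=> m; exact: mg.
- exact/measurable_EFinP.
- apply: aeW => x _.
  have [D1 D2] := D x.
  have hhP : (forall m, hh m != 0) /\ hh m @[m --> \oo] --> (0 : R).
    by split=> [m|]; [rewrite gt_eqF|exact: cvg_harmonic].
  have H : (h^-1 *: ((F \o shift x) (h *: ev i) - F x)) @[h --> (0:R)^'] --> dF x.
    by rewrite -D2; exact: D1.
  have := (cvgr_dnbhsP _ _ _).1 H hh hhP => H'.
  apply: cvg_EFin; first by apply: nearW.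
  rewrite (_ : _ \o _ = (fun m => (hh m)^-1 *: ((F \o shift x) (hh m *: ev i) - F x)))//.
  by apply/funext => m; rewrite /= [hh m *: _ + x]addrC.
- have : mu.-integrable (cube 0 2) (EFin \o cst C).
    apply: (@bounded_integrable _ _ _ _ `|C|) => //.
    - exact: measurable_cube.
    - exact: cube_fin.
  move=> /(integrable_mkcond _ (@measurable_cube R n 0 2)).
  congr (integrable _ _ _); apply/funext => x; rewrite /restrict /G /= indicE.
  by case: ifPn => _; rewrite ?mulr1 ?mulr0.
- by apply: aeW => x m _; exact: g_le.
move=> _ _.
rewrite (_ : [sequence _]_n = cst 0%E); last by apply/funext => m; exact: int_g.
move=> /(cvg_lim (@ereal_hausdorff R)); rewrite lim_cst// => E.
rewrite [LHS]integral_mkcond [RHS]E; apply: eq_integral => x _; rewrite /restrict.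
by case: ifPn => // /negP xB; rewrite dF0// => xB'; apply: xB; rewrite inE.
Qed.

End ibp.


(** * Polynomial functions *)

Section polynomials.
Context (R : realType) (n : nat).
Local Notation mu := (lebesgue_rV R n).
Implicit Types (p q : mpoly.mpoly n R) (x v : 'rV[R]_n).

Definition pev p x : R := mpoly.meval (fun i => x ord0 i) p.

Lemma pevC c x : pev (mpoly.mpolyC n c) x = c.
Proof. exact: mpoly.mevalC. Qed.
Lemma pevX i x : pev (mpoly.mpolyX R (mpoly.mnm1 i)) x = x ord0 i.
Proof. exact: mpoly.mevalXU. Qed.
Lemma pevD p q x : pev (p + q) x = pev p x + pev q x.
Proof. exact: mpoly.mevalD. Qed.
Lemma pevM p q x : pev (p * q) x = pev p x * pev q x.
Proof. exact: mpoly.mevalM. Qed.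
Lemma pev1 x : pev 1 x = 1.
Proof. exact: mpoly.meval1. Qed.
Lemma pevN p x : pev (- p) x = - pev p x.
Proof. exact: mpoly.mevalN. Qed.
Lemma pev0 x : pev 0 x = 0.
Proof. exact: mpoly.meval0. Qed.
Lemma pev_sum (I : Type) (s : seq I) (P : pred I) (f : I -> mpoly.mpoly n R) x :
  pev (\sum_(i <- s | P i) f i) x = \sum_(i <- s | P i) pev (f i) x.
Proof. exact: (raddf_sum (mpoly.meval (fun i => x ord0 i))). Qed.

Lemma pevCE c : pev (mpoly.mpolyC n c) = cst c.
Proof. by apply/funext => x; exact: pevC. Qed.
Lemma pevXE i : pev (mpoly.mpolyX R (mpoly.mnm1 i)) = (fun x => x ord0 i).
Proof. by apply/funext => x; exact: pevX. Qed.
Lemma pevDE p q : pev (p + q) = pev p \+ pev q.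
Proof. by apply/funext => x; exact: pevD. Qed.
Lemma pevME p q : pev (p * q) = pev p \* pev q.
Proof. by apply/funext => x; exact: pevM. Qed.

(** Monomials are broken up into variables, so that analytic properties need checking only on
    constants and coordinates, with closure under sums and products. *)
Lemma poly_ind (P : mpoly.mpoly n R -> Prop) :
  (forall c, P (mpoly.mpolyC n c)) ->
  (forall i, P (mpoly.mpolyX R (mpoly.mnm1 i))) ->
  (forall p q, P p -> P q -> P (p + q)) ->
  (forall p q, P p -> P q -> P (p * q)) -> forall p, P p.
Proof.
move=> PC PX PD PM; apply: mpoly.mpolyind => [|c m p _ _ Pp].
  by rewrite -(mpoly.mpolyC0 n); exact: PC.
apply: PD => //; rewrite -mpoly.mul_mpolyC; apply: (PM) => //.
rewrite mpoly.mpolyXE_id; apply: (big_ind P); first exact: (PC 1).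
  exact: PM.
move=> i _; elim: (m i) => [|k IHk]; first by rewrite expr0; exact: (PC 1).
by rewrite exprS; exact: PM.
Qed.

Lemma is_derive_pev p x v :
  is_derive x v (pev p) (\sum_i v ord0 i * pev (mpoly.mderiv i p) x).
Proof.
elim/poly_ind: p => [c|i|p q IHp IHq|p q IHp IHq].
- rewrite big1; last by move=> i _; rewrite mpoly.mderivC pev0 mulr0.
  by rewrite pevCE; exact: is_derive_cst.
- rewrite pevXE.
  rewrite (bigD1 i)//= big1 ?addr0; last first.
    move=> j ji; rewrite mpoly.mderivX mpoly.mnm1E eq_sym (negbTE ji) scale0r.
    by rewrite pev0 mulr0.
  rewrite mpoly.mderivX mpoly.mnm1E eqxx scale1r.
  rewrite (_ : mpoly.mnm_sub _ _ = mpoly.mnm0); last first.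
    by apply/mpoly.mnmP => j; rewrite mpoly.mnmBE subnn mpoly.mnm0E.
  by rewrite mpoly.mpolyX0 /pev mpoly.meval1 mulr1; exact: is_derive_coor.
- rewrite pevDE.
  rewrite -[_ \+ _]/(pev p + pev q); apply: is_derive_eq; rewrite -big_split; apply: eq_bigr => i _ /=.
  by rewrite mpoly.mderivD pevD mulrDr.
- rewrite pevME.
  rewrite -[_ \* _]/(pev p * pev q); apply: is_derive_eq; rewrite /GRing.scale /= !mulr_sumr -big_split; apply: eq_bigr => i _ /=.
  by rewrite mpoly.mderivM pevD !pevM; ring.
Qed.

Lemma is_derive_pev_ev p x i : is_derive x (ev R i) (pev p) (pev (mpoly.mderiv i p) x).
Proof.
have := is_derive_pev p x (ev R i).
rewrite (bigD1 i)//= big1 ?addr0.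
  by rewrite mxE !eqxx mul1r.
by move=> j ji; rewrite mxE (negbTE ji) andbF mul0r.
Qed.

Lemma measurable_pev p : measurable_fun setT (pev p : 'rV[R]_n -> R).
Proof.
elim/poly_ind: p => [c|i|p q IHp IHq|p q IHp IHq].
- by rewrite pevCE.
- rewrite pevXE; exact: measurable_coor.
- rewrite pevDE.
  exact: measurable_funD.
- rewrite pevME.
  exact: measurable_funM.
Qed.

Lemma continuous_pev p : continuous (pev p).
Proof.
elim/poly_ind: p => [c|i|p q IHp IHq|p q IHp IHq] x.
- by rewrite pevCE; exact: cst_continuous.
- rewrite pevXE; exact: coord_continuous.
- rewrite pevDE.
  by apply: continuousD; [exact: IHp|exact: IHq].
- rewrite pevME.
  by apply: continuousM; [exact: IHp|exact: IHq].
Qed.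

Lemma pev_bounded p (r : R) : exists2 C : R, 0 <= C & forall x, enorm x <= r -> `|pev p x| <= C.
Proof.
elim/poly_ind: p => [c|i|p q [C1 C10 IHp] [C2 C20 IHq]|p q [C1 C10 IHp] [C2 C20 IHq]].
- by exists `|c| => // x _; rewrite pevC.
- exists `|r| => // x xr; rewrite pevX; apply: le_trans (le_coor_enorm _ _) _.
  exact: le_trans xr (ler_norm _).
- exists (C1 + C2) => [|x xr]; first exact: addr_ge0.
  by rewrite pevD (le_trans (ler_normD _ _))// lerD ?IHp ?IHq.
- exists (C1 * C2) => [|x xr]; first exact: mulr_ge0.
  by rewrite pevM normrM ler_pM ?IHp ?IHq.
Qed.

Definition lap p := \sum_(i < n) mpoly.mderiv i (mpoly.mderiv i p).

Definition homog k p := p \is mpoly.ishomog1 k (@mpoly.mdeg n).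

Lemma pev_homog k p c x : homog k p -> pev p (c *: x) = c ^+ k * pev p x.
Proof.
move=> /mpoly.dhomogP hp; rewrite /pev !mpoly.mevalE mulr_sumr big_seq [RHS]big_seq.
apply: eq_bigr => m /hp <-; rewrite mulrCA; congr (_ * _).
rewrite -[X in c ^+ X]/(mpoly.mdeg m) mpoly.mdegE -prodrXr -big_split /=; apply: eq_bigr => i _.
by rewrite mxE exprMn.
Qed.

(** Euler's identity: differentiate p((1 + s) x) = (1 + s)^k p(x) at s = 0. *)
Lemma euler k p x : homog k p ->
  \sum_i x ord0 i * pev (mpoly.mderiv i p) x = k%:R * pev p x.
Proof.
move=> hp.
have /is_derive_line0 [_ <-] := is_derive_pev p x x.
have D2 : is_derive (0 : R) 1 (pev p x *: ((cst 1 + (@idfun R)) ^+ k)) (k%:R * pev p x).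
  apply: is_derive_eq; rewrite /= add0r /GRing.scale /= !fctE addr0 expr1n mulr1.
  by rewrite mulr1 mulrC.
rewrite (_ : (fun s => _) = (pev p x) *: ((cst 1 + (@idfun R)) ^+ k)).
  by have [_] := D2.
apply/funext => s; rewrite -{1}(scale1r x) -scalerDl (pev_homog _ _ hp) mulrC.
by rewrite /GRing.scale /= fctE.
Qed.

Lemma mderiv_comm_lap p i : lap p = 0 -> lap (mpoly.mderiv i p) = 0.
Proof.
rewrite /lap => H.
transitivity (mpoly.mderiv i (\sum_(j < n) mpoly.mderiv j (mpoly.mderiv j p))).
  rewrite raddf_sum; apply: eq_bigr => j _.
  by rewrite (mpoly.mderiv_comm i j) (mpoly.mderiv_comm i j).
by rewrite H raddf0.
Qed.

End polynomials.


(** * Integrals over the unit ball against radial weights *)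

Section integrals.
Context (R : realType) (n : nat).
Local Notation mu := (lebesgue_rV R n).
Local Notation B := (@unit_ball R n).
Implicit Types (f g : 'rV[R]_n -> R).

(** Measurability is global but the bound is asked only on the ball, so polynomials qualify and the
    class is closed under products; every member is integrable on the ball. *)
Definition bndmeas f := measurable_fun setT f /\ exists C : R, forall x, B x -> `|f x| <= C.

Definition Ib f : R := Rintegral mu B f.

Lemma bndmeas_integrable f : bndmeas f -> mu.-integrable B (EFin \o f).
Proof.
move=> [mf [C fC]]; apply: (ball_integrable _ fC).
exact: measurable_funTS.
Qed.

Lemma Ib_EFin f : bndmeas f -> ((Ib f)%:E = \int[mu]_(x in B) (f x)%:E)%E.
Proof.
move=> /bndmeas_integrable i; rewrite /Ib /Rintegral fineK//.
exact: (integrable_fin_num (@measurable_unit_ball R n) i).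
Qed.

Lemma bndmeas_cst c : bndmeas (fun=> c).
Proof. by split; [exact: measurable_cst|exists `|c|]. Qed.

Lemma bndmeasD f g : bndmeas f -> bndmeas g -> bndmeas (fun x => f x + g x).
Proof.
move=> [mf [C fC]] [mg [D gD]]; split; first exact: measurable_funD.
by exists (C + D) => x Bx; rewrite (le_trans (ler_normD _ _))// lerD ?fC ?gD.
Qed.

Lemma bndmeasM f g : bndmeas f -> bndmeas g -> bndmeas (fun x => f x * g x).
Proof.
move=> [mf [C fC]] [mg [D gD]]; split; first exact: measurable_funM.
by exists (C * D) => x Bx; rewrite normrM ler_pM ?fC ?gD.
Qed.

Lemma bndmeasZ c f : bndmeas f -> bndmeas (fun x => c * f x).
Proof. by move=> Hf; apply: bndmeasM => //; exact: bndmeas_cst. Qed.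

Lemma bndmeasN f : bndmeas f -> bndmeas (fun x => - f x).
Proof.
move=> [mf [C fC]]; split; first exact: measurableT_comp.
by exists C => x Bx; rewrite normrN fC.
Qed.

Lemma bndmeasB f g : bndmeas f -> bndmeas g -> bndmeas (fun x => f x - g x).
Proof. by move=> Hf Hg; apply: bndmeasD => //; exact: bndmeasN. Qed.

Lemma bndmeas_norm f : bndmeas f -> bndmeas (fun x => `|f x|).
Proof.
move=> [mf [C fC]]; split; first exact: measurableT_comp.
by exists C => x Bx; rewrite normr_id fC.
Qed.

Lemma bndmeas_sum (I : Type) (s : seq I) (F : I -> 'rV[R]_n -> R) :
  (forall i, bndmeas (F i)) -> bndmeas (fun x => \sum_(i <- s) F i x).
Proof.
move=> HF; elim: s => [|i s IHs].
  by under eq_fun do rewrite big_nil; exact: bndmeas_cst.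
by under eq_fun do rewrite big_cons; exact: bndmeasD.
Qed.

Lemma bndmeas_pev p : bndmeas (pev p).
Proof.
split; first exact: measurable_pev.
have [C _ HC] := pev_bounded p 1; exists C => x Bx; apply: HC; exact: ltW.
Qed.

Lemma IbD f g : bndmeas f -> bndmeas g -> Ib (fun x => f x + g x) = Ib f + Ib g.
Proof.
move=> Hf Hg; apply: RintegralD; [exact: measurable_unit_ball| |];
exact: bndmeas_integrable.
Qed.

Lemma IbB f g : bndmeas f -> bndmeas g -> Ib (fun x => f x - g x) = Ib f - Ib g.
Proof.
move=> Hf Hg; apply: RintegralB; [exact: measurable_unit_ball| |];
exact: bndmeas_integrable.
Qed.

Lemma IbZ c f : bndmeas f -> Ib (fun x => c * f x) = c * Ib f.
Proof.
by move=> Hf; apply: RintegralZl; [exact: measurable_unit_ball|exact: bndmeas_integrable].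
Qed.

Lemma Ib_sum (I : Type) (s : seq I) (F : I -> 'rV[R]_n -> R) :
  (forall i, bndmeas (F i)) ->
  Ib (fun x => \sum_(i <- s) F i x) = \sum_(i <- s) Ib (F i).
Proof.
move=> HF; elim: s => [|i s IHs].
  rewrite big_nil -[RHS](mul0r (Ib (fun=> 0))) -IbZ; last exact: bndmeas_cst.
  by congr Ib; apply/funext => x; rewrite big_nil mul0r.
rewrite big_cons -IHs -IbD//; last exact: bndmeas_sum.
by congr Ib; apply/funext => x; rewrite big_cons.
Qed.

Lemma eq_Ib f g : (forall x, B x -> f x = g x) -> Ib f = Ib g.
Proof. by move=> fg; apply: eq_Rintegral => x; rewrite inE; exact: fg. Qed.

Lemma le_Ib f g : bndmeas f -> bndmeas g -> (forall x, B x -> f x <= g x) -> Ib f <= Ib g.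
Proof.
move=> Hf Hg fg; apply: le_Rintegral => //; try exact: bndmeas_integrable.
exact: measurable_unit_ball.
Qed.

Lemma Ib_ge0 f : (forall x, B x -> 0 <= f x) -> 0 <= Ib f.
Proof. exact: Rintegral_ge0. Qed.

Lemma ler_norm_Ib f : bndmeas f -> `|Ib f| <= Ib (fun x => `|f x|).
Proof.
move=> Hf; apply: le_normr_Rintegral; last exact: bndmeas_integrable.
exact: measurable_unit_ball.
Qed.

End integrals.

(** * Radial weights and the divergence identities they satisfy *)

Section radial.
Context (R : realType) (n : nat).
Local Notation mu := (lebesgue_rV R n).
Local Notation B := (@unit_ball R n).

(** Vanishing from t = 1 on makes the radial function vanish off the open ball. The argument is
    |x|^2 rather than |x|, which keeps differentiability at the origin. *)
Definition weight (w : R -> R) := continuous w /\ forall t, 1 <= t -> w t = 0.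

Definition radial (w : R -> R) (x : 'rV[R]_n) : R := w (sqn x).

Lemma measurable_sqn : measurable_fun setT (@sqn R n).
Proof.
apply: measurable_sum => i.
by apply: measurable_funX; exact: measurable_coor.
Qed.

Lemma sqn_ge1 x : ~ B x -> 1 <= sqn x.
Proof.
move=> /negP; rewrite -leNgt -sqr_enorm => x1; rewrite -[leLHS](expr1n _ 2).
by rewrite ler_pXn2r ?nnegrE ?ler01 ?enorm_ge0.
Qed.

Lemma weight_bounded w : weight w -> exists C : R, forall t, 0 <= t -> `|w t| <= C.
Proof.
move=> [cw w0].
have [c _ Hc] := @EVT_max R (fun t => `|w t|) 0 1 ler01
  (continuous_subspaceT (fun t => continuous_comp (cw t) (@norm_continuous _ _ _))).
exists `|w c| => t t0; have [t1|t1] := leP t 1; first by apply: Hc; rewrite in_itv /= t0.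
by rewrite w0 ?normr0// ltW.
Qed.

Lemma measurable_radial w : continuous w -> measurable_fun setT (radial w).
Proof.
move=> cw; apply: (measurableT_comp (continuous_measurable_fun cw)).
exact: measurable_sqn.
Qed.

Lemma bndmeas_radial w : weight w -> bndmeas (radial w).
Proof.
move=> Hw; split; first by apply: measurable_radial; case: Hw.
have [C HC] := weight_bounded Hw; exists C => x _; apply: HC; exact: sqn_ge0.
Qed.

Lemma is_derive_sqn x v : is_derive x v (@sqn R n) (2 * \sum_i v ord0 i * x ord0 i).
Proof.
rewrite /sqn.
rewrite (_ : (fun _ => _) = \sum_i (fun x : 'rV[R]_n => x ord0 i) ^+ 2); last first.
  by apply/funext => y; rewrite fct_sumE.
have := fun i => is_derive_coor x v i.
move=> D.
apply: is_derive_eq; rewrite mulr_sumr; apply: eq_bigr => i _.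
by rewrite /GRing.scale /= expr1; ring.
Qed.

Lemma is_derive_radial Psi w x i : (forall t : R, is_derive t (1 : R) Psi (w t)) ->
  is_derive x (ev R i) (radial Psi) (radial w x * (2 * x ord0 i)).
Proof.
move=> D; apply: (@is_derive_comp1 _ _ Psi (@sqn R n) x _ (w (sqn x))).
have := is_derive_sqn x (ev R i); rewrite (bigD1 i)//= big1 ?addr0.
  by rewrite mxE !eqxx mul1r.
by move=> j ji; rewrite mxE (negbTE ji) andbF mul0r.
Qed.

(** The product of [radial Psi] and [q] and its partial derivative vanish outside the ball, so the
    integral of the derivative is zero; the product rule expands it. *)
Lemma ibp_radial Psi w (q dq : 'rV[R]_n -> R) i :
  weight Psi -> weight w -> (forall t : R, is_derive t (1 : R) Psi (w t)) ->
  (forall x, is_derive x (ev R i) q (dq x)) -> bndmeas q -> bndmeas dq ->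
  Ib (fun x => radial w x * (2 * x ord0 i) * q x + radial Psi x * dq x) = 0.
Proof.
move=> HP Hw D Dq Hq Hdq.
have bc : bndmeas (fun x : 'rV[R]_n => x ord0 i).
  by rewrite -pevXE; exact: bndmeas_pev.
pose F x := radial Psi x * q x.
pose dF x := radial w x * (2 * x ord0 i) * q x + radial Psi x * dq x.
have HdF : bndmeas dF.
  apply: bndmeasD.
    apply: bndmeasM => //; apply: bndmeasM; first exact: bndmeas_radial.
    exact: bndmeasZ.
  by apply: bndmeasM => //; exact: bndmeas_radial.
have HF : bndmeas F by apply: bndmeasM => //; exact: bndmeas_radial.
have radout v : weight v -> forall x, ~ B x -> radial v x = 0.
  by move=> [_ v0] x /sqn_ge1; exact: v0.
have dF0 x : ~ B x -> dF x = 0.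
  by move=> xB; rewrite /dF !radout// !mul0r addr0.
have [_ [C HC]] := HdF.
have DF x : is_derive x (ev R i) F (dF x).
  have D1 := is_derive_radial x i D; have D2 := Dq x.
  rewrite (_ : F = radial Psi * q); last by apply/funext.
  apply: is_derive_eq; rewrite /GRing.scale /= /dF; ring.
have := @integral_partial_eq0 R n F dF i `|C| (proj1 HF) (proj1 HdF) DF.
rewrite -Ib_EFin// => H; apply: EFin_inj; apply: H.
- move=> x; have [xB|xB] := pselect (B x); last by rewrite dF0// normr0.
  exact: le_trans (HC _ xB) (ler_norm _).
- by move=> x xB; rewrite /F radout// mul0r.
- exact: dF0.
- exact: bndmeas_integrable.
Qed.

Lemma ibp_radial_sum Psi w (q dq : 'I_n -> 'rV[R]_n -> R) :
  weight Psi -> weight w -> (forall t : R, is_derive t (1 : R) Psi (w t)) ->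
  (forall i x, is_derive x (ev R i) (q i) (dq i x)) ->
  (forall i, bndmeas (q i)) -> (forall i, bndmeas (dq i)) ->
  Ib (fun x => radial w x * (2 * \sum_i x ord0 i * q i x) + radial Psi x * \sum_i dq i x) = 0.
Proof.
move=> HP Hw D Dq Hq Hdq.
rewrite -[RHS](@big1_eq R 0 +%R 'I_n (index_enum _) xpredT).
rewrite -[RHS](eq_bigr _ (fun i _ => ibp_radial HP Hw D (Dq i) (Hq i) (Hdq i))).
rewrite -Ib_sum.
  apply: eq_Ib => x _; rewrite big_split /= !mulr_sumr; congr (_ + _).
  by apply: eq_bigr => i _; ring.
move=> i; have bc : bndmeas (fun x : 'rV[R]_n => x ord0 i).
  by rewrite -pevXE; exact: bndmeas_pev.
have := bndmeas_radial HP; have := bndmeas_radial Hw => r1 r2.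
by apply: bndmeasD; apply: bndmeasM => //; apply: bndmeasM => //; exact: bndmeasZ.
Qed.

(* Green's identity: integrate by parts the field
   [Psi(|x|^2) (p grad q - q grad p)], whose divergence is
   [2 (k - j) w(|x|^2) p q] when [Psi' = w]. *)
Lemma radial_orthogonality Psi w j k p q :
  weight Psi -> weight w -> (forall t : R, is_derive t (1 : R) Psi (w t)) ->
  homog j p -> homog k q -> lap p = 0 -> lap q = 0 -> j <> k ->
  Ib (fun x => radial w x * (pev p x * pev q x)) = 0.
Proof.
move=> HP Hw D hp hq lp lq jk.
pose d i := @mpoly.mderiv n R i.
pose Q i := p * d i q - q * d i p.
have H := @ibp_radial_sum Psi w (fun i => pev (Q i)) (fun i => pev (d i (Q i))) HP Hw D
  (fun i x => is_derive_pev_ev (Q i) x i)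
  (fun i => bndmeas_pev (Q i)) (fun i => bndmeas_pev (d i (Q i))).
have bpq : bndmeas (fun x => radial w x * (pev p x * pev q x)).
  apply: bndmeasM; first exact: bndmeas_radial.
  by apply: bndmeasM; exact: bndmeas_pev.
have : 2 * (k%:R - j%:R) * Ib (fun x => radial w x * (pev p x * pev q x)) = 0.
  rewrite -H -IbZ//; apply: eq_Ib => x _.
  have -> : \sum_i pev (d i (Q i)) x = 0.
    rewrite -pev_sum; apply: etrans (pev0 x); congr (pev _ x).
    transitivity (p * lap q - q * lap p); last by rewrite lp lq !mulr0 subrr.
    rewrite /lap !mulr_sumr -sumrB; apply: eq_bigr => i _.
    by rewrite /Q /d mpoly.mderivB !mpoly.mderivM; ring.
  have -> : \sum_i x ord0 i * pev (Q i) x = (k%:R - j%:R) * (pev p x * pev q x).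
    transitivity (pev p x * (\sum_i x ord0 i * pev (d i q) x) -
                  pev q x * (\sum_i x ord0 i * pev (d i p) x)).
      rewrite !mulr_sumr -sumrB; apply: eq_bigr => i _.
      by rewrite /Q pevD pevN !pevM; ring.
    by rewrite (euler _ hp) (euler _ hq); ring.
  by ring.
move=> /eqP; rewrite !mulf_eq0 pnatr_eq0 /= subr_eq0 eqr_nat => /orP[/eqP kj|/eqP//].
by case: jk.
Qed.

(* The left-hand side is the integral of [p] against the divergence of the field
   [x psi(|x|^2) q]. *)
Lemma weighted_divergence psi dpsi l k p q :
  weight psi -> weight dpsi -> (forall t : R, is_derive t (1 : R) psi (dpsi t)) ->
  homog l p -> homog k q ->
  Ib (fun x => pev p x * ((n%:R + k%:R) * radial psi x + 2 * sqn x * radial dpsi x) * pev q x) =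
  - l%:R * Ib (fun x => radial psi x * (pev p x * pev q x)).
Proof.
move=> HP Hw D hp hq.
pose d i := @mpoly.mderiv n R i.
pose Q i := mpoly.mpolyX R (mpoly.mnm1 i) * (p * q).
have H := @ibp_radial_sum psi dpsi (fun i => pev (Q i)) (fun i => pev (d i (Q i))) HP Hw D
  (fun i x => is_derive_pev_ev (Q i) x i)
  (fun i => bndmeas_pev (Q i)) (fun i => bndmeas_pev (d i (Q i))).
have bpq : bndmeas (fun x => radial psi x * (pev p x * pev q x)).
  apply: bndmeasM; first exact: bndmeas_radial.
  by apply: bndmeasM; exact: bndmeas_pev.
have E (x : 'rV[R]_n) : \sum_i x ord0 i * pev (Q i) x = sqn x * (pev p x * pev q x).
  rewrite /sqn mulr_suml; apply: eq_bigr => i _.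
  by rewrite /Q !pevM pevX; ring.
have E2 (x : 'rV[R]_n) : \sum_i pev (d i (Q i)) x = (n%:R + l%:R + k%:R) * (pev p x * pev q x).
  transitivity (\sum_(i < n) (pev p x * pev q x +
      pev q x * (x ord0 i * pev (d i p) x) +
      pev p x * (x ord0 i * pev (d i q) x))).
    apply: eq_bigr => i _.
    rewrite /Q /d !mpoly.mderivM !(pevD, pevM) pevX.
    rewrite mpoly.mderivX mpoly.mnm1E eqxx scale1r.
    rewrite (_ : mpoly.mnm_sub _ _ = mpoly.mnm0); last first.
      by apply/mpoly.mnmP => j; rewrite mpoly.mnmBE subnn mpoly.mnm0E.
    by rewrite mpoly.mpolyX0 pev1; ring.
  rewrite !big_split /= -!mulr_sumr.
  rewrite (euler _ hp) (euler _ hq) sumr_const card_ord -mulr_natl.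
  by ring.
rewrite -IbZ// -[LHS]subr0 -[X in _ - X]H -IbB.
- by apply: eq_Ib => x _; rewrite E E2; ring.
- apply: bndmeasM; last exact: bndmeas_pev.
  apply: bndmeasM; first exact: bndmeas_pev.
  apply: bndmeasD; first by apply: bndmeasZ; exact: bndmeas_radial.
  apply: bndmeasM; last exact: bndmeas_radial.
  apply: bndmeasZ; apply: bndmeas_sum => i.
  by apply: bndmeasM; rewrite -pevXE; exact: bndmeas_pev.
- apply: bndmeasD; apply: bndmeasM; try exact: bndmeas_radial.
    apply: bndmeasZ; apply: bndmeas_sum => i.
    by apply: bndmeasM; [rewrite -pevXE|]; exact: bndmeas_pev.
  by apply: bndmeas_sum => i; exact: bndmeas_pev.
Qed.

End radial.


(** * Smooth bump functions *)

Section bump.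
Context (R : realType).

Definition bumpf (m : nat) (t : R) : R := if 0 < t then t ^- m * expR (- t^-1) else 0.

Lemma bumpf_ge0 m t : 0 <= bumpf m t.
Proof.
by rewrite /bumpf; case: ifPn => // t0; rewrite mulr_ge0 ?expR_ge0// invr_ge0 exprn_ge0// ltW.
Qed.

Lemma bumpf_le0 m t : t <= 0 -> bumpf m t = 0.
Proof. by rewrite /bumpf leNgt => /negbTE ->. Qed.

(** With s = 1/t this is s^m <= m^m e^s, the mth power of s/m <= e^(s/m); the case m = 0 is
    separate. *)
Lemma bumpf_le m t : bumpf m t <= m%:R ^+ m.
Proof.
rewrite /bumpf; case: ifPn => [t0|_]; last by rewrite exprn_ge0.
case: m => [|m]; first by rewrite expr0 invr1 mul1r expr0 -expR0 ler_expR oppr_le0 invr_ge0 ltW.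
rewrite expRN ler_pdivrMr ?expR_gt0// -exprVn.
have -> : expR t^-1 = expR (t^-1 / m.+1%:R) ^+ m.+1.
  by rewrite -expRM_natl mulrC divfK// pnatr_eq0.
rewrite -exprMn ler_pXn2r// ?nnegrE.
- rewrite -ler_pdivrMl//; apply: le_trans (expR_ge1Dx _).
  by rewrite mulrC lerDr.
- by rewrite invr_ge0 ltW.
- by rewrite mulr_ge0// expR_ge0.
Qed.

Lemma bumpf_lin m t : bumpf m t = `|t| * bumpf m.+1 t.
Proof.
rewrite /bumpf; case: ifPn => [t0|_]; last by rewrite mulr0.
by rewrite gtr0_norm// exprS invfM !mulrA mulfV ?mul1r// gt_eqF.
Qed.

Lemma is_derive_bumpf m (t : R) :
  is_derive t (1:R) (bumpf m) (- m%:R * bumpf m.+1 t + bumpf m.+2 t).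
Proof.
have [t0|t0|<-] := ltgtP 0 t.
- have t0' : t != 0 by rewrite gt_eqF.
  apply: (@near_eq_is_derive _ _ _ (fun s : R => s^-1 ^+ m * expR (- s^-1))).
    near=> s; rewrite /bumpf exprVn.
    suff -> : 0 < s by [].
    by near: s; exact: lt_nbhsr.
  have D1 : is_derive t (1:R) (fun s : R => s^-1) (- t ^- 2).
    have D0 := @is_deriveV _ (@idfun R) t 1 1 t0' _.
    by apply: is_derive_eq; rewrite /GRing.scale /= mulr1.
  have D2 : is_derive t (1:R) (expR \o (fun s : R => - s^-1)) (expR (- t^-1) * t ^- 2).
    apply: is_derive_eq.
    by rewrite opprK.
  have -> : (fun s : R => s^-1 ^+ m * expR (- s^-1)) =
     (fun s : R => s^-1) ^+ m * (expR \o (fun s : R => - s^-1)).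
    by apply/funext => s; rewrite /GRing.mul /= fctE.
  apply: is_derive_eq; rewrite /GRing.scale /bumpf t0 /= fctE.
  rewrite -[1 *- m]/(- (m%:R)) -!exprVn; set a := t^-1; set E := expR _.
  case: m => [|m]; first by rewrite /= !exprS !expr0; ring.
  by rewrite /= !exprS -natr1; ring.
- apply: (@near_eq_is_derive _ _ _ (cst 0)).
    near=> s; rewrite bumpf_le0//= ltW//.
    by near: s; exact: lt_nbhsl.
  by rewrite !bumpf_le0 ?ltW// mulr0 addr0; exact: is_derive_cst.
- rewrite !bumpf_le0// mulr0 addr0.
  (* At the origin the quotient equals in absolute value |h| times [bumpf m.+2 h], which is at most
     |h| (m+2)^(m+2). *)
  have H : (h^-1 *: ((bumpf m \o shift 0) (h *: 1) - bumpf m 0)) @[h --> (0:R)^'] --> (0:R).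
    apply/cvgr0Pnorm_lt => e e0; near=> h.
    have hh : `|h| < e / (m.+2%:R ^+ m.+2 + 1).
      by near: h; apply: dnbhs0_lt; rewrite divr_gt0// ltr_wpDl// exprn_ge0.
    rewrite /= (bumpf_le0 m (lexx 0)) addr0 subr0 [h *: 1]mulr1 normrM.
    rewrite (bumpf_lin m) (bumpf_lin m.+1) !normrM normr_id.
    rewrite (ger0_norm (bumpf_ge0 _ _)).
    have h0 : `|h| != 0 by rewrite normr_eq0; near: h; exact: nbhs_dnbhs_neq.
    rewrite normfV mulrA mulVf// mul1r.
    rewrite ltr_pdivlMr in hh; last by rewrite ltr_wpDl// exprn_ge0.
    apply: le_lt_trans hh; rewrite ler_wpM2l//.
    by apply: le_trans (bumpf_le _ _) _; rewrite lerDl.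
  by split; [apply/cvg_ex; exists 0|apply/cvg_lim].
Unshelve. all: by end_near.
Qed.

End bump.


Section scaled_bump.
Context (R : realType).

(** For c > 0 it is positive exactly for t < b, and c^(-1) is the width of the transition at b. *)
Definition bw (c b : R) (m : nat) (t : R) : R := bumpf m (c * (b - t)).
Definition dbw (c b : R) (m : nat) (t : R) : R :=
  - c * (- m%:R * bw c b m.+1 t + bw c b m.+2 t).

Lemma is_derive_bw c b m (t : R) : is_derive t (1:R) (bw c b m) (dbw c b m t).
Proof.
have D : is_derive t (1:R) (c *: (cst b - (@idfun R))) (- c).
  by apply: is_derive_eq; rewrite sub0r /GRing.scale /= mulrN1.
rewrite (_ : bw c b m = bumpf m \o (c *: (cst b - (@idfun R)))); last exact/funext.
rewrite /dbw; have D2 := is_derive_bumpf m ((c *: (cst b - (@idfun R))) t).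
rewrite [- c * _]mulrC; exact: (@is_derive1_comp _ _ _ _ _ _ D2 D).
Qed.

Lemma weight_bw c b m : 0 < c -> b <= 1 -> weight (bw c b m).
Proof.
move=> c0 b1; split.
  move=> t; have [D _] := is_derive_bw c b m t.
  exact/differentiable_continuous/derivable1_diffP.
move=> t t1; rewrite /bw bumpf_le0// pmulr_rle0// subr_le0.
exact: le_trans b1 t1.
Qed.

Lemma weightD (v w : R -> R) : weight v -> weight w -> weight (fun t => v t + w t).
Proof.
move=> [cv v0] [cw w0]; split; last by move=> t t1; rewrite v0// w0// addr0.
by move=> t; apply: cvgD; [exact: cv|exact: cw].
Qed.

Lemma weightZ a (v : R -> R) : weight v -> weight (fun t => a * v t).
Proof.
move=> [cv v0]; split; last by move=> t t1; rewrite v0// mulr0.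
by move=> t; apply: cvgMr; exact: cv.
Qed.

Lemma weight_dbw c b m : 0 < c -> b <= 1 -> weight (dbw c b m).
Proof.
by move=> c0 b1; apply: weightZ; apply: weightD; [apply: weightZ|]; exact: weight_bw.
Qed.

(* [f_0' = f_2] for [f_m t = t^-m exp(-1/t)], so the weight [f_2] has an explicit
   compactly supported primitive. *)
Definition pbw (c b t : R) : R := - c^-1 * bw c b 0 t.

Lemma weight_pbw c b : 0 < c -> b <= 1 -> weight (pbw c b).
Proof. by move=> c0 b1; apply: weightZ; exact: weight_bw. Qed.

Lemma is_derive_pbw c b (t : R) : 0 < c -> is_derive t (1:R) (pbw c b) (bw c b 2 t).
Proof.
move=> c0; rewrite (_ : pbw c b = - c^-1 *: bw c b 0); last exact/funext.
have D := is_derive_bw c b 0 t.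
apply: is_derive_eq; rewrite /dbw /GRing.scale /= oppr0 mul0r add0r.
by rewrite mulrA mulrNN mulVf ?mul1r// gt_eqF.
Qed.

End scaled_bump.

(** * Mean values and gradients of harmonic polynomials *)

Section mean_value.
Context (R : realType) (n : nat).
Local Notation mu := (lebesgue_rV R n).
Local Notation B := (@unit_ball R n).
Implicit Types (p : mpoly.mpoly n R) (x y : 'rV[R]_n).

(** Averages are taken against this smooth radial density instead of over spheres. The index 2 is
    the one with an explicit compactly supported primitive, [pbw]. *)
Definition mvw : R -> R := bw 1 1 2.
Definition Kmv : 'rV[R]_n -> R := radial mvw.

Lemma bndmeas_Kmv : bndmeas Kmv.
Proof. by apply: bndmeas_radial; exact: weight_bw. Qed.

Lemma bndmeas_pev_aff p (t : R) x : bndmeas (fun y => pev p (x + t *: y)).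
Proof.
split.
  rewrite (_ : (fun y => _) = pev p \o (fun y => t *: y + x)).
    exact: measurableT_comp (measurable_pev p) (measurable_aff t x).
  by apply/funext => y; rewrite /= addrC.
have [C _ HC] := pev_bounded p (enorm x + `|t|); exists C => y By; apply: HC.
apply: le_trans (ler_enormD _ _) _; rewrite lerD2l enormZ.
by rewrite ler_piMr//; exact: ltW.
Qed.

Lemma is_derive_pev_aff p (t : R) x y i :
  is_derive y (ev R i) (fun y => pev p (x + t *: y)) (t * pev (mpoly.mderiv i p) (x + t *: y)).
Proof.
apply/is_derive_line0.
rewrite (_ : (fun s => _) = fun s => pev p ((x + t *: y) + s *: (t *: ev R i))); last first.
  apply/funext => s; congr (pev p _).
  by rewrite scalerDr addrA !scalerA mulrC.
apply/is_derive_line0.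
have := is_derive_pev p (x + t *: y) (t *: ev R i).
rewrite (bigD1 i)//= big1 ?addr0.
  by rewrite !mxE !eqxx mulr1.
by move=> j ji; rewrite !mxE (negbTE ji) andbF mulr0 mul0r.
Qed.

Definition mvA p x (t : R) : R := Ib (fun y => Kmv y * pev p (x + t *: y)).

Lemma is_derive_mvA p x (t : R) : lap p = 0 -> is_derive t (1:R) (mvA p x) 0.
Proof.
move=> lp.
pose f (t : R) y := Kmv y * pev p (x + t *: y).
pose df (t : R) y := Kmv y * \sum_i y ord0 i * pev (mpoly.mderiv i p) (x + t *: y).
have Df (s : R) y : is_derive s (1:R) (fun s => f s y) (df s y).
  have D : is_derive s (1:R) (fun s => pev p (x + s *: y))
      (\sum_i y ord0 i * pev (mpoly.mderiv i p) (x + s *: y)).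
    by apply/is_derive_line; exact: is_derive_pev.
  rewrite (_ : (fun s => f s y) = Kmv y *: (fun s => pev p (x + s *: y))); last exact/funext.
  exact: is_derive_eq.
have Ef s y : partial1of2 f s y = df s y.
  by rewrite partial1of2E; have [_] := Df s y.
have [C1 HC1] : exists C : R, forall y, B y -> `|Kmv y| <= C by case: bndmeas_Kmv.
have HC i : exists C : R, 0 <= C /\ forall s y, s \in `]t - 1, t + 1[ -> B y ->
    `|pev (mpoly.mderiv i p) (x + s *: y)| <= C.
  have [C C0 HC] := pev_bounded (mpoly.mderiv i p) (enorm x + (`|t| + 1)).
  exists C; split=> // s y; rewrite in_itv /= => /andP[s1 s2] By; apply: HC.
  apply: le_trans (ler_enormD _ _) _; rewrite lerD2l enormZ.
  have st : `|s| <= `|t| + 1.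
    rewrite -{1}(subrK t s) addrC (le_trans (ler_normD _ _))// lerD2l ler_norml; lra.
  by rewrite -[leRHS]mulr1 ler_pM// ?enorm_ge0// ltW.
pose C i := sval (cid (HC i)).
have CP i := svalP (cid (HC i)).
pose G : 'rV[R]_n -> R := fun=> `|C1| * \sum_i C i.
have tI : (`]t - 1, t + 1[%classic : set R) t by rewrite /= in_itv /=; lra.
have G0 y : 0 <= G y.
  by rewrite mulr_ge0// sumr_ge0// => i _; have [] := CP i.
have H1 (s : R) : (`]t - 1, t + 1[%classic : set R) s -> mu.-integrable B (EFin \o f s).
  move=> _; apply: bndmeas_integrable; apply: bndmeasM; first exact: bndmeas_Kmv.
  exact: bndmeas_pev_aff.
have H2 (s : R) y : (`]t - 1, t + 1[%classic : set R) s -> B y -> derivable (f ^~ y) s 1.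
  by move=> _ _; have [] := Df s y.
have H3 : mu.-integrable B (EFin \o G).
  by apply: bndmeas_integrable; exact: bndmeas_cst.
have H4 (s : R) y : (`]t - 1, t + 1[%classic : set R) s -> B y -> `|partial1of2 f s y| <= G y.
  move=> si By; rewrite Ef /df /G normrM ler_pM//.
    by apply: le_trans (HC1 _ By) (ler_norm _).
  apply: le_trans (ler_norm_sum _ _ _) _; apply: ler_sum => i _.
  rewrite normrM -[leRHS]mul1r ler_pM//; last by have [_] := CP i; apply.
  by apply: le_trans (le_coor_enorm _ _) (ltW By).
have D1 := derivable_under_integral (@measurable_unit_ball R n) tI H1 H2 G0 H3 H4.
have D2 := differentiation_under_integral (@measurable_unit_ball R n) tI H1 H2 G0 H3 H4.
split; first exact: D1.
rewrite -derive1E [LHS]D2.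
rewrite (_ : Rintegral _ _ _ = Ib (df t)); last first.
  by apply: eq_Rintegral => y _; exact: Ef.
pose q i y := pev (mpoly.mderiv i p) (x + t *: y).
pose dq i y := t * pev (mpoly.mderiv i (mpoly.mderiv i p)) (x + t *: y).
have := @ibp_radial_sum R n (pbw 1 1) mvw q dq (weight_pbw ltr01 (lexx 1))
  (weight_bw 2 ltr01 (lexx 1)) (fun s => is_derive_pbw 1 s ltr01)
  (fun i y => is_derive_pev_aff (mpoly.mderiv i p) t x y i)
  (fun i => bndmeas_pev_aff (mpoly.mderiv i p) t x)
  (fun i => bndmeasZ t (bndmeas_pev_aff (mpoly.mderiv i (mpoly.mderiv i p)) t x)).
rewrite (_ : (fun x0 => _) = (fun y => 2 * df t y)).
  rewrite IbZ => [/eqP|].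
    by rewrite mulf_eq0 pnatr_eq0 /= => /eqP.
  apply: bndmeasM; first exact: bndmeas_Kmv.
  apply: bndmeas_sum => i; apply: bndmeasM; last exact: bndmeas_pev_aff.
  by rewrite -pevXE; exact: bndmeas_pev.
apply/funext => y; rewrite -mulr_sumr -pev_sum -/(lap p) lp pev0 !mulr0 addr0.
by rewrite /df /Kmv mulrCA.
Qed.

(* The weighted average over the ball of radius [t] centred at [x] has zero
   derivative in [t]: [mvw] has a compactly supported primitive, so the derivative
   integrates by parts to a multiple of the Laplacian. *)
Lemma mean_value p x (d : R) : lap p = 0 ->
  Ib (fun y => Kmv y * pev p (x + d *: y)) = Ib Kmv * pev p x.
Proof.
move=> lp; rewrite -/(mvA p x d).
rewrite (is_derive_0_is_cst d 0 (fun t => is_derive_mvA x t lp)).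
rewrite mulrC -IbZ; last exact: bndmeas_Kmv.
by apply: eq_Ib => y _; rewrite scale0r addr0 mulrC.
Qed.

Lemma Ib_ge_cube (f : 'rV[R]_n -> R) (c : 'rV[R]_n) (r k : R) : bndmeas f -> 0 < r ->
  0 <= k -> (forall x, B x -> 0 <= f x) ->
  cube c r `<=` B -> (forall x, cube c r x -> k <= f x) ->
  k * (r *+ 2) ^+ n <= Ib f.
Proof.
move=> Hf r0 k0 f0 cB kf.
have mc : measurable (cube c r) by exact: measurable_cube.
rewrite -lee_fin Ib_EFin// EFinM -(lebesgue_rV_cube c r0).
rewrite -integral_cst//.
apply: (@le_trans _ _ (\int[mu]_(x in cube c r) (f x)%:E)%E).
  apply: ge0_le_integral => //.
  by apply/measurable_EFinP; apply: measurable_funTS; case: Hf.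
apply: ge0_subset_integral => //; first exact: measurable_unit_ball.
by apply/measurable_EFinP; apply: measurable_funTS; case: Hf.
Qed.

Lemma Ib_Kmv_gt0 : 0 < Ib Kmv.
Proof.
(* The sum of n coordinates of size r is at most 1/2, so |x|^2 <= 1/2 on the cube and the kernel is
   at least e^(-2) there. *)
pose r : R := (n.+1%:R * 2)^-1.
have r0 : 0 < r by rewrite invr_gt0 mulr_gt0.
have cs x : cube 0 r x -> sqn x <= 2^-1.
  move=> xc; have x1 : enorm x <= 2^-1.
    apply: le_trans (enorm_le_sum _) _.
    apply: (@le_trans _ _ (\sum_(i < n) r)).
      by apply: ler_sum => i _; have := xc i; rewrite mxE subr0 => /ltW.
    rewrite sumr_const card_ord -[leLHS]mulr_natl /r ler_pdivrMr ?mulr_gt0//.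
    by rewrite mulrCA mulVf// mulr1 ler_nat.
  rewrite -sqr_enorm; have := enorm_ge0 x; rewrite expr2; nra.
have cB : cube 0 r `<=` B.
  move=> x /cs; rewrite -sqr_enorm => x1; rewrite /unit_ball /=.
  by rewrite -(@expr_lt1 _ 2)// ?enorm_ge0//; lra.
apply: lt_le_trans (@Ib_ge_cube Kmv 0 r (expR (- 2)) bndmeas_Kmv r0 (expR_ge0 _) _ cB _).
- by rewrite mulr_gt0 ?expR_gt0// exprn_gt0// mulrn_wgt0.
- by move=> x _; exact: bumpf_ge0.
- move=> x /cs x1; rewrite /Kmv /radial /mvw /bw /bumpf mul1r.
  have s0 := sqn_ge0 x.
  have t0 : 0 < 1 - sqn x by lra.
  rewrite t0 -[leLHS]mul1r ler_pM ?expR_ge0//.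
    rewrite -exprVn exprn_ege1// invf_ge1//; lra.
  rewrite ler_expR lerN2 -[leRHS]invrK lef_pV2 ?posrE ?invr_gt0//; lra.
Qed.

(* The point is that the constant does not depend on the degree of [p]. *)
Lemma gradient_estimate : exists2 C : R, 0 < C & forall p x (d M : R) i, 0 < d ->
  lap p = 0 -> (forall z, enorm (z - x) < d -> `|pev p z| <= M) ->
  `|pev (mpoly.mderiv i p) x| <= C / d * M.
Proof.
pose w2 := @dbw R 1 1 2.
have Hw2 : weight w2 by exact: weight_dbw.
have bw2 : bndmeas (fun y : 'rV[R]_n => 2 * `|radial w2 y|).
  by apply: bndmeasZ; apply: bndmeas_norm; exact: bndmeas_radial.
pose C0 := Ib (fun y : 'rV[R]_n => 2 * `|radial w2 y|).
have C00 : 0 <= C0 by apply: Ib_ge0 => y _; rewrite mulr_ge0.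
have K0 := Ib_Kmv_gt0.
exists ((C0 + 1) / Ib Kmv) => [|p x d M i d0 lp pM]; first by rewrite divr_gt0// ltr_wpDl.
have M0 : 0 <= M.
  by apply: le_trans (pM x _); rewrite ?subrr ?enorm0.
(* The derivative of [p] is harmonic, so the mean value identity applies to it; an integration by
   parts then moves the derivative onto the kernel at the cost of 1/d. Only the kernel enters the
   constant; the [+ 1] in it ensures positivity. *)
have := mean_value x d (mderiv_comm_lap i lp) => mv.
have := ibp_radial (weight_bw 2 ltr01 (lexx 1)) Hw2 (is_derive_bw 1 1 2)
  (fun y => is_derive_pev_aff p d x y i) (bndmeas_pev_aff p d x)
  (bndmeasZ d (bndmeas_pev_aff (mpoly.mderiv i p) d x)).
have bc : bndmeas (fun x : 'rV[R]_n => x ord0 i) by rewrite -pevXE; exact: bndmeas_pev.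
have b1 : bndmeas (fun y => radial w2 y * (2 * y ord0 i) * pev p (x + d *: y)).
  apply: bndmeasM; last exact: bndmeas_pev_aff.
  by apply: bndmeasM; [exact: bndmeas_radial|exact: bndmeasZ].
have b2 : bndmeas (fun y => Kmv y * pev (mpoly.mderiv i p) (x + d *: y)).
  by apply: bndmeasM; [exact: bndmeas_Kmv|exact: bndmeas_pev_aff].
rewrite (_ : (fun x0 => _) = (fun y => radial w2 y * (2 * y ord0 i) * pev p (x + d *: y) +
  d * (Kmv y * pev (mpoly.mderiv i p) (x + d *: y)))); last first.
  by apply/funext => y; congr (_ + _); exact: mulrCA.
rewrite IbD//; last exact: bndmeasZ.
rewrite IbZ// mv => /eqP; rewrite addrC addr_eq0 => /eqP E.
have le1 : `|d * (Ib Kmv * pev (mpoly.mderiv i p) x)| <= C0 * M.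
  rewrite E normrN; apply: le_trans (ler_norm_Ib b1) _.
  rewrite mulrC -IbZ//; apply: le_Ib; [exact: bndmeas_norm|exact: bndmeasZ|].
  move=> y By; rewrite normrM mulrC ler_pM//.
    apply: pM; rewrite addrAC subrr add0r enormZ gtr0_norm//.
    by rewrite gtr_pMr.
  rewrite normrM mulrC ler_wpM2r// normrM [`|2|]ger0_norm// ler_piMr//.
  by apply: le_trans (le_coor_enorm _ _) (ltW By).
rewrite !normrM (gtr0_norm d0) (gtr0_norm K0) in le1.
have -> : (C0 + 1) / Ib Kmv / d * M = ((C0 + 1) * M) / (d * Ib Kmv).
  by field; rewrite !gt_eqF.
by rewrite ler_pdivlMr ?mulr_gt0//; lra.
Qed.

End mean_value.


(** * Dominated series of harmonic polynomials *)

Section dominated_series.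
Context (R : realType).
Implicit Types (f M : R^nat).

Lemma series_dominated_cvg f M : cvgn (series M) -> (forall k, `|f k| <= M k) -> cvgn (series f).
Proof.
move=> cM fM; apply: normed_cvg; apply: (@series_le_cvg _ _ M) => // k.
- exact: normr_ge0.
- by rewrite (le_trans _ (fM k)).
Qed.

Lemma dominated_tail f M N : cvgn (series M) -> (forall k, `|f k| <= M k) ->
  `|limn (series f) - series f N| <= limn (series M) - series M N.
Proof.
move=> cM fM; have cf := series_dominated_cvg cM fM.
have c1 : `|series f m - series f N| @[m --> \oo] --> `|limn (series f) - series f N|.
  by apply: cvg_norm; apply: cvgB => //; exact: cvg_cst.
have c2 : series M m - series M N @[m --> \oo] --> limn (series M) - series M N.
  by apply: cvgB => //; exact: cvg_cst.
apply: ler_cvg_to c1 c2 _.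
near=> m.
have Nm : (N <= m)%N by near: m; exists N.
rewrite !sub_series_geq//; apply: le_trans (ler_norm_sum _ _ _) _.
by apply: ler_sum.
Unshelve. all: by end_near. Qed.

Lemma dominated_norm f M : cvgn (series M) -> (forall k, `|f k| <= M k) ->
  `|limn (series f)| <= limn (series M).
Proof.
move=> cM fM; have := dominated_tail 0 cM fM.
by rewrite !seriesEnat /= !big_geq// !subr0.
Qed.

Lemma tail_small M (e : R) : cvgn (series M) -> 0 < e ->
  exists N, limn (series M) - series M N < e.
Proof.
move=> /cvgrPdist_lt /(_ e) H e0; have [N _ HN] := H e0.
by exists N; apply: le_lt_trans (ler_norm _) (HN N _) => /=.
Qed.

(** Two applications of the mean value theorem give K h^2 in place of the sharp K h^2 / 2. Negative
    h is reduced to positive h by reflection. *)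
Lemma taylor2 (f f1 f2 : R -> R) (h K : R) :
  (forall t : R, is_derive t (1:R) f (f1 t)) -> (forall t : R, is_derive t (1:R) f1 (f2 t)) ->
  (forall t, `|t| <= `|h| -> `|f2 t| <= K) ->
  `|f h - f 0 - h * f1 0| <= K * h ^+ 2.
Proof.
move=> D1 D2 fK.
wlog h0 : h f f1 f2 D1 D2 fK / 0 < h.
  move=> W; have [h0|h0|<-] := ltgtP 0 h; first exact: (W h f f1 f2).
    have N t : is_derive t (1:R) (fun s : R => - s) (-1).
      exact: is_deriveNid.
    have DN (g g' : R -> R) : (forall t : R, is_derive t (1:R) g (g' t)) ->
        forall t : R, is_derive t (1:R) (fun s => g (- s)) (- g' (- t)).
      move=> D t; have := @is_derive1_comp _ g (fun s => - s) t _ _ (D (- t)) (N t).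
      by rewrite mulrN1.
    have := W (- h) (fun s => f (- s)) (fun s => - f1 (- s)) (fun s => f2 (- s)) (DN _ _ D1).
    rewrite !opprK oppr0 sqrrN mulrNN; apply.
    - move=> t; rewrite -[f2 (- t)]opprK.
      have := DN _ _ D2 t => D3.
      exact: (is_deriveN D3).
- by move=> t; rewrite normrN => ht; apply: fK; rewrite normrN.
    - by rewrite oppr_gt0.
  by rewrite mul0r subrr subr0 normr0 expr0n mulr0.
have [] := @MVT R f f1 0 h h0 (fun t _ => D1 t).
  by apply: derivable_within_continuous => t _; have [] := D1 t.
move=> c; rewrite in_itv /= => /andP[c0 ch]; rewrite subr0 => ->.
have [] := @MVT R f1 f2 0 c c0 (fun t _ => D2 t).
  by apply: derivable_within_continuous => t _; have [] := D2 t.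
move=> d; rewrite in_itv /= => /andP[d0 dc]; rewrite subr0 => E.
rewrite mulrC -mulrBr E !normrM (gtr0_norm h0) (gtr0_norm c0).
have Kd : `|f2 d| <= K by apply: fK; rewrite !gtr0_norm//; lra.
rewrite expr2 [leRHS]mulrCA ler_pM2l// ler_pM//; exact: ltW.
Qed.

End dominated_series.

(** * Term-by-term differentiation *)

Section harmonic_series.
Context (R : realType) (n : nat).
Local Notation mu := (lebesgue_rV R n).
Local Notation B := (@unit_ball R n).
Implicit Types (x : 'rV[R]_n) (Q : nat -> mpoly.mpoly n R) (M : R^nat).

Definition psum Q x : R := limn (series (fun k => pev (Q k) x)).

Lemma sqn_continuous : continuous (@sqn R n).
Proof.
rewrite (_ : @sqn R n = pev (\sum_i (mpoly.mpolyX R (mpoly.mnm1 i)) ^+ 2)).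
  exact: continuous_pev.
apply/funext => y; rewrite pev_sum; apply: eq_bigr => i _.
by rewrite !expr2 pevM pevX.
Qed.

Lemma enorm_continuous : continuous (@enorm R n).
Proof.
move=> x; apply: (@continuous_comp _ _ _ (@sqn R n) (@Num.sqrt R)).
  exact: sqn_continuous.
exact: sqrt_continuous.
Qed.

Lemma open_eball r : open (@eball R n r).
Proof.
have -> : @eball R n r = @enorm R n @^-1` [set t | t < r] by [].
by apply: open_comp; [move=> x _; exact: enorm_continuous|exact: open_lt].
Qed.

Definition dominated_on (A : set 'rV[R]_n) Q M :=
  forall k x, A x -> `|pev (Q k) x| <= M k.

Lemma psum_continuous A Q M : cvgn (series M) -> dominated_on A Q M ->
  {within A, continuous (psum Q)}.
Proof.
move=> cM dQ; apply/subspace_continuousP => x Ax.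
apply/cvgrPdist_lt => e e0.
have e3 : 0 < e / 3 by rewrite divr_gt0.
have [N HN] := tail_small cM e3.
pose S y : R := series (fun k => pev (Q k) y) N.
have cS : S y @[y --> x] --> S x.
  rewrite /S (_ : (fun y => _) = pev (\sum_(0 <= k < N) Q k)).
    rewrite (_ : series _ N = pev (\sum_(0 <= k < N) Q k) x); first exact: continuous_pev.
    by rewrite seriesEnat /= pev_sum.
  by apply/funext => y; rewrite seriesEnat /= pev_sum.
have tl y : A y -> `|psum Q y - S y| < e / 3.
  by move=> Ay; apply: le_lt_trans HN; apply: dominated_tail => // k; exact: dQ.
have /cvgrPdist_lt /(_ _ e3) cS3 := cS.
rewrite near_withinE; near=> y => Ay.
have -> : psum Q x - psum Q y = (psum Q x - S x) + (S x - S y) - (psum Q y - S y) by ring.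
apply: le_lt_trans (ler_normB _ _) _; apply: le_lt_trans (lerD (ler_normD _ _) (lexx _)) _.
have := tl _ Ax; have := tl _ Ay.
have : `|S x - S y| < e / 3 by near: y.
lra.
Unshelve. all: by end_near. Qed.

(** The Taylor remainders of the terms, bounded by [M2 k * h ^+ 2], sum to K h^2; hence the
    difference quotient of the sum differs from the sum of the derivatives by at most K |h|. *)
Lemma psum_is_derive Q (M0 M1 M2 : R^nat) r x i :
  cvgn (series M0) -> cvgn (series M1) -> cvgn (series M2) ->
  dominated_on (eball r) Q M0 ->
  dominated_on (eball r) (fun k => mpoly.mderiv i (Q k)) M1 ->
  dominated_on (eball r) (fun k => mpoly.mderiv i (mpoly.mderiv i (Q k))) M2 ->
  enorm x < r ->
  is_derive x (ev R i) (psum Q) (psum (fun k => mpoly.mderiv i (Q k)) x).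
Proof.
move=> c0 c1 c2 d0 d1 d2 xr.
set L := psum _ x.
pose K := limn (series M2).
have K0 : 0 <= K.
  by apply: le_trans (dominated_norm c2 (fun k => d2 k x xr)).
have key (h : R) : `|h| < r - enorm x -> `|psum Q (x + h *: ev R i) - psum Q x - h * L| <= K * h ^+ 2.
  move=> hr.
  have xh (t : R) : `|t| <= `|h| -> eball r (x + t *: ev R i).
    move=> th; rewrite /eball /=; apply: le_lt_trans (ler_enormD _ _) _.
    by rewrite enormZ enorm_ev mulr1; lra.
  have cQ y : eball r y -> cvgn (series (fun k => pev (Q k) y)).
    by move=> yr; apply: series_dominated_cvg c0 _ => k; exact: d0.
  have cQ1 : cvgn (series (fun k => pev (mpoly.mderiv i (Q k)) x)).
    by apply: series_dominated_cvg c1 _ => k; exact: d1.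
  rewrite /L /psum -[h * _](lim_seriesZ h cQ1) -lim_seriesB; last 2 first.
  - by apply: cQ; exact: xh.
  - exact: cQ.
  rewrite -lim_seriesB; last 2 first.
  - by apply: is_cvg_seriesB; apply: cQ => //; exact: xh.
  - exact: is_cvg_seriesZ.
  rewrite mulrC -[X in _ <= X](lim_seriesZ (h ^+ 2) c2).
  apply: dominated_norm; first exact: is_cvg_seriesZ.
  move=> k; rewrite !fctE /= /GRing.scale /= mulrC.
  have := @taylor2 R (fun t => pev (Q k) (x + t *: ev R i))
    (fun t => pev (mpoly.mderiv i (Q k)) (x + t *: ev R i))
    (fun t => pev (mpoly.mderiv i (mpoly.mderiv i (Q k))) (x + t *: ev R i)) h (M2 k).
  rewrite scale0r addr0 mulrC [M2 k * _]mulrC; apply.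
  - by move=> t; apply/is_derive_line; exact: is_derive_pev_ev.
  - by move=> t; apply/is_derive_line; exact: is_derive_pev_ev.
  - by move=> t th; apply: d2; exact: xh.
have H : (h^-1 *: ((psum Q \o shift x) (h *: ev R i) - psum Q x)) @[h --> (0:R)^'] --> L.
  apply/cvgrPdist_lt => e e0; near=> h.
  have h0 : h != 0 by near: h; exact: nbhs_dnbhs_neq.
  have h1 : `|h| < r - enorm x by near: h; apply: dnbhs0_lt; rewrite subr_gt0.
  have h2 : `|h| < e / (K + 1) by near: h; apply: dnbhs0_lt; rewrite divr_gt0// ltr_wpDl.
  rewrite /= [h *: _ + x]addrC /GRing.scale /=.
  have hn : 0 < `|h| by rewrite normr_gt0.
  rewrite -(ltr_pM2l hn) -normrM mulrBr mulrA mulfV// mul1r -normrN opprB.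
  apply: le_lt_trans (key h h1) _.
  rewrite ltr_pdivlMr in h2; last by rewrite ltr_wpDl.
  rewrite -[h ^+ 2]ger0_norm ?sqr_ge0// normrX expr2 mulrCA ltr_pM2l// mulrC.
  by apply: le_lt_trans h2; rewrite ler_pM2l// lerDl.
by split; [apply/cvg_ex; exists L|apply/cvg_lim].
Unshelve. all: by end_near. Qed.

Section harmonic_sum.
Variables (P : nat -> mpoly.mpoly n R) (M : R^nat).
Hypothesis lP : forall k, lap (P k) = 0.
Hypothesis cM : cvgn (series M).
Hypothesis dP : dominated_on B P M.

Definition mderivs (l : seq 'I_n) (p : mpoly.mpoly n R) := foldr (@mpoly.mderiv n R) p l.

Lemma lap_mderivs l p : lap p = 0 -> lap (mderivs l p) = 0.
Proof. by move=> lp; elim: l => //= i l IH; exact: mderiv_comm_lap. Qed.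

(** Each derivative uses up half of the remaining distance to the sphere. The gradient estimate on
    balls of radius r' - r costs a factor independent of k, so every derivative is dominated by a
    multiple of the same series [M]. *)
Lemma mderivs_dominated l r : r < 1 -> exists C : R,
  dominated_on (eball r) (fun k => mderivs l (P k)) (C *: M).
Proof.
elim: l r => [|i l IH] r r1.
  exists 1 => k x xr; rewrite scale1r; apply: dP.
  exact: lt_trans xr r1.
pose r' := (r + 1) / 2.
have r'1 : r' < 1 by rewrite /r'; lra.
have [C HC] := IH r' r'1.
have [G G0 HG] := gradient_estimate R n.
exists (G / (r' - r) * C) => k x xr /=.
rewrite -scalerA; apply: (HG _ _ _ ((C *: M) k)).
- by rewrite /r'; lra.
- by apply: lap_mderivs.
- move=> z zx; apply: HC; rewrite /eball /=.
  rewrite -(subrK x z); apply: le_lt_trans (ler_enormD _ _) _.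
  by move: xr zx; rewrite /eball /=; lra.
Qed.

Lemma psum_is_derive_mderivs l x i : B x ->
  is_derive x (ev R i) (psum (fun k => mderivs l (P k)))
    (psum (fun k => mderivs (i :: l) (P k)) x).
Proof.
move=> Bx; pose r := (enorm x + 1) / 2.
have xr : enorm x < r by move: Bx; rewrite /unit_ball /r /=; lra.
have r1 : r < 1 by move: Bx; rewrite /unit_ball /r /=; lra.
have [C0 H0] := mderivs_dominated l r1.
have [C1 H1] := mderivs_dominated (i :: l) r1.
have [C2 H2] := mderivs_dominated [:: i, i & l] r1.
by apply: psum_is_derive H0 H1 H2 xr; exact: is_cvg_seriesZ.
Qed.

Lemma near_unit_ball x : B x -> \forall y \near x, B y.
Proof. by move=> Bx; apply: open_nbhs_nbhs; split=> //; exact: open_eball. Qed.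

Variable u : 'rV[R]_n -> R.
Hypothesis uE : forall x, B x -> u x = psum P x.

Lemma partialsE l x : B x -> partials l u x = psum (fun k => mderivs l (P k)) x.
Proof.
elim: l x => [|i l IH] x Bx /=; first exact: uE.
rewrite /partial (@near_eq_derive _ _ _ _ (psum (fun k => mderivs l (P k)))).
- by have [_] := psum_is_derive_mderivs l i Bx.
- near=> y; apply: IH; near: y; exact: near_unit_ball.
Unshelve. all: by end_near. Qed.

Lemma psum_continuous_at l x : B x -> {for x, continuous (psum (fun k => mderivs l (P k)))}.
Proof.
move=> Bx; pose r := (enorm x + 1) / 2.
have xr : enorm x < r by move: Bx; rewrite /unit_ball /r /=; lra.
have r1 : r < 1 by move: Bx; rewrite /unit_ball /r /=; lra.
have [C0 H0] := mderivs_dominated l r1.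
have H := psum_continuous (is_cvg_seriesZ (k := C0) cM) H0.
have := H; rewrite continuous_open_subspace; last exact: open_eball.
by apply; rewrite inE.
Qed.

Lemma harmonic_psum : harmonic_on B u.
Proof.
split; [split|].
- move=> l i x _ Bx.
  have [D _] := psum_is_derive_mderivs l i Bx.
  apply: near_eq_derivable D => //.
  by near=> y; rewrite partialsE//; near: y; exact: near_unit_ball.
- move=> l x _ Bx; have := @psum_continuous_at l x Bx.
  rewrite /prop_for /continuous_at partialsE// => H.
  have E : {near x, psum (fun k => mderivs l (P k)) =1 partials l u}.
    by near=> y; rewrite partialsE//; near: y; exact: near_unit_ball.
  exact: cvg_trans (near_eq_cvg E) H.
- move=> x Bx.
  transitivity (\sum_(i < n) psum (fun k => mderivs [:: i; i] (P k)) x).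
    by apply: eq_bigr => i _; exact: partialsE.
  pose r := (enorm x + 1) / 2.
  have xr : enorm x < r by move: Bx; rewrite /unit_ball /r /=; lra.
  have r1 : r < 1 by move: Bx; rewrite /unit_ball /r /=; lra.
  have cD i : cvgn (series (fun k => pev (mderivs [:: i; i] (P k)) x)).
    have [C0 H0] := mderivs_dominated [:: i; i] r1.
    by apply: series_dominated_cvg (is_cvg_seriesZ (k := C0) cM) _ => k; exact: H0.
  have L i : series (fun k => pev (mderivs [:: i; i] (P k)) x) m @[m --> \oo] -->
     psum (fun k => mderivs [:: i; i] (P k)) x by exact: cD.
  have sumL (s : seq 'I_n) : \sum_(i <- s) series (fun k => pev (mderivs [:: i; i] (P k)) x) m
      @[m --> \oo] --> \sum_(i <- s) psum (fun k => mderivs [:: i; i] (P k)) x.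
    elim: s => [|i s IH].
      by rewrite big_nil; under eq_fun do rewrite big_nil; exact: cvg_cst.
    by rewrite big_cons; under eq_fun do rewrite big_cons; apply: cvgD.
  have := sumL (index_enum 'I_n).
  rewrite (_ : (fun m => _) = cst 0).
    by move=> /cvg_lim <- //; rewrite lim_cst.
  apply/funext => m; rewrite /= exchange_big /= big1// => k _.
  by rewrite -pev_sum -/(lap (P k)) lP pev0.
Unshelve. all: by end_near. Qed.

End harmonic_sum.

End harmonic_series.


(** * Test functions *)

Section test_functions.
Context (R : realType) (n : nat).
Local Notation B := (@unit_ball R n).
Variables (c b : R).

(* A family of functions stable under partial derivatives, because
   [f_m' = - m f_(m+1) + f_(m+2)]; hence its members are smooth. *)
Inductive smooth_span : ('rV[R]_n -> R) -> Prop :=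
| smooth_pev p : smooth_span (pev p)
| smooth_radial m : smooth_span (radial (bw c b m))
| smoothD f g : smooth_span f -> smooth_span g -> smooth_span (fun x => f x + g x)
| smoothM f g : smooth_span f -> smooth_span g -> smooth_span (fun x => f x * g x).

Lemma smooth_span_derive f i : smooth_span f ->
  exists2 g, smooth_span g & forall x, is_derive x (ev R i) f (g x).
Proof.
elim=> [p|m|{}f g _ [f' sf' Df] _ [g' sg' Dg]|{}f g sf [f' sf' Df] sg [g' sg' Dg]].
- by exists (pev (mpoly.mderiv i p)); [exact: smooth_pev|move=> x; exact: is_derive_pev_ev].
- exists (fun x => (pev (mpoly.mpolyC n (- c)) x *
    (pev (mpoly.mpolyC n (- m%:R)) x * radial (bw c b m.+1) x + radial (bw c b m.+2) x)) *
    pev (mpoly.mpolyC n 2 * mpoly.mpolyX R (mpoly.mnm1 i)) x).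
    apply: smoothM; last exact: smooth_pev.
    apply: smoothM; first exact: smooth_pev.
    apply: smoothD; last exact: smooth_radial.
    by apply: smoothM; [exact: smooth_pev|exact: smooth_radial].
  move=> x; rewrite pevM !pevC pevX.
  exact: (is_derive_radial x i (is_derive_bw c b m)).
- exists (fun x => f' x + g' x); first exact: smoothD.
  by move=> x; have := Df x; have := Dg x => D1 D2; rewrite -[fun x => _]/(f + g); apply: is_derive_eq.
- exists (fun x => f x * g' x + g x * f' x); first by apply: smoothD; exact: smoothM.
  by move=> x; have := Df x; have := Dg x => D1 D2; rewrite -[fun x => _]/(f * g); apply: is_derive_eq.
Qed.

Lemma smooth_span_continuous f : smooth_span f -> continuous f.
Proof.
elim=> [p|m|{}f g _ cf _ cg|{}f g _ cf _ cg].
- exact: continuous_pev.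
- move=> x; apply: (@continuous_comp _ _ _ (@sqn R n) (bw c b m)).
    exact: sqn_continuous.
  have [D _] := is_derive_bw c b m (sqn x).
  exact/differentiable_continuous/derivable1_diffP.
- by move=> x; apply: continuousD; [exact: cf|exact: cg].
- by move=> x; apply: continuousM; [exact: cf|exact: cg].
Qed.

Lemma smooth_span_partials l f : smooth_span f -> smooth_span (partials l f).
Proof.
move=> sf; elim: l => //= i l IH; rewrite /partial.
have [g sg Dg] := smooth_span_derive i IH.
rewrite (_ : (fun x => _) = g)//; apply/funext => x.
by have [_] := Dg x.
Qed.

Lemma smooth_span_class_C k f : smooth_span f -> class_C k setT f.
Proof.
move=> sf; split=> [l i x _ _|l x _ _].
  have [g _ Dg] := smooth_span_derive i (smooth_span_partials l sf).
  by have [] := Dg x.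
exact: (smooth_span_continuous (smooth_span_partials l sf)).
Qed.

Lemma closed_ball_sqn : closed [set x : 'rV[R]_n | sqn x <= b].
Proof.
have -> : [set x : 'rV[R]_n | sqn x <= b] = @sqn R n @^-1` [set t | t <= b] by [].
apply: closed_comp; last exact: closed_le.
by move=> x _; exact: sqn_continuous.
Qed.

Lemma compact_sqn : compact [set x : 'rV[R]_n | sqn x <= b].
Proof.
apply: (subclosed_compact closed_ball_sqn
  (@rV_compact R n (fun=> `[- (1 + `|b|), 1 + `|b|]%classic) _)).
  by move=> _; exact: segment_compact.
move=> x xb i /=; rewrite in_itv /= -ler_norml.
apply: le_trans (le_coor_enorm _ _) _.
have xb' : enorm x ^+ 2 <= `|b| by rewrite sqr_enorm (le_trans xb)// ler_norm.
have := enorm_ge0 x; have := normr_ge0 b; move: xb'; rewrite expr2; nra.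
Qed.

(** The support lies in the closed set |x|^2 <= b, which is compact, and b < 1 places it inside the
    open ball. *)
Lemma smooth_test_function f m : 0 < c -> b < 1 -> smooth_span f ->
  test_function B (fun x => radial (bw c b m) x * f x).
Proof.
move=> c0 b1 sf; set phi := fun x => _.
have sub : closure [set x | phi x != 0] `<=` [set x | sqn x <= b].
  rewrite [X in _ `<=` X](proj1 (closure_id _) closed_ball_sqn); apply: closure_subset.
  move=> x /=; apply: contraNle => bx.
  by rewrite /phi /radial /bw bumpf_le0 ?mul0r// pmulr_rle0// subr_le0 ltW.
split.
- by move=> k; apply: smooth_span_class_C; apply: smoothM => //; exact: smooth_radial.
- apply: subclosed_compact sub; first exact: closed_closure.
  exact: compact_sqn.
- move=> x /sub /=; rewrite -sqr_enorm => xb.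
  by rewrite /unit_ball /= -(@expr_lt1 _ 2) ?enorm_ge0//; apply: le_lt_trans xb b1.
Qed.

End test_functions.


(** * Mass of homogeneous functions *)

Section real_bounds.
Context (R : realType).

Lemma bernoulli_ge (x : R) m : 0 <= x <= 1 -> 1 - m%:R * x <= (1 - x) ^+ m.
Proof.
move=> /andP[x0 x1]; elim: m => [|m IH]; first by rewrite mul0r subr0 expr0.
rewrite exprS -natr1.
have H : (1 - x) * (1 - m%:R * x) <= (1 - x) * (1 - x) ^+ m by rewrite ler_wpM2l//; lra.
apply: le_trans H; have : 0 <= m%:R * x * x by rewrite !mulr_ge0.
lra.
Qed.

(** The upper companion of Bernoulli's inequality: (1 - x)^m (1 + m x) <= 1, by induction. *)
Lemma bernoulli_le (x : R) m : 0 <= x <= 1 -> (1 - x) ^+ m <= (1 + m%:R * x)^-1.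
Proof.
move=> /andP[x0 x1]; elim: m => [|m IH]; first by rewrite mul0r addr0 expr0 invr1.
have mx : 0 <= m%:R * x by rewrite mulr_ge0.
rewrite exprS -natr1; apply: le_trans (ler_wpM2l _ IH) _; first lra.
rewrite ler_pdivrMr; last lra.
rewrite mulrC ler_pdivlMr; last lra.
have : 0 <= m%:R * x * x by rewrite !mulr_ge0.
have : 0 <= x * x by rewrite mulr_ge0.
lra.
Qed.

(** The case x = 1/N of [bernoulli_le]. It serves both to locate mass near the sphere and to keep 1
    - r^k away from 0 at r = 1 - 1/k. *)
Lemma half_power (N : nat) : (0 < N)%N -> (1 - N%:R^-1 : R) ^+ N <= 2^-1.
Proof.
move=> N0; have N0' : (0 : R) < N%:R by rewrite ltr0n.
apply: le_trans (bernoulli_le _ _) _; last by rewrite divff ?gt_eqF.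
by rewrite invr_ge0 ltW//= invf_le1// ler1n.
Qed.

End real_bounds.

Section scaling.
Context (R : realType) (n : nat).
Local Notation mu := (lebesgue_rV R n).
Local Notation B := (@unit_ball R n).
Implicit Types (f g W : 'rV[R]_n -> R).

Lemma eball_sub (r : R) : r <= 1 -> @eball R n r `<=` B.
Proof. by move=> r1 x xr; exact: lt_le_trans xr r1. Qed.

Lemma restrict_scale f (r : R) (x : 'rV[R]_n) : 0 < r ->
  ((EFin \o f) \_ (eball r)) (r *: x + 0) = ((fun x => (f (r *: x))%:E) \_ B) x.
Proof.
move=> r0; rewrite addr0 /restrict.
have -> : (r *: x \in eball r) = (x \in B).
  apply/idP/idP; rewrite !inE /eball /unit_ball /= enormZ gtr0_norm//.
    by rewrite gtr_pMr.
  by rewrite gtr_pMr.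
by [].
Qed.

Lemma integrable_scale_ball f (r : R) : 0 < r <= 1 -> mu.-integrable B (EFin \o f) ->
  mu.-integrable B (fun x => (f (r *: x))%:E).
Proof.
move=> /andP[r0 r1] intf.
have : mu.-integrable (eball r) (EFin \o f).
  by apply: integrableS intf; [exact: measurable_unit_ball|exact: measurable_eball|exact: eball_sub].
move=> /(integrable_mkcond _ (@measurable_eball R n r)) /(integrable_aff 0 r0).
rewrite (eq_fun (fun x => restrict_scale f x r0)).
by move=> /(integrable_mkcond _ (@measurable_unit_ball R n)).
Qed.

Lemma integral_scale_ball f (r : R) : 0 < r <= 1 -> mu.-integrable B (EFin \o f) ->
  (\int[mu]_(x in B) (f (r *: x)%R)%:E =
   (r^-1 ^+ n)%:E * \int[mu]_(x in eball r) (f x)%:E)%E.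
Proof.
move=> /andP[r0 r1] intf.
have : mu.-integrable (eball r) (EFin \o f).
  by apply: integrableS intf; [exact: measurable_unit_ball|exact: measurable_eball|exact: eball_sub].
move=> /(integrable_mkcond _ (@measurable_eball R n r)) /(integral_aff 0 r0).
rewrite (integral_mkcond (eball r)) => <-.
rewrite [LHS]integral_mkcond; apply: eq_integral => x _.
by rewrite restrict_scale.
Qed.

Lemma bndmeas_indic (A : set 'rV[R]_n) : measurable A -> bndmeas (\1_A : 'rV[R]_n -> R).
Proof.
move=> mA; split; first exact: measurable_indic.
by exists 1 => x _; rewrite indicE; case: (_ \in _); rewrite ?normr1 ?normr0.
Qed.

Lemma Ib_scale f (r : R) : 0 < r <= 1 -> bndmeas f ->
  Ib (fun x => \1_(eball r) x * f x) = r ^+ n * Ib (fun x => f (r *: x)).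
Proof.
move=> r01 bf; have /andP[r0 r1] := r01.
have bi : bndmeas (fun x => \1_(eball r) x * f x).
  by apply: bndmeasM => //; apply: bndmeas_indic; exact: measurable_eball.
have := integral_scale_ball r01 (bndmeas_integrable bf).
have -> : (\int[mu]_(x in eball r) (f x)%:E)%E = (Ib (fun x => \1_(eball r) x * f x))%:E.
  rewrite Ib_EFin// [LHS]integral_mkcond [RHS]integral_mkcond.
  apply: eq_integral => x _; rewrite /restrict indicE.
  case: ifPn => xr; case: ifPn => xB; rewrite ?mul1r ?mul0r//.
  by move: xB; rewrite mem_set//; apply: (eball_sub r1); rewrite inE in xr.
rewrite -EFinM => E.
rewrite /Ib [X in _ = _ * X]/Rintegral E /= mulrA -exprMn mulfV ?gt_eqF// expr1n mul1r.
by [].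
Qed.

Definition zero_homog W := forall (r : R) x, 0 < r -> W (r *: x) = W x.

(** For zero-homogeneous [W] and n >= 1, polar coordinates identify this with the integral of [W]
    over the sphere divided by n + al; only dilations are used to exploit it. *)
Definition mass W (al : nat) := Ib (fun x => enorm x ^+ al * W x).

Lemma bndmeas_enorm al : bndmeas (fun x : 'rV[R]_n => enorm x ^+ al).
Proof.
split; first by apply: measurable_funX; exact: measurable_enorm.
exists 1 => x Bx; rewrite ger0_norm ?exprn_ge0 ?enorm_ge0//.
by rewrite exprn_ile1 ?enorm_ge0// ltW.
Qed.

Section mass.
Variable W : 'rV[R]_n -> R.
Hypotheses (bW : bndmeas W) (W0 : forall x, 0 <= W x) (hW : zero_homog W).

Let bm al : bndmeas (fun x => enorm x ^+ al * W x).
Proof. by apply: bndmeasM => //; exact: bndmeas_enorm. Qed.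

Lemma mass_eball (r : R) al : 0 < r <= 1 ->
  Ib (fun x => \1_(eball r) x * (enorm x ^+ al * W x)) = r ^+ (n + al) * mass W al.
Proof.
move=> r01; have /andP[r0 r1] := r01; rewrite Ib_scale// exprD -mulrA; congr (_ * _).
rewrite -IbZ//; apply: eq_Ib => x _; rewrite hW// enormZ gtr0_norm// exprMn mulrA//.
Qed.

Lemma mass_ge0 al : 0 <= mass W al.
Proof. by apply: Ib_ge0 => x _; rewrite mulr_ge0// exprn_ge0// enorm_ge0. Qed.

(** With r = 1 - 1/(n + al), dilation shows that the ball of radius r carries at most half of the
    mass. The rest sits in the shell beyond r, where |x|^al <= 1 and the unweighted mass is a
    fraction 1 - r^n <= n/(n + al) of the total. *)
Lemma mass_le al : (1 < n)%N -> mass W al <= 2 * n%:R * mass W 0 / (n + al)%:R.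
Proof.
move=> n1.
have N1 : (1 < n + al)%N by rewrite (leq_trans n1)// leq_addr.
have N0 : (0 < n + al)%N by exact: ltnW.
have N0' : (0 : R) < (n + al)%:R by rewrite ltr0n.
pose r : R := 1 - (n + al)%:R^-1.
have x01 : 0 <= ((n + al)%:R^-1 : R) <= 1.
  by rewrite invr_ge0 ltW//= invf_le1// ler1n.
have r0 : 0 < r.
  by rewrite subr_gt0 invf_lt1// ltr1n.
have r01 : 0 < r <= 1 by rewrite r0 /r; lra.
have br : bndmeas (\1_(eball r) : 'rV[R]_n -> R) by apply: bndmeas_indic; exact: measurable_eball.
have key : mass W al <= r ^+ (n + al) * mass W al + (1 - r ^+ n) * mass W 0.
  rewrite -mass_eball//.
  have -> : (1 - r ^+ n) * mass W 0 = Ib (fun x => enorm x ^+ 0 * W x - \1_(eball r) x * (enorm x ^+ 0 * W x)).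
    rewrite IbB//; last exact: bndmeasM.
    by rewrite mass_eball// addn0; rewrite mulrBl mul1r.
  rewrite -IbD//; last 2 first.
  - exact: bndmeasM.
  - by apply: bndmeasB => //; exact: bndmeasM.
  apply: le_Ib => //.
    by apply: bndmeasD; [|apply: bndmeasB => //]; exact: bndmeasM.
  move=> x Bx; rewrite expr0 mul1r indicE; case: (_ \in _) => /=.
    by rewrite !mul1r subrr addr0.
  rewrite !mul0r subr0 add0r ler_piMl// exprn_ile1 ?enorm_ge0//; exact: ltW.
have h1 : r ^+ (n + al) <= 2^-1 by exact: half_power.
have h2 := bernoulli_ge n x01; rewrite -/r in h2.
have m1 := mass_ge0 al; have m0 := mass_ge0 0.
have k1 : r ^+ (n + al) * mass W al <= 2^-1 * mass W al by rewrite ler_wpM2r.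
have k2 : (1 - r ^+ n) * mass W 0 <= (n%:R * (n + al)%:R^-1) * mass W 0.
  by rewrite ler_wpM2r//; lra.
have -> : 2 * n%:R * mass W 0 / (n + al)%:R = 2 * (n%:R * (n + al)%:R^-1 * mass W 0) by ring.
lra.
Qed.

(** The lower counterpart of [mass_le]: the mass of a shell is the difference of two balls, each
    known by dilation. *)
Lemma mass_shell (psi : 'rV[R]_n -> R) (r1 r2 K : R) al : bndmeas psi ->
  0 <= K -> 0 < r1 -> r1 <= r2 -> r2 <= 1 ->
  (forall x, B x -> 0 <= psi x) ->
  (forall x, r1 <= enorm x < r2 -> K <= psi x * enorm x ^+ al) ->
  K * ((r2 ^+ n - r1 ^+ n) * mass W 0) <= Ib (fun x => psi x * (enorm x ^+ al * W x)).
Proof.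
move=> bpsi K0 r10 r12 r21 psi0 Kpsi.
have r20 : 0 < r2 by exact: lt_le_trans r12.
have b1 : bndmeas (\1_(eball r1) : 'rV[R]_n -> R) by apply: bndmeas_indic; exact: measurable_eball.
have b2 : bndmeas (\1_(eball r2) : 'rV[R]_n -> R) by apply: bndmeas_indic; exact: measurable_eball.
have -> : (r2 ^+ n - r1 ^+ n) * mass W 0 =
    Ib (fun x => \1_(eball r2) x * (enorm x ^+ 0 * W x) - \1_(eball r1) x * (enorm x ^+ 0 * W x)).
  rewrite IbB; try exact: bndmeasM.
  have e1 : 0 < r1 <= 1 by rewrite r10 (le_trans r12).
  have e2 : 0 < r2 <= 1 by rewrite r20.
  by rewrite (mass_eball 0 e1) (mass_eball 0 e2) addn0 mulrBl.
rewrite -IbZ; last by apply: bndmeasB; exact: bndmeasM.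
apply: le_Ib; first by apply: bndmeasZ; apply: bndmeasB; exact: bndmeasM.
  by apply: bndmeasM.
move=> x Bx; rewrite expr0 mul1r !indicE.
have pos : 0 <= psi x * (enorm x ^+ al * W x).
  by rewrite !mulr_ge0 ?psi0// exprn_ge0// enorm_ge0.
have [x1|x1] := ltP (enorm x) r1.
  rewrite !mem_set//= ?subrr ?mulr0//.
  by apply: lt_le_trans r12.
have -> : (x \in eball r1) = false.
  by apply: memNset; rewrite /eball /=; apply/negP; rewrite -leNgt.
have [x2|x2] := ltP (enorm x) r2; last first.
  by rewrite memNset ?mul0r ?subrr ?mulr0//= /eball /=; apply/negP; rewrite -leNgt.
rewrite mem_set//= mul0r subr0 mul1r mulrA ler_wpM2r// Kpsi//.
by rewrite x1.
Qed.

End mass.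
End scaling.


(** * Size of the bumps attached to one mode *)

Section bump_mass.
Context (R : realType) (n : nat).
Local Notation B := (@unit_ball R n).
Implicit Types (p : mpoly.mpoly n R) (x : 'rV[R]_n).

Lemma bndmeas_sqr (f : 'rV[R]_n -> R) : bndmeas f -> bndmeas (fun x => f x ^+ 2).
Proof.
by move=> bf; under [X in bndmeas X]eq_fun do rewrite expr2; exact: bndmeasM.
Qed.

(** The square of the restriction to the sphere, extended constantly along rays; at the origin,
    where [normalize] is 0, it is p(0)^2. *)
Definition sqsph p x : R := pev p (normalize x) ^+ 2.

Lemma enorm_normalize x : x <> 0 -> enorm (normalize x) = 1.
Proof.
move=> x0; rewrite /normalize enormZ ger0_norm ?invr_ge0 ?enorm_ge0// mulVf//.
by apply/eqP => /enorm_eq0.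
Qed.

Lemma normalize0 : normalize (0 : 'rV[R]_n) = 0.
Proof. by rewrite /normalize scaler0. Qed.

Lemma enorm_normalize_le1 x : enorm (normalize x) <= 1.
Proof.
have [->|/eqP x0] := eqVneq x 0; first by rewrite normalize0 enorm0.
by rewrite enorm_normalize.
Qed.

Lemma normalizeZ (r : R) x : 0 < r -> normalize (r *: x) = normalize x.
Proof.
move=> r0; rewrite /normalize enormZ gtr0_norm// scalerA invfM mulrAC mulVf ?mul1r//.
by rewrite gt_eqF.
Qed.

Lemma pev_normalize k p x : homog k p -> (0 < k)%N ->
  pev p x = enorm x ^+ k * pev p (normalize x).
Proof.
move=> hp k0; rewrite -(pev_homog _ _ hp) /normalize scalerA.
have [->|/eqP x0] := eqVneq x 0; first by rewrite scaler0.
by rewrite mulfV ?scale1r//; apply/eqP => /enorm_eq0.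
Qed.

Lemma bndmeas_sqsph p : bndmeas (sqsph p).
Proof.
split.
  apply: measurable_funX; apply: measurableT_comp (measurable_pev p) _.
  exact: measurable_normalize.
have [C C0 HC] := pev_bounded p 1; exists (C ^+ 2) => x _.
by rewrite /sqsph normrX ler_pXn2r ?nnegrE// HC// enorm_normalize_le1.
Qed.

Lemma sqsph_ge0 p x : 0 <= sqsph p x. Proof. exact: sqr_ge0. Qed.

Lemma sqsph_homog p : zero_homog (sqsph p).
Proof. by move=> r x r0; rewrite /sqsph normalizeZ. Qed.

(* [|x|^(2k)] carries its mass in the shell [1 - |x| ~ 1/k], and so does this
   bump, of width [1/k] and supported in [|x|^2 <= 1 - 1/(2k)]. *)
Definition kweight (k : nat) : R -> R := bw k%:R (1 - (2 * k%:R)^-1) 2.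

Lemma kweight_ge0 k t : 0 <= kweight k t. Proof. exact: bumpf_ge0. Qed.

Lemma kweight_le k t : kweight k t <= 4.
Proof. by apply: le_trans (bumpf_le _ _) _; rewrite -natrX. Qed.

Lemma kcenter_lt1 k : (0 < k)%N -> 1 - (2 * k%:R)^-1 < 1 :> R.
Proof. by move=> k0; rewrite ltrBlDr ltrDl invr_gt0 mulr_gt0// ltr0n. Qed.

Lemma weight_kweight k : (0 < k)%N -> weight (kweight k).
Proof.
by move=> k0; apply: weight_bw; [rewrite ltr0n|exact: ltW (kcenter_lt1 k0)].
Qed.

(** The interval covers the values of k (1 - 1/(2k) - |x|^2) on the shell 1 - 2/k <= |x| < 1 - 1/k;
    on it s^(-2) >= 1/16 and e^(-1/s) >= e^(-2). *)
Lemma bumpf2_ge (s : R) : 2^-1 <= s <= 4 -> expR (- 2) / 16 <= bumpf 2 s.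
Proof.
move=> /andP[s1 s4]; have s0 : 0 < s by lra.
rewrite /bumpf s0 mulrC; apply: ler_pM; rewrite ?invr_ge0 ?expR_ge0//.
  rewrite lef_pV2 ?posrE ?exprn_gt0// expr2; nra.
rewrite ler_expR lerN2 -[leRHS]invrK lef_pV2 ?posrE ?invr_gt0//; lra.
Qed.

(** The three factors bound from below, on the shell 1 - 2/k <= |x| < 1 - 1/k, the bump, then
    |x|^(2k), and finally k times the fraction of unweighted mass in the shell. *)
Definition shell_const : R := expR (- 2) / 16 * (2^-1) ^+ 8 * 2^-1 ^+ n.

Lemma shell_const_gt0 : 0 < shell_const.
Proof. by rewrite /shell_const !mulr_gt0 ?exprn_gt0 ?expR_gt0. Qed.

(** Both the bump and |x|^(2k) are bounded below on the shell 1 - 2/k <= |x| < 1 - 1/k. With k = 4m,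
    |x|^(2k) is at least the eighth power of (1 - 2/k)^m, and Bernoulli's inequality makes the
    latter at least 1 - 2m/k = 1/2. *)
Lemma bump_mass_ge k m p : homog k p -> k = (4 * m)%N -> (0 < m)%N -> (0 < n)%N ->
  shell_const / k%:R * mass (sqsph p) 0 <=
  Ib (fun x => radial (kweight k) x * (pev p x * pev p x)).
Proof.
move=> hp km m0 n0.
have k0 : (0 < k)%N by rewrite km muln_gt0.
have k4 : (4 <= k)%N by rewrite km leq_pmulr.
have k4' : (4 : R) <= k%:R by rewrite ler_nat.
have kp : (0 : R) < k%:R by rewrite ltr0n.
pose d : R := k%:R^-1.
have d0 : 0 < d by rewrite invr_gt0.
have dk : d * k%:R = 1 by rewrite mulVf// gt_eqF.
have d4 : d <= 4^-1 by rewrite lef_pV2 ?posrE.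
have -> : (fun x => radial (kweight k) x * (pev p x * pev p x)) =
    (fun x => radial (kweight k) x * (enorm x ^+ (2 * k) * sqsph p x)).
  apply/funext => x; congr (_ * _); rewrite (pev_normalize x hp k0) /sqsph.
  by rewrite mulnC exprM; ring.
pose K : R := expR (- 2) / 16 * (2^-1) ^+ 8.
have K0 : 0 <= K by rewrite /K !mulr_ge0 ?exprn_ge0 ?expR_ge0.
have H := @mass_shell R n (sqsph p) (bndmeas_sqsph p) (sqsph_ge0 p) (@sqsph_homog p)
  (radial (kweight k)) (1 - 2 * d) (1 - d) K (2 * k) (bndmeas_radial n (weight_kweight k0)) K0.
apply: le_trans (H _ _ _ _ _); first last.
- move=> x /andP[x1 x2]; rewrite /K; apply: ler_pM.
  + by rewrite mulr_ge0 ?expR_ge0.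
  + by rewrite exprn_ge0.
  + apply: bumpf2_ge; rewrite -sqr_enorm.
    have -> : k%:R * (1 - (2 * k%:R)^-1 - enorm x ^+ 2) =
        k%:R - 2^-1 - k%:R * enorm x ^+ 2 :> R by field; rewrite gt_eqF.
    have u1 : enorm x ^+ 2 <= 1 - d by rewrite expr2; nra.
    have u2 : 1 - 4 * d <= enorm x ^+ 2 by rewrite expr2; nra.
    have u1k : k%:R * enorm x ^+ 2 <= k%:R * (1 - d) by rewrite ler_wpM2l// ltW.
    have u2k : k%:R * (1 - 4 * d) <= k%:R * enorm x ^+ 2 by rewrite ler_wpM2l// ltW.
    by lra.
  + apply: (@le_trans _ _ ((1 - 2 * d) ^+ (2 * k))).
      rewrite (_ : (2 * k)%N = (m * 8)%N); last by rewrite km mulnA mulnC.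
      rewrite exprM ler_pXn2r ?nnegrE ?exprn_ge0//; try lra.
      have x01 : 0 <= 2 * d <= 1 by lra.
      apply: le_trans (bernoulli_ge m x01).
      have : m%:R * (4 * d) = 1.
        by rewrite mulrA -natrM mulnC -km mulrC.
      by lra.
    by rewrite ler_pXn2r ?nnegrE ?enorm_ge0 ?muln_gt0 ?k0//; lra.
- by move=> x _; exact: kweight_ge0.
- lra.
- lra.
- lra.
rewrite -/d mulrA ler_wpM2r ?mass_ge0//; first exact: sqsph_ge0.
rewrite /shell_const -/K -mulrA ler_wpM2l//.
case: n n0 => // n' _.
have q0 : 0 <= 1 - 2 * d by lra.
(* Factoring out (1 - d)^(n-1) leaves (1 - d)^n - (1 - 2d)^n >= d (1 - d)^(n-1), and 1 - d >=
   1/2. *)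
have e1 : (1 - 2 * d) ^+ n'.+1 <= (1 - 2 * d) * (1 - d) ^+ n'.
  by rewrite exprS ler_wpM2l// lerXn2r ?nnegrE//; lra.
have e2 : 2^-1 ^+ n' <= (1 - d) ^+ n' by rewrite lerXn2r ?nnegrE//; lra.
have e3 : d * 2^-1 ^+ n' <= d * (1 - d) ^+ n' by rewrite ler_wpM2l// ltW.
have e4 : 2^-1 ^+ n'.+1 * d <= d * 2^-1 ^+ n'.
  rewrite mulrC ler_pM2l// exprS ler_piMl ?exprn_ge0//; lra.
apply: le_trans e4 _; apply: le_trans e3 _; rewrite [(1 - d) ^+ n'.+1]exprS.
by lra.
Qed.

(** The factor 16 is the square of the bound 4 on [kweight]; the decay 1/k is [mass_le] at exponent
    2k. *)
Lemma bump_sq_le k p : homog k p -> (0 < k)%N -> (1 < n)%N ->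
  Ib (fun x => (radial (kweight k) x * pev p x) ^+ 2) <=
  16 * (n%:R / k%:R * mass (sqsph p) 0).
Proof.
move=> hp k0 n1; have kp : (0 : R) < k%:R by rewrite ltr0n.
have br := bndmeas_radial n (weight_kweight k0).
have bp := bndmeas_pev p.
have bs := bndmeas_sqsph p.
have be := @bndmeas_enorm R n (2 * k).
apply: (@le_trans _ _ (16 * mass (sqsph p) (2 * k))).
  rewrite /mass -IbZ; last exact: bndmeasM.
  apply: le_Ib; first by apply: bndmeas_sqr; exact: bndmeasM.
    by apply: bndmeasZ; exact: bndmeasM.
  move=> x _; rewrite exprMn (pev_normalize x hp k0) exprMn -exprM mulnC.
  rewrite -[pev p (normalize x) ^+ 2]/(sqsph p x); apply: ler_wpM2r.
    by apply: mulr_ge0; [exact: (exprn_ge0 _ (enorm_ge0 _))|exact: sqsph_ge0].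
  have := kweight_ge0 k (sqn x); have := kweight_le k (sqn x); rewrite /radial expr2; nra.
rewrite ler_pM2l//.
apply: le_trans (mass_le (bndmeas_sqsph p) (sqsph_ge0 p) (@sqsph_homog p) _ n1) _.
have m0 := mass_ge0 (sqsph_ge0 p) 0.
have -> : n%:R / k%:R * mass (sqsph p) 0 = 2 * n%:R * mass (sqsph p) 0 / (2 * k%:R).
  by field; rewrite gt_eqF.
rewrite ler_wpM2l ?mulr_ge0// lef_pV2 ?posrE ?mulr_gt0//.
  by rewrite -natrM ler_nat leq_addl.
by rewrite ltr0n addn_gt0 (ltnW n1).
Qed.

(** By |y| <= (1 + y^2)/2, the integrand is at most 2 |x|^k (1 + [sqsph p x]), so only the L^2
    normalisation enters this L^1 bound, and [mass_le] at exponent k gives the decay. *)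
Lemma bump_abs_le k p : homog k p -> (0 < k)%N -> (1 < n)%N ->
  Ib (fun x => `|radial (kweight k) x * pev p x|) <=
  4 * (n%:R / k%:R * (mass (fun _ : 'rV[R]_n => 1) 0 + mass (sqsph p) 0)).
Proof.
move=> hp k0 n1; have kp : (0 : R) < k%:R by rewrite ltr0n.
have br := bndmeas_radial n (weight_kweight k0).
have bp := bndmeas_pev p.
have bs := bndmeas_sqsph p.
have be := @bndmeas_enorm R n k.
pose W x : R := 1 + sqsph p x.
have bW : bndmeas W by apply: bndmeasD => //; exact: bndmeas_cst.
have W0 x : 0 <= W x by rewrite addr_ge0// sqsph_ge0.
have hW : zero_homog W by move=> r x r0; rewrite /W sqsph_homog.
have -> : mass (fun _ : 'rV[R]_n => 1) 0 + mass (sqsph p) 0 = mass W 0.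
  rewrite /mass -IbD; try (apply: bndmeasM => //; try exact: bndmeas_enorm); last exact: bndmeas_cst.
  by apply: eq_Ib => x _; rewrite mulrDr.
apply: (@le_trans _ _ (2 * mass W k)).
  rewrite /mass -IbZ; last exact: bndmeasM.
  apply: le_Ib.
  - by apply: bndmeas_norm; exact: bndmeasM.
  - by apply: bndmeasZ; exact: bndmeasM.
  move=> x _; rewrite (pev_normalize x hp k0) normrM normrM.
  rewrite (ger0_norm (kweight_ge0 _ _)) (ger0_norm (exprn_ge0 _ (enorm_ge0 _))).
  rewrite mulrCA [leRHS]mulrCA ler_wpM2l ?exprn_ge0 ?enorm_ge0// /W /sqsph.
  have := kweight_ge0 k (sqn x); have := kweight_le k (sqn x); rewrite /radial.
  set y := pev _ _; rewrite -(real_normK (num_real y)).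
  have := normr_ge0 y; set z := `|y|; move=> z0 h1 h2.
  have : 0 <= (z - 1) ^+ 2 by exact: sqr_ge0.
  have : kweight k (sqn x) * z <= 4 * z by rewrite ler_wpM2r.
  rewrite !expr2; lra.
have m0 := mass_ge0 W0 0.
apply: le_trans (ler_wpM2l _ (mass_le bW W0 hW k n1)) _ => //.
have -> : 4 * (n%:R / k%:R * mass W 0) = 2 * (2 * n%:R * mass W 0 / k%:R) by ring.
rewrite ler_pM2l// ler_wpM2l ?mulr_ge0// lef_pV2 ?posrE//.
  by rewrite ler_nat leq_addl.
by rewrite ltr0n addn_gt0 (ltnW n1).
Qed.

End bump_mass.


(** * Isolating one mode of the series *)

Section modes.
Context (R : realType) (n : nat).
Local Notation mu := (lebesgue_rV R n).
Local Notation B := (@unit_ball R n).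
Implicit Types (Q : nat -> mpoly.mpoly n R) (M : R^nat) (F : 'rV[R]_n -> R).

(** The sum of the series is controlled only on the ball; extension by zero places it in [bndmeas]
    without changing any [Ib]. *)
Lemma bndmeas_patch (f : 'rV[R]_n -> R) C : measurable_fun B f ->
  (forall x, B x -> `|f x| <= C) -> bndmeas (f \_ B).
Proof.
move=> mf fC; split.
  by apply/(measurable_restrictT _ (@measurable_unit_ball R n)).
by exists C => x Bx; rewrite patchE mem_set// fC.
Qed.

Lemma psum_measurable Q M : cvgn (series M) -> dominated_on B Q M ->
  measurable_fun B (psum Q).
Proof.
move=> cM dQ; apply: (@measurable_fun_cvg _ _ _ _ (fun N x => series (fun k => pev (Q k) x) N)).
- move=> N; rewrite /series /=; apply: measurable_sum => k.
  by apply: measurable_funTS; exact: measurable_pev.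
- move=> x Bx; have H : cvgn (series (fun k => pev (Q k) x)).
    by apply: series_dominated_cvg cM _ => k; exact: dQ.
  exact: H.
Qed.

Lemma psum_bounded Q M x : cvgn (series M) -> dominated_on B Q M -> B x ->
  `|psum Q x| <= limn (series M).
Proof. by move=> cM dQ Bx; apply: dominated_norm => // k; exact: dQ. Qed.

Lemma bndmeas_psum Q M : cvgn (series M) -> dominated_on B Q M ->
  bndmeas (psum Q \_ B).
Proof.
move=> cM dQ; apply: (@bndmeas_patch _ (limn (series M))).
  exact: psum_measurable cM dQ.
by move=> x Bx; exact: (psum_bounded cM dQ).
Qed.

(** The tails of [series M] bound the remainders uniformly on the ball, so the sum may be truncated
    at any N > k, where orthogonality leaves the single term k. *)
Lemma Ib_psum_mode Q M F k : cvgn (series M) -> dominated_on B Q M -> bndmeas F ->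
  (forall j, j <> k -> Ib (fun x => pev (Q j) x * F x) = 0) ->
  Ib (fun x => psum Q x * F x) = Ib (fun x => pev (Q k) x * F x).
Proof.
move=> cM dQ bF HF.
have bu := bndmeas_psum cM dQ.
have -> : Ib (fun x => psum Q x * F x) = Ib (fun x => (psum Q \_ B) x * F x).
  by apply: eq_Ib => x Bx; rewrite patchE mem_set.
set A := Ib _; set A' := Ib _.
have bQF j : bndmeas (fun x => pev (Q j) x * F x).
  by apply: bndmeasM => //; exact: bndmeas_pev.
have key N : (k < N)%N -> `|A - A'| <= (limn (series M) - series M N) * Ib (fun x => `|F x|).
  move=> kN.
  have -> : A' = Ib (fun x => \sum_(0 <= j < N) pev (Q j) x * F x).
    rewrite Ib_sum// (bigD1_seq k) ?iota_uniq//=; last by rewrite mem_index_iota.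
    by rewrite big1 ?addr0// => j jk; apply: HF; exact/eqP.
  rewrite /A -IbB; last 2 first.
  - exact: bndmeasM.
  - exact: bndmeas_sum.
  have bd : bndmeas (fun x => (psum Q \_ B) x * F x - \sum_(0 <= j < N) pev (Q j) x * F x).
    by apply: bndmeasB; [exact: bndmeasM|exact: bndmeas_sum].
  apply: le_trans (ler_norm_Ib bd) _.
  rewrite -IbZ; last exact: bndmeas_norm.
  apply: le_Ib; [exact: bndmeas_norm|by apply: bndmeasZ; exact: bndmeas_norm|].
  move=> x Bx; rewrite patchE mem_set// -mulr_suml -mulrBl normrM ler_wpM2r//.
  by have := dominated_tail N cM (fun k => dQ k x Bx); rewrite seriesEnat.
apply/eqP; rewrite -subr_eq0 -normr_eq0 eq_le normr_ge0 andbT.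
have IF0 : 0 <= Ib (fun x => `|F x|) by exact: Ib_ge0.
apply/ler_addgt0Pl => e e0; rewrite addr0.
have e1 : 0 < e / (Ib (fun x => `|F x|) + 1) by rewrite divr_gt0// ltr_wpDl.
have /cvgrPdist_lt /(_ _ e1) H := cM.
near \oo => N.
have kN : (k < N)%N by near: N; exists k.+1.
apply: le_trans (key N kN) _.
have : `|limn (series M) - series M N| < e / (Ib (fun x => `|F x|) + 1) by near: N.
rewrite ltr_pdivlMr ?ltr_wpDl// => h; apply: le_trans (ltW h).
by rewrite ler_pM// ?ler_norm ?lerDl// (le_trans _ (dominated_tail N cM (fun k => dQ k 0 _)))//= /unit_ball /= enorm0.
Unshelve. all: by end_near. Qed.

End modes.

(** * Reading the coefficients off the sum and its dilates *)

Section coefficients.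
Context (R : realType) (n : nat).
Local Notation mu := (lebesgue_rV R n).
Local Notation B := (@unit_ball R n).
Variables (p : nat -> mpoly.mpoly n R) (a : nat -> R) (M : R^nat).
Hypothesis hp : forall k, homog k (p k).
Hypothesis lp : forall k, lap (p k) = 0.
Hypothesis cM : cvgn (series M).
Let P k := a k *: p k.
Hypothesis dP : dominated_on (@unit_cball R n) P M.
Variable u : 'rV[R]_n -> R.
Hypothesis uE : forall x, unit_cball x -> u x = psum P x.

Definition bumpmode k x : R := radial (kweight k) x * pev (p k) x.
Definition bumpmass k : R := Ib (fun x => radial (kweight k) x * (pev (p k) x * pev (p k) x)).

Lemma pevZ c q (x : 'rV[R]_n) : pev (c *: q) x = c * pev q x.
Proof. exact: mpoly.mevalZ. Qed.

Lemma ball_cball (x : 'rV[R]_n) : B x -> unit_cball x.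
Proof. exact: ltW. Qed.

Lemma bndmeas_bumpmode k : (0 < k)%N -> bndmeas (bumpmode k).
Proof.
by move=> k0; apply: bndmeasM; [apply: bndmeas_radial; exact: weight_kweight|exact: bndmeas_pev].
Qed.

Lemma ortho_bumpmode j k : (0 < k)%N -> j <> k ->
  Ib (fun x => pev (p j) x * bumpmode k x) = 0.
Proof.
move=> k0 jk.
have kR : (0 : R) < k%:R by rewrite ltr0n.
have := radial_orthogonality (weight_pbw kR (ltW (kcenter_lt1 R k0))) (weight_kweight R k0)
  (fun t => is_derive_pbw _ t kR) (hp j) (hp k) (lp j) (lp k) jk.
by move=> H; rewrite -[RHS]H; apply: eq_Ib => x _; rewrite mulrCA.
Qed.

Lemma domP_scale (r : R) : 0 <= r <= 1 -> dominated_on B (fun k => r ^+ k *: P k) M.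
Proof.
move=> /andP[r0 r1] k x Bx; rewrite pevZ normrM -[leRHS]mul1r ler_pM//.
  by rewrite ger0_norm ?exprn_ge0// exprn_ile1.
by apply: dP; exact: ball_cball.
Qed.

Lemma u_scale (r : R) x : 0 <= r <= 1 -> B x -> u (r *: x) = psum (fun k => r ^+ k *: P k) x.
Proof.
move=> /andP[r0 r1] Bx.
rewrite uE; last first.
  rewrite /unit_cball /= enormZ ger0_norm//.
  by rewrite mulr_ile1 ?enorm_ge0//; exact: ltW.
rewrite /psum; congr (limn (series _)); apply/funext => k.
by rewrite !pevZ (pev_homog _ _ (hp k)) mulrCA.
Qed.

(** Dilation acts diagonally on homogeneous terms: it multiplies the coefficient of degree k by
    r^k. *)
Lemma Ib_u_scale_bumpmode (r : R) k : 0 <= r <= 1 -> (0 < k)%N ->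
  Ib (fun x => u (r *: x) * bumpmode k x) = a k * r ^+ k * bumpmass k.
Proof.
move=> r01 k0.
have -> : Ib (fun x => u (r *: x) * bumpmode k x) =
    Ib (fun x => psum (fun k => r ^+ k *: P k) x * bumpmode k x).
  by apply: eq_Ib => x Bx; rewrite u_scale.
have bb := bndmeas_bumpmode k0.
rewrite (Ib_psum_mode cM (domP_scale r01) bb (k := k)).
  rewrite /bumpmass -IbZ.
    by apply: eq_Ib => x _; rewrite !pevZ /bumpmode; ring.
  apply: bndmeasM; first by apply: bndmeas_radial; exact: weight_kweight.
  by apply: bndmeasM; exact: bndmeas_pev.
move=> j jk.
transitivity ((r ^+ j * a j) * Ib (fun x => pev (p j) x * bumpmode k x)).
  rewrite -IbZ; last by apply: bndmeasM => //; exact: bndmeas_pev.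
  by apply: eq_Ib => x _; rewrite !pevZ; ring.
by rewrite ortho_bumpmode// mulr0.
Qed.

Lemma Ib_u_bumpmode k : (0 < k)%N ->
  Ib (fun x => u x * bumpmode k x) = a k * bumpmass k.
Proof.
move=> k0; have := @Ib_u_scale_bumpmode 1 k; rewrite expr1n mulr1 => <- //.
  by apply: eq_Ib => x _; rewrite scale1r.
by rewrite ler01 lexx.
Qed.

Lemma bndmeas_u_scale (r : R) : 0 <= r <= 1 -> bndmeas ((fun x => u (r *: x)) \_ B).
Proof.
move=> r01; have := bndmeas_psum cM (domP_scale r01); congr bndmeas.
by apply/funext => x; rewrite !patchE; case: ifPn => // xB; rewrite u_scale//; rewrite inE in xB.
Qed.

Lemma bndmeas_u : bndmeas (u \_ B).
Proof.
have := @bndmeas_u_scale 1; rewrite ler01 lexx => /(_ isT); congr bndmeas.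
by apply/funext => x; rewrite !patchE scale1r.
Qed.

Lemma Ib_u_diff (r : R) k : 0 <= r <= 1 -> (0 < k)%N ->
  Ib (fun x => u x * bumpmode k x) - Ib (fun x => u (r *: x) * bumpmode k x) =
  a k * (1 - r ^+ k) * bumpmass k.
Proof. by move=> r01 k0; rewrite Ib_u_scale_bumpmode// Ib_u_bumpmode//; ring. Qed.

End coefficients.


(** * Weak derivatives tested against one mode *)

Section square_integrable.
Context (R : realType) (n : nat).
Local Notation mu := (lebesgue_rV R n).
Local Notation B := (@unit_ball R n).
Implicit Types (f g F : 'rV[R]_n -> R).

Definition ballint f := mu.-integrable B (EFin \o f).

Lemma ballint_le f g : measurable_fun B f -> ballint g ->
  (forall x, B x -> `|f x| <= g x) -> ballint f.
Proof.
move=> mf ig fg; apply: (le_integrable (@measurable_unit_ball R n) _ _ ig).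
  exact/measurable_EFinP.
by move=> x Bx /=; rewrite lee_fin (le_trans (fg x Bx))// ler_norm.
Qed.

Lemma ballintD f g : ballint f -> ballint g -> ballint (fun x => f x + g x).
Proof. by move=> If Ig; have := integrableD (@measurable_unit_ball R n) If Ig. Qed.

Lemma ballintZ c f : ballint f -> ballint (fun x => c * f x).
Proof. by move=> If; have := integrableZl (@measurable_unit_ball R n) c If. Qed.

Lemma ballintB f g : ballint f -> ballint g -> ballint (fun x => f x - g x).
Proof. by move=> If Ig; have := integrableB (@measurable_unit_ball R n) If Ig. Qed.

Lemma ballint_measurable f : ballint f -> measurable_fun B f.
Proof. by move=> /integrableP[/measurable_EFinP]. Qed.

Lemma square_integrable_sqr g : square_integrable B g -> ballint (fun x => g x ^+ 2).
Proof.
move=> [mg goo]; apply/integrableP; split.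
  by apply/measurable_EFinP; exact: measurable_funX.
under eq_integral do rewrite /= ger0_norm ?sqr_ge0//.
exact: goo.
Qed.

Lemma square_integrableM g F : square_integrable B g -> bndmeas F ->
  ballint (fun x => g x * F x).
Proof.
move=> sg bF; have [mg _] := sg; have [mF _] := bF.
apply: (@ballint_le _ (fun x => g x ^+ 2 + F x ^+ 2)).
- by apply: measurable_funM => //; exact: measurable_funTS.
- apply: ballintD; first exact: square_integrable_sqr.
  by apply: bndmeas_integrable; exact: bndmeas_sqr.
move=> x _; rewrite normrM -(real_normK (num_real (g x))) -(real_normK (num_real (F x))).
have := sqr_ge0 (`|g x| - `|F x|); have := normr_ge0 (g x); have := normr_ge0 (F x).
rewrite !expr2; nra.
Qed.

(** Young's inequality from (t y - z)^2 >= 0, in the role of the Cauchy-Schwarz inequality. The free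
    parameter t is later taken to be a power of k that balances both terms. *)
Lemma ler_norm_Ib_sq g F (t : R) : 0 < t -> ballint (fun x => g x ^+ 2) ->
  ballint (fun x => g x * F x) -> bndmeas F ->
  `|Ib (fun x => g x * F x)| <=
  t * Ib (fun x => g x ^+ 2) + t^-1 * Ib (fun x => F x ^+ 2).
Proof.
move=> t0 sg igF bF.
have mB := @measurable_unit_ball R n.
have iF : ballint (fun x => F x ^+ 2) by apply: bndmeas_integrable; exact: bndmeas_sqr.
apply: le_trans (le_normr_Rintegral mB igF) _.
rewrite /Ib -!RintegralZl// -RintegralD//; try exact: ballintZ.
apply: le_Rintegral => //.
- by apply: (integrable_norm igF).
- by apply: ballintD; exact: ballintZ.
move=> x _; rewrite normrM -(real_normK (num_real (g x))) -(real_normK (num_real (F x))).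
have t1 : 0 < t^-1 by rewrite invr_gt0.
have tt : t * t^-1 = 1 by rewrite mulfV// gt_eqF.
set y := `|g x|; set z := `|F x|.
have y0 : 0 <= y by exact: normr_ge0.
have z0 : 0 <= z by exact: normr_ge0.
have : 0 <= t^-1 * (t * y - z) ^+ 2 by rewrite mulr_ge0 ?sqr_ge0// ltW.
have -> : t^-1 * (t * y - z) ^+ 2 = (t * t^-1) * (t * y ^+ 2) - 2 * (t * t^-1) * (y * z) + t^-1 * z ^+ 2.
  ring.
by rewrite tt mulr1 mul1r; have := mulr_ge0 y0 z0; lra.
Qed.

Lemma weak_partials_Ib l (u g phi : 'rV[R]_n -> R) :
  weak_partials l B u g -> test_function B phi ->
  ballint (fun x => g x * phi x) ->
  Ib (fun x => u x * partials l phi x) = (-1) ^+ size l * Ib (fun x => g x * phi x).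
Proof.
move=> wu tphi ig; rewrite /Ib /Rintegral (wu phi tphi).
rewrite fineM//; apply: integrable_fin_num => //.
exact: measurable_unit_ball.
Qed.

End square_integrable.

(** * Bounds on a coefficient from weak derivatives *)

Section weak.
Context (R : realType) (n : nat).
Local Notation mu := (lebesgue_rV R n).
Local Notation B := (@unit_ball R n).
Variables (p : nat -> mpoly.mpoly n R) (a : nat -> R) (M : R^nat).
Hypothesis hp : forall k, homog k (p k).
Hypothesis lp : forall k, lap (p k) = 0.
Hypothesis cM : cvgn (series M).
Hypothesis dP : dominated_on (@unit_cball R n) (fun k => a k *: p k) M.
Variable u : 'rV[R]_n -> R.
Hypothesis uE : forall x, unit_cball x -> u x = psum (fun k => a k *: p k) x.

Local Notation bumpmode := (bumpmode p).
Local Notation bumpmass := (bumpmass p).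

(** A dilated bump is again a bump times a polynomial, with edge r^2 (1 - 1/(2k)), and so is covered
    by the same smoothness and support arguments. *)
Lemma scaled_bumpE k (r : R) (x : 'rV[R]_n) : 0 < r ->
  bumpmode k (r^-1 *: x) =
  radial (bw (k%:R * r ^- 2) (r ^+ 2 * (1 - (2 * k%:R)^-1)) 2) x *
  pev (r^-1 ^+ k *: p k) x.
Proof.
move=> r0; rewrite /bumpmode pevZ (pev_homog _ _ (hp k)); congr (_ * _).
rewrite /radial /kweight /bw sqnZ exprVn; congr bumpf.
by move: (1 - (2 * k%:R)^-1) => b; field; rewrite gt_eqF.
Qed.

Lemma test_scaled_bump k (r : R) : (0 < k)%N -> 0 < r <= 1 ->
  test_function B (fun x => bumpmode k (r^-1 *: x)).
Proof.
move=> k0 /andP[r0 r1].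
rewrite (_ : (fun x => _) = fun x =>
  radial (bw (k%:R * r ^- 2) (r ^+ 2 * (1 - (2 * k%:R)^-1)) 2) x *
  pev (r^-1 ^+ k *: p k) x); last by apply/funext => x; exact: scaled_bumpE.
apply: smooth_test_function; last exact: smooth_pev.
- by rewrite mulr_gt0 ?ltr0n// invr_gt0 exprn_gt0.
- have b1 := kcenter_lt1 R k0.
  have r2 : r ^+ 2 <= 1 by rewrite exprn_ile1// ltW.
  apply: (@le_lt_trans _ _ (1 - (2 * k%:R)^-1)) => //.
  rewrite ler_piMl// subr_ge0 invf_le1 ?mulr_gt0 ?ltr0n//.
  by rewrite -natrM ler1n muln_gt0.
Qed.

Lemma test_bump k : (0 < k)%N -> test_function B (bumpmode k).
Proof.
move=> k0; have := @test_scaled_bump k 1 k0; rewrite ltr01 lexx => /(_ isT).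
by congr test_function; apply/funext => x; rewrite invr1 scale1r.
Qed.

Lemma bumpmode_out k (x : 'rV[R]_n) : (0 < k)%N -> ~ B x -> bumpmode k x = 0.
Proof.
move=> k0 /sqn_ge1 x1; rewrite /bumpmode /radial.
by have [_ ->//] := weight_kweight R k0; rewrite mul0r.
Qed.

Lemma Ib_scale_bump f k (r : R) : (0 < k)%N -> 0 < r <= 1 ->
  ballint (fun x => f x * bumpmode k (r^-1 *: x)) ->
  Ib (fun x => f (r *: x) * bumpmode k x) =
  r^-1 ^+ n * Ib (fun x => f x * bumpmode k (r^-1 *: x)).
Proof.
move=> k0 r01 ifphi; have /andP[r0 r1] := r01.
have := integral_scale_ball r01 ifphi.
have -> : (\int[mu]_(x in eball r) (f x * bumpmode k (r^-1 *: x))%:E =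
  \int[mu]_(x in B) (f x * bumpmode k (r^-1 *: x))%:E)%E.
  rewrite [LHS]integral_mkcond [RHS]integral_mkcond.
  apply: eq_integral => x _; rewrite /restrict.
  case: ifPn => xr; case: ifPn => xB //.
    by move: xB; rewrite mem_set//; apply: (eball_sub r1); rewrite inE in xr.
  rewrite bumpmode_out ?mulr0// => xrB.
  move: xr; rewrite notin_setE; apply; move: xrB.
  by rewrite /unit_ball /eball /= enormZ gtr0_norm ?invr_gt0// ltr_pdivrMl// mulr1.
move=> E; rewrite /Ib /Rintegral -[X in X * _]/(fine (r^-1 ^+ n)%:E) -fineM//; last first.
  by apply: integrable_fin_num ifphi; exact: measurable_unit_ball.
rewrite -E; congr fine; apply: eq_integral => x _.
by rewrite scalerA mulVf ?scale1r// gt_eqF.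
Qed.

Lemma bndmeas_scaled_bump k (r : R) : (0 < k)%N -> 0 < r <= 1 ->
  bndmeas (fun x => bumpmode k (r^-1 *: x)).
Proof.
move=> k0 /andP[r0 r1].
rewrite (_ : (fun x => _) = fun x =>
  radial (bw (k%:R * r ^- 2) (r ^+ 2 * (1 - (2 * k%:R)^-1)) 2) x *
  pev (r^-1 ^+ k *: p k) x); last by apply/funext => x; exact: scaled_bumpE.
apply: bndmeasM; last exact: bndmeas_pev.
apply: bndmeas_radial; apply: weight_bw.
  by rewrite mulr_gt0 ?ltr0n// invr_gt0 exprn_gt0.
have b1 := kcenter_lt1 R k0.
have r2 : r ^+ 2 <= 1 by rewrite exprn_ile1// ltW.
apply: (@le_trans _ _ (1 - (2 * k%:R)^-1)); last exact: ltW.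
rewrite ler_piMl// subr_ge0 invf_le1 ?mulr_gt0 ?ltr0n//.
by rewrite -natrM ler1n muln_gt0.
Qed.

Lemma ballint_u F : bndmeas F -> ballint (fun x => u x * F x).
Proof.
move=> bF; have bu := bndmeas_u hp cM dP uE.
have [mF [C FC]] := bF; have [mu' [D uD]] := bu.
apply: (@ball_integrable _ _ _ (D * C)).
  apply: measurable_funM; last exact: measurable_funTS.
  exact/(measurable_restrictT _ (@measurable_unit_ball R n)).
move=> x Bx; rewrite normrM ler_pM ?FC//.
by have := uD x Bx; rewrite patchE mem_set.
Qed.

(** Almost everywhere equality of [g] and [u] is never extracted: the change of variables x -> r x
    turns the second integral into one against a dilated bump, again a test function, so [g] may be
    replaced by [u] in both integrals. *)
Lemma weak_diff g (r : R) k : (0 < k)%N -> 0 < r <= 1 ->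
  square_integrable B g -> weak_partials [::] B u g ->
  Ib (fun x => (g x - g (r *: x)) * bumpmode k x) = a k * (1 - r ^+ k) * bumpmass k.
Proof.
move=> k0 r01 sg wg; have /andP[r0 r1] := r01.
have r01' : 0 <= r <= 1 by rewrite ltW.
have bb := bndmeas_bumpmode p k0.
have ibb := bndmeas_scaled_bump k0 r01.
have igs := square_integrableM sg ibb.
have igb := square_integrableM sg bb.
have igr : ballint (fun x => g (r *: x) * bumpmode k x).
  have := integrable_scale_ball r01 igs; congr (integrable _ _ _).
  by apply/funext => x /=; rewrite scalerA mulVf ?scale1r// gt_eqF.
rewrite -(Ib_u_diff hp lp cM dP uE r01' k0).
have -> : Ib (fun x => (g x - g (r *: x)) * bumpmode k x) =
    Ib (fun x => g x * bumpmode k x) - Ib (fun x => g (r *: x) * bumpmode k x).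
  rewrite /Ib -RintegralB//; last exact: measurable_unit_ball.
  by apply: eq_Rintegral => x _; rewrite mulrBl.
congr (_ - _).
  by have := weak_partials_Ib wg (test_bump k0) igb; rewrite expr0 mul1r => <-.
rewrite (Ib_scale_bump k0 r01 igs) (Ib_scale_bump k0 r01 (ballint_u ibb)).
congr (_ * _).
by have := weak_partials_Ib wg (test_scaled_bump k0 r01) igs; rewrite expr0 mul1r => <-.
Qed.

Lemma coef_diff_bound g (r t : R) k : (0 < k)%N -> 0 < r <= 1 -> 0 < t ->
  square_integrable B g -> weak_partials [::] B u g ->
  ballint (fun x => (g x - g (r *: x)) ^+ 2) ->
  `|a k * (1 - r ^+ k) * bumpmass k| <=
  t * Ib (fun x => (g x - g (r *: x)) ^+ 2) + t^-1 * Ib (fun x => bumpmode k x ^+ 2).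
Proof.
move=> k0 r01 t0 sg wg id; rewrite -(weak_diff k0 r01 sg wg).
have bb := bndmeas_bumpmode p k0; have /andP[r0 r1] := r01.
apply: ler_norm_Ib_sq => //.
have igs := square_integrableM sg (bndmeas_scaled_bump k0 r01).
have igr : ballint (fun x => g (r *: x) * bumpmode k x).
  have := integrable_scale_ball r01 igs; congr (integrable _ _ _).
  by apply/funext => x /=; rewrite scalerA mulVf ?scale1r// gt_eqF.
have := ballintB (square_integrableM sg bb) igr; congr (ballint _).
by apply/funext => x; rewrite mulrBl.
Qed.

(** The gain is the factor k. Against a polynomial of degree j, the divergence of the field [phi]
    integrates to -j times the radially weighted pairing with p_k, and orthogonality keeps only j =
    k. Since |x_i| <= 1 on the ball, each component of the field is bounded by the bump itself. *)
Lemma coef_grad_bound (g : 'I_n -> 'rV[R]_n -> R) (t : R) k : (0 < k)%N -> 0 < t ->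
  (forall i, square_integrable B (g i)) -> (forall i, weak_partials [:: i] B u (g i)) ->
  `|a k * k%:R * bumpmass k| <=
  t * (\sum_i Ib (fun x => g i x ^+ 2)) + n%:R * (t^-1 * Ib (fun x => bumpmode k x ^+ 2)).
Proof.
move=> k0 t0 sg wg.
pose c : R := k%:R; pose b : R := 1 - (2 * k%:R)^-1.
have c0 : 0 < c by rewrite ltr0n.
have b1 : b < 1 by exact: kcenter_lt1.
pose X i : mpoly.mpoly n R := mpoly.mpolyX R (mpoly.mnm1 i) * p k.
pose phi i x := radial (bw c b 2) x * pev (X i) x.
pose dphi i x := radial (bw c b 2) x * pev (mpoly.mderiv i (X i)) x +
   radial (dbw c b 2) x * (2 * x ord0 i) * pev (X i) x.
have tphi i : test_function B (phi i) by apply: smooth_test_function => //; exact: smooth_pev.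
have Dphi i x : is_derive x (ev R i) (phi i) (dphi i x).
  have D1 := is_derive_radial x i (is_derive_bw c b 2).
  have D2 := is_derive_pev_ev (X i) x i.
  rewrite (_ : phi i = radial (bw c b 2) * pev (X i)); last exact/funext.
  by apply: is_derive_eq; rewrite /dphi /GRing.scale /=; ring.
have Pphi i : partials [:: i] (phi i) = dphi i.
  by apply/funext => x; have [_] := Dphi i x.
have bw1 : bndmeas (radial (n := n) (bw c b 2)) by apply: bndmeas_radial; apply: weight_bw => //; exact: ltW.
have bw2 : bndmeas (radial (n := n) (dbw c b 2)) by apply: bndmeas_radial; apply: weight_dbw => //; exact: ltW.
have bphi i : bndmeas (phi i) by apply: bndmeasM => //; exact: bndmeas_pev.
have bx i : bndmeas (fun x : 'rV[R]_n => x ord0 i) by rewrite -pevXE; exact: bndmeas_pev.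
have bdphi i : bndmeas (dphi i).
  apply: bndmeasD; first by apply: bndmeasM => //; exact: bndmeas_pev.
  by apply: bndmeasM; [apply: bndmeasM => //; exact: bndmeasZ|exact: bndmeas_pev].
(* The divergence of [phi], in the form given by Euler's identity and used by
   [weighted_divergence]. *)
pose F x := ((n%:R + k%:R) * radial (bw c b 2) x + 2 * sqn x * radial (dbw c b 2) x) * pev (p k) x.
have FE x : F x = \sum_i dphi i x.
  transitivity (\sum_(i < n) (radial (bw c b 2) x * pev (p k) x +
      radial (bw c b 2) x * (x ord0 i * pev (mpoly.mderiv i (p k)) x) +
      2 * radial (dbw c b 2) x * pev (p k) x * x ord0 i ^+ 2)).
    rewrite !big_split /= -!mulr_sumr (euler _ (hp k)) sumr_const card_ord -mulr_natl.
    by rewrite -/(sqn x) /F; ring.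
  apply: eq_bigr => i _; rewrite /dphi /X mpoly.mderivM pevD !pevM pevX.
  rewrite mpoly.mderivX mpoly.mnm1E eqxx scale1r.
  rewrite (_ : mpoly.mnm_sub _ _ = mpoly.mnm0); last first.
    by apply/mpoly.mnmP => j; rewrite mpoly.mnmBE subnn mpoly.mnm0E.
  by rewrite mpoly.mpolyX0 pev1; ring.
have bF : bndmeas F.
  by rewrite (_ : F = fun x => \sum_i dphi i x); [exact: bndmeas_sum|exact/funext].
have wd j : Ib (fun x => pev (p j) x * F x) =
    - j%:R * Ib (fun x => radial (bw c b 2) x * (pev (p j) x * pev (p k) x)).
  rewrite -(weighted_divergence (weight_bw _ c0 (ltW b1)) (weight_dbw _ c0 (ltW b1)) (is_derive_bw c b 2) (hp j) (hp k)).
  by apply: eq_Ib => x _; rewrite /F mulrA.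
have dPB : dominated_on B (fun k => a k *: p k) M.
  by move=> j x Bx; apply: dP; exact: ball_cball.
have uF : Ib (fun x => u x * F x) = - (a k * k%:R * bumpmass k).
  have -> : Ib (fun x => u x * F x) = Ib (fun x => psum (fun k => a k *: p k) x * F x).
    by apply: eq_Ib => x Bx; rewrite uE//; exact: ball_cball.
  have E j : Ib (fun x => pev (a j *: p j) x * F x) = a j * Ib (fun x => pev (p j) x * F x).
    rewrite -IbZ; last by apply: bndmeasM => //; exact: bndmeas_pev.
    by apply: eq_Ib => x _; rewrite pevZ mulrA.
  rewrite (Ib_psum_mode cM dPB bF (k := k)).
    by rewrite E wd /bumpmass; ring.
  move=> j jk; rewrite E wd.
  rewrite (_ : Ib _ = 0) ?mulr0//.
  rewrite -[RHS](ortho_bumpmode hp lp k0 jk).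
  by apply: eq_Ib => x _; rewrite mulrCA.
have wi i : Ib (fun x => u x * dphi i x) = - Ib (fun x => g i x * phi i x).
  by have := weak_partials_Ib (wg i) (tphi i) (square_integrableM (sg i) (bphi i)); rewrite Pphi expr1 mulN1r.
have -> : a k * k%:R * bumpmass k = \sum_i Ib (fun x => g i x * phi i x).
  apply: oppr_inj; rewrite -uF -sumrN -(eq_bigr _ (fun i _ => wi i)).
  transitivity (\sum_i Ib (fun x => (u \_ B) x * dphi i x)).
    rewrite -Ib_sum; last first.
      by move=> i; apply: bndmeasM => //; exact: (bndmeas_u hp cM dP uE).
    by apply: eq_Ib => x Bx; rewrite FE mulr_sumr patchE mem_set.
  by apply: eq_bigr => i _; apply: eq_Ib => x Bx; rewrite patchE mem_set.
apply: le_trans (ler_norm_sum _ _ _) _.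
rewrite mulr_sumr -[n in n%:R * _]card_ord mulr_natl -sumr_const -big_split /=.
apply: ler_sum => i _.
apply: le_trans (ler_norm_Ib_sq t0 (square_integrable_sqr (sg i)) (square_integrableM (sg i) (bphi i)) (bphi i)) _.
rewrite lerD2l ler_pM2l ?invr_gt0//; apply: le_Ib.
- exact: bndmeas_sqr.
- by apply: bndmeas_sqr; exact: bndmeas_bumpmode.
move=> x Bx; rewrite /phi /X pevM pevX /bumpmode mulrCA exprMn ler_piMl ?sqr_ge0//.
rewrite -real_normK ?num_real// exprn_ile1//.
by apply: le_trans (le_coor_enorm _ _) (ltW Bx).
Qed.

End weak.


(** * The Gagliardo seminorm controls dilation differences *)

Lemma sqr_triangle (R : realType) (a b c K s t : R) :
  (a - c) ^+ 2 <= K * s -> (b - c) ^+ 2 <= K * t -> (a - b) ^+ 2 <= 2 * K * (s + t).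
Proof.
move=> h1 h2; have := sqr_ge0 ((a - c) + (b - c)).
have -> : ((a - c) + (b - c)) ^+ 2 = 2 * (a - c) ^+ 2 + 2 * (b - c) ^+ 2 - (a - b) ^+ 2.
  by ring.
by rewrite mulrDr -!mulrA; lra.
Qed.

Section gagliardo.
Context (R : realType) (n : nat).
Local Notation mu := (lebesgue_rV R n).
Local Notation B := (@unit_ball R n).
Variables (g : 'rV[R]_n -> R) (s : R).
Hypothesis sg : square_integrable B g.
Hypothesis s0 : 0 < s.

Let q : R := n%:R + 2 * s.
Let gB := g \_ B.

(** Defined on all pairs, with the ball entering through [gB] and an indicator, so that
    measurability of the inner integral comes from the Fubini-Tonelli theorem. On the diagonal the
    squared difference makes it 0. *)
Definition gker (z : 'rV[R]_n * 'rV[R]_n) : \bar R :=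
  ((gB z.1 - gB z.2) ^+ 2 * enorm (z.1 - z.2) `^ (- q) * \1_B z.2)%:E.

Lemma measurable_gB : measurable_fun setT gB.
Proof. by apply/(measurable_restrictT _ (@measurable_unit_ball R n)); case: sg. Qed.

Lemma measurable_gker : measurable_fun setT gker.
Proof.
apply/measurable_EFinP; apply: measurable_funM; last first.
  apply: measurableT_comp measurable_snd; apply: measurable_indic.
  exact: measurable_unit_ball.
apply: measurable_funM.
  apply: measurable_funX; apply: measurable_funB.
    exact: measurableT_comp measurable_gB measurable_fst.
  exact: measurableT_comp measurable_gB measurable_snd.
apply: (measurableT_comp (measurable_powR _)).
apply: measurableT_comp (@measurable_enorm R n) _.
apply: measurable_fun_rV => i.
rewrite (_ : (fun _ => _) = (fun z : 'rV[R]_n * 'rV[R]_n => z.1 ord0 i - z.2 ord0 i)); last first.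
  by apply/funext => z; rewrite !mxE.
apply: measurable_funB.
  exact: measurableT_comp (measurable_coor i) measurable_fst.
exact: measurableT_comp (measurable_coor i) measurable_snd.
Qed.

Lemma gker_ge0 z : (0 <= gker z)%E.
Proof.
rewrite lee_fin; apply: mulr_ge0; last by rewrite indicE.
by apply: mulr_ge0; [exact: sqr_ge0|exact: powR_ge0].
Qed.

Definition ginner (x : 'rV[R]_n) : \bar R := (\int[mu]_y gker (x, y))%E.

Lemma ginner_ge0 x : (0 <= ginner x)%E.
Proof. by apply: integral_ge0 => y _; exact: gker_ge0. Qed.

Lemma measurable_ginner : measurable_fun setT ginner.
Proof.
apply: measurable_fun_fubini_tonelli_F; [exact: measurable_gker|exact: gker_ge0].
Qed.

Lemma gagliardoE : gagliardo s B g = (\int[mu]_(x in B) ginner x)%E.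
Proof.
apply: eq_integral => x; rewrite inE => Bx.
rewrite /ginner [LHS]integral_mkcond; apply: eq_integral => y _.
rewrite /restrict /gker indicE /gB !patchE (mem_set Bx) /=.
by case: ifPn => yB; rewrite ?mulr1 ?mulr0// powRN.
Qed.

Lemma gker_sqr (x y : 'rV[R]_n) (r : R) : B x -> B y -> 0 < r -> enorm (x - y) <= r ->
  (g x - g y) ^+ 2 <= r `^ q * fine (gker (x, y)).
Proof.
move=> Bx By r0 xyr; rewrite /gker /= /gB !patchE !mem_set// indicE mem_set// mulr1.
have q0 : 0 <= q by rewrite addr_ge0// mulr_ge0// ltW.
have [xy|/eqP xy] := eqVneq x y; first by rewrite xy subrr expr0n mul0r mulr0.
have e0 : 0 < enorm (x - y).
  rewrite lt_def enorm_ge0 andbT; apply/eqP => /enorm_eq0 /eqP.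
  by rewrite subr_eq0 => /eqP.
rewrite mulrCA ler_peMr ?sqr_ge0//.
rewrite powRN -(ler_pM2r (powR_gt0 q e0)) mul1r -mulrA mulVf ?mulr1 ?gt_eqF ?powR_gt0//.
by apply: ge0_ler_powR; rewrite ?nnegrE ?enorm_ge0// ltW.
Qed.

Lemma ballint_diff (r : R) : 0 < r <= 1 -> ballint (fun x => (g x - g (r *: x)) ^+ 2).
Proof.
move=> r01; have ig := square_integrable_sqr sg.
have ir : ballint (fun x => g (r *: x) ^+ 2) by exact: (integrable_scale_ball r01 ig).
have mr : measurable_fun B (fun x => g (r *: x)).
  have ig1 : ballint g.
    have := square_integrableM sg (bndmeas_cst n 1).
    by congr (ballint _); apply/funext => x; rewrite mulr1.
  exact: (ballint_measurable (integrable_scale_ball r01 ig1)).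
apply: (@ballint_le _ _ _ (fun x => 2 * (g x ^+ 2 + g (r *: x) ^+ 2))).
- by apply: measurable_funX; apply: measurable_funB => //; case: sg.
- by apply: ballintZ; exact: ballintD.
- move=> x _; rewrite ger0_norm ?sqr_ge0//.
  have := sqr_ge0 (g x + g (r *: x)); rewrite !expr2; lra.
Qed.

Section estimate.
Variable k : nat.
Hypotheses (k2 : (2 <= k)%N) (n0 : (0 < n)%N).
Let r : R := 1 - k%:R^-1.
(** With this half-side, the cube about r x lies in the Euclidean ball of radius 1/k about r x. As
    |r x| < 1 - 1/k, it stays in the unit ball, and its points are within 2/k of both x and r x. *)
Let d : R := (k%:R * n%:R)^-1.

Let kR : (2 : R) <= k%:R. Proof. by rewrite ler_nat. Qed.
Let nR : (1 : R) <= n%:R. Proof. by rewrite ler1n. Qed.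
Let ki0 : 0 < k%:R^-1 :> R. Proof. by rewrite invr_gt0 ltr0n (ltn_trans _ k2). Qed.
Let ki1 : k%:R^-1 <= 2^-1 :> R.
Proof. by rewrite lef_pV2 ?posrE//; have := kR; lra. Qed.
Let r01 : 0 < r <= 1. Proof. by rewrite /r; have := ki0; have := ki1; lra. Qed.
Let d0 : 0 < d. Proof. by rewrite invr_gt0 mulr_gt0// ltr0n// (ltn_trans _ k2). Qed.

Lemma cube_near (x y : 'rV[R]_n) : B x -> cube (r *: x) d y ->
  [/\ B (r *: x), B y, enorm (x - y) <= 2 / k%:R & enorm (r *: x - y) <= 2 / k%:R].
Proof.
move=> Bx yc; have /andP[r0 r1] := r01; have k0 := ki0.
have h : enorm (r *: x - y) <= k%:R^-1.
  apply: le_trans (enorm_le_sum _) _; apply: (@le_trans _ _ (\sum_(i < n) d)).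
    by apply: ler_sum => i _; have := yc i; rewrite !mxE distrC => /ltW.
  by rewrite sumr_const card_ord -[d *+ n]mulr_natr /d invfM -mulrA mulVf ?mulr1// gt_eqF// ltr0n.
have rx : enorm (r *: x) = r * enorm x by rewrite enormZ gtr0_norm.
have xr : enorm (x - r *: x) <= k%:R^-1.
  have -> : x - r *: x = k%:R^-1 *: x by rewrite -{1}(scale1r x) -scalerBl /r opprB addrC subrK.
  by rewrite enormZ gtr0_norm// ler_piMr// ?ltW.
have Bx' : enorm x < 1 by [].
split.
- rewrite /unit_ball /= rx; have := enorm_ge0 x; nra.
- rewrite /unit_ball /= -(subrK (r *: x) y); apply: le_lt_trans (ler_enormD _ _) _.
  rewrite rx -enormN opprB.
  have : r * enorm x < r by rewrite gtr_pMr.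
  by move: h; rewrite /r; lra.
- rewrite -(subrK (r *: x) x) -addrA; apply: le_trans (ler_enormD _ _) _; lra.
- by apply: le_trans h _; lra.
Qed.

(* Average [(g x - g y)^2 + (g (r x) - g y)^2] over the points [y] of a cube of
   side [~ 1/k] centred at [r x]. *)
Lemma diff_le_ginner x : B x ->
  (((d *+ 2) ^+ n * (g x - g (r *: x)) ^+ 2)%:E <=
  (2 * (2 / k%:R) `^ q)%:E * (ginner x + ginner (r *: x)))%E.
Proof.
move=> Bx; have mc : measurable (cube (r *: x) d) by exact: measurable_cube.
have k20 : 0 < 2 / k%:R :> R by rewrite mulr_gt0.
have mk z : measurable_fun setT (fun y => gker (z, y)).
  exact: measurableT_comp measurable_gker (measurable_pair1 z).
set K : R := 2 * (2 / k%:R) `^ q.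
have K0 : 0 <= K by rewrite mulr_ge0// powR_ge0.
rewrite mulrC EFinM -(lebesgue_rV_cube (r *: x) d0) -integral_cst//.
rewrite /ginner -ge0_integralD//; try exact: mk; try (by move=> y _; exact: gker_ge0).
rewrite -ge0_integralZl//; last 2 first.
- by apply: emeasurable_funD; exact: mk.
- by move=> y _; rewrite adde_ge0// gker_ge0.
apply: (@le_trans _ _ (\int[mu]_(y in cube (r *: x) d) (K%:E * (gker (x, y) + gker (r *: x, y)))%E)%E); last first.
  apply: ge0_subset_integral => //.
  - by apply: measurable_funeM; apply: emeasurable_funD; exact: mk.
  - by move=> y _; rewrite mule_ge0// adde_ge0// gker_ge0.
apply: ge0_le_integral => //.
- by move=> y _; rewrite lee_fin sqr_ge0.
- by apply: measurable_funTS; apply: measurable_funeM; apply: emeasurable_funD; exact: mk.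
move=> y /(cube_near Bx)[Brx By h1 h2].
have e1 := gker_sqr Bx By k20 h1.
have e2 := gker_sqr Brx By k20 h2.
rewrite -(@fineK _ (gker (x, y)))// -(@fineK _ (gker (r *: x, y)))//.
rewrite -EFinD -EFinM lee_fin /K.
exact: sqr_triangle e1 e2.
Qed.

(** The seminorm sees pairs of points spread over the ball, not the pairs (x, r x), which form a
    null set; [diff_le_ginner], integrated over x, bridges the two. *)
Lemma gagliardo_diff : (gagliardo s B g < +oo)%E ->
  Ib (fun x => (g x - g (r *: x)) ^+ 2) <=
  2 * n%:R ^+ n * (1 + 2 ^+ n) * (2 / k%:R) `^ (2 * s) * fine (gagliardo s B g).
Proof.
rewrite gagliardoE => Goo.
have /andP[r0 r1] := r01.
have mB := @measurable_unit_ball R n.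
set G := (\int[mu]_(x in B) ginner x)%E.
have G0 : (0 <= G)%E by apply: integral_ge0 => x _; exact: ginner_ge0.
have Gfin : G \is a fin_num by rewrite ge0_fin_numE.
have mgr : measurable_fun setT (fun x : 'rV[R]_n => ginner (r *: x)).
  apply: (measurableT_comp measurable_ginner).
  have E : aff r 0 = (fun x : 'rV[R]_n => r *: x).
    by apply/funext => x; rewrite /aff addr0.
  by have := measurable_aff r (0 : 'rV[R]_n); rewrite E.
(* The Jacobian r^(-n) is at most 2^n, because k >= 2 gives r >= 1/2. *)
have scaled : (\int[mu]_(x in B) ginner (r *: x)%R <= (2 ^+ n)%:E * G)%E.
  have mge : measurable_fun setT (ginner \_ (eball r)).
    apply/(measurable_restrictT _ (@measurable_eball R n r)).
    exact: measurable_funTS measurable_ginner.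
  have e0 x : (0 <= (ginner \_ (eball r)) x)%E.
    by rewrite patchE; case: ifPn => // _; exact: ginner_ge0.
  have -> : (\int[mu]_(x in B) ginner (r *: x)%R =
      (r^-1 ^+ n)%:E * \int[mu]_(x in eball r) ginner x)%E.
    rewrite (integral_mkcond (eball r)) -(ge0_integral_aff 0 r0 mge e0).
    rewrite [LHS]integral_mkcond; apply: eq_integral => x _.
    rewrite addr0 !patchE.
    have -> : (r *: x \in eball r) = (x \in B).
      apply/idP/idP; rewrite !inE /eball /unit_ball /= enormZ gtr0_norm//.
        by rewrite gtr_pMr.
      by rewrite gtr_pMr.
    by [].
  apply: lee_pmul.
  - by rewrite lee_fin exprn_ge0// invr_ge0 ltW.
  - by apply: integral_ge0 => x _; exact: ginner_ge0.
  - rewrite lee_fin lerXn2r ?nnegrE ?invr_ge0 ?(ltW r0)//.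
    rewrite -[leRHS]invrK lef_pV2 ?posrE ?invr_gt0//.
    by rewrite /r; have := ki1; lra.
  - apply: ge0_subset_integral.
    + exact: measurable_eball.
    + exact: mB.
    + exact: measurable_funTS measurable_ginner.
    + by move=> x _; exact: ginner_ge0.
    + exact: eball_sub.
set K : R := 2 * (2 / k%:R) `^ q.
have K0 : 0 <= K by rewrite mulr_ge0// powR_ge0.
have V0 : 0 < (d *+ 2) ^+ n by rewrite exprn_gt0// mulrn_wgt0.
have id := ballint_diff r01.
have key : (d *+ 2) ^+ n * Ib (fun x => (g x - g (r *: x)) ^+ 2) <= K * (1 + 2 ^+ n) * fine G.
  rewrite -lee_fin [in leRHS]EFinM (fineK Gfin) /Ib -RintegralZl// /Rintegral.
  rewrite (fineK (integrable_fin_num mB (ballintZ _ id))).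
  apply: (@le_trans _ _ (\int[mu]_(x in B) (K%:E * (ginner x + ginner (r *: x)%R)))%E).
    apply: ge0_le_integral => //.
    - by move=> x _; rewrite lee_fin mulr_ge0 ?sqr_ge0// ltW.
    - exact: (measurable_int _ (ballintZ _ id)).
    - by apply: measurable_funTS; apply: measurable_funeM; apply: emeasurable_funD; [exact: measurable_ginner|exact: mgr].
    - by move=> x Bx; exact: diff_le_ginner.
  rewrite ge0_integralZl//; last 2 first.
  - by apply: measurable_funTS; apply: emeasurable_funD; [exact: measurable_ginner|exact: mgr].
  - by move=> x _; rewrite adde_ge0// ginner_ge0.
  rewrite (ge0_integralD mu mB (fun x _ => ginner_ge0 x) (measurable_funTS measurable_ginner)
    (fun x _ => ginner_ge0 (r *: x)) (measurable_funTS mgr)).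
  rewrite (EFinM K (1 + 2 ^+ n)) -muleA; apply: lee_wpmul2l; first by rewrite lee_fin.
  rewrite EFinD ge0_muleDl// mul1e; exact: leeD2l.
rewrite -ler_pdivlMl// in key; apply: le_trans key _.
have k0 : 0 < k%:R :> R by rewrite ltr0n (ltn_trans _ k2).
have nn0 : 0 < n%:R :> R by rewrite ltr0n.
rewrite le_eqVlt; apply/orP; left; apply/eqP.
rewrite /K /q powRD; last by apply/implyP => _; rewrite gt_eqF// divr_gt0.
rewrite powR_mulrn; last by rewrite mulr_ge0// ltW.
(* The volume (2d)^n of the cube cancels (2/k)^n up to n^n, leaving (2/k)^(2s) out of
   (2/k)^(n+2s). *)
have -> : (2 / k%:R) ^+ n = (d *+ 2) ^+ n * n%:R ^+ n :> R.
  rewrite -exprMn; congr (_ ^+ _); rewrite /d -mulr_natl; field.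
  by rewrite !gt_eqF.
by field; rewrite gt_eqF.
Qed.

End estimate.
End gagliardo.


(** * Norms on the sphere *)

Section sphere.
Context (R : realType) (n : nat).
Local Notation mu := (lebesgue_rV R n).
Local Notation B := (@unit_ball R n).
Local Notation sigma := (@sphere_measure R n).
Implicit Types (f : 'rV[R]_n -> R).

Lemma ge0_integral_mrestr (F : 'rV[R]_n -> \bar R) : measurable_fun setT F ->
  (forall x, 0 <= F x)%E ->
  (\int[mrestr mu (@measurable_unit_ball R n)]_x F x = \int[mu]_(x in B) F x)%E.
Proof.
move=> mF F0; have mB := @measurable_unit_ball R n.
rewrite -(setUv B) ge0_integral_setU//.
- rewrite [X in (_ + X)%E](_ : _ = 0%E) ?adde0.
    apply: eq_measure_integral => A mA AB; rewrite /= /mrestr; congr (mu _).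
    by apply/setIidPl.
  rewrite -(integral_measure_zero (~` B) F); apply: eq_measure_integral => A mA AB.
  rewrite /= /mrestr (_ : A `&` B = set0) ?measure0//.
  by apply/seteqP; split => // x [/AB].
- exact: measurableC.
- by rewrite setUv.
- by rewrite /disj_set setICr.
Qed.

Lemma ge0_integral_sphere (F : 'rV[R]_n -> \bar R) : measurable_fun setT F ->
  (forall x, 0 <= F x)%E ->
  (\int[sigma]_x F x = n%:R%:E * \int[mu]_(x in B) F (normalize x))%E.
Proof.
move=> mF F0.
pose pf := measure_function_pushforward__canonical__measure_function_Measure
      (mrestr mu (@measurable_unit_ball R n)) (@measurable_normalize R n).
transitivity (\int[mscale (NngNum (ler0n R n)) pf]_x F x)%E.
  by apply: eq_measure_integral.
rewrite ge0_integral_mscale//; congr (_ * _)%E.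
rewrite ge0_integral_pushforward//; last exact: measurable_normalize.
rewrite preimage_setT ge0_integral_mrestr//.
  exact: measurableT_comp mF (@measurable_normalize R n).
by move=> x; exact: F0.
Qed.

Lemma measurable_unit_sphere : measurable (@unit_sphere R n).
Proof.
have -> : @unit_sphere R n = @enorm R n @^-1` [set 1] by [].
by rewrite -[X in measurable X]setTI; exact: measurable_enorm.
Qed.

(** The surface measure of a set is n times the volume of the cone over it, so a unit L^2 norm says
    that n times the mass is 1. *)
Lemma mass_sqsph k p (Y : 'rV[R]_n -> R) : (0 < n)%N -> homog k p -> (0 < k)%N ->
  (forall x, unit_sphere x -> Y x = pev p x) ->
  sphere_Lnorm 2%:E Y = 1%E -> mass (sqsph p) 0 = n%:R^-1.
Proof.
move=> n0 hp k0 YE; rewrite /sphere_Lnorm => Y1.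
have YpE : Y \_ (@unit_sphere R n) = pev p \_ (@unit_sphere R n).
  by apply/funext => x; rewrite !patchE; case: ifPn => //; rewrite inE; exact: YE.
rewrite YpE in Y1.
have := poweR_Lnorm sigma (EFin \o (pev p \_ (@unit_sphere R n))) (r := 2).
rewrite pnatr_eq0 => /(_ isT); rewrite Y1 poweR1r.
rewrite (_ : (\int[_]_x _)%E = (\int[sigma]_x ((pev p \_ (@unit_sphere R n)) x ^+ 2)%:E)%E); last first.
  apply: eq_integral => x _ /=; congr EFin.
  by rewrite powR_mulrn// real_normK// num_real.
rewrite ge0_integral_sphere; first last.
- by move=> x; rewrite lee_fin sqr_ge0.
- apply/measurable_EFinP; apply: measurable_funX.
  apply/(measurable_restrictT _ measurable_unit_sphere).
  by apply: measurable_funTS; exact: measurable_pev.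
rewrite (_ : (\int[_]_(x in _) _)%E = (mass (sqsph p) 0)%:E).
  rewrite -EFinM => -[] E; apply: (@mulfI _ n%:R); first by rewrite pnatr_eq0 -lt0n.
  by rewrite -E mulfV// pnatr_eq0 -lt0n.
rewrite /mass Ib_EFin; last first.
  by apply: bndmeasM; [exact: bndmeas_enorm|exact: bndmeas_sqsph].
apply: eq_integral => x _; congr EFin; rewrite expr0 mul1r /sqsph; congr (_ ^+ 2).
rewrite patchE; case: ifPn => // xS.
(* The origin is the only point not sent to the sphere by [normalize]; there p(0) = 0 because the
   degree is positive. *)
have [x0|/eqP x0] := eqVneq x 0; last first.
  by move: xS; rewrite mem_set//= /unit_sphere /= enorm_normalize.
rewrite x0 normalize0 -(scale0r (0 : 'rV[R]_n)) (pev_homog _ _ hp).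
by rewrite expr0n gtn_eqF// mul0r.
Qed.

Lemma sphere_measure_cube (c : 'rV[R]_n) (d : R) (A : set 'rV[R]_n) : (0 < n)%N -> 0 < d ->
  cube c d `<=` B -> cube c d `<=` @normalize R n @^-1` A -> measurable A ->
  (0 < sigma A)%E.
Proof.
move=> n0 d0 cB cA mA; rewrite /sphere_measure /pushforward /= /mrestr.
apply: mule_gt0; first by rewrite lte_fin ltr0n.
apply: (@lt_le_trans _ _ (mu (cube c d))).
  by rewrite lebesgue_rV_cube// lte_fin exprn_gt0// mulrn_wgt0.
apply: le_measure; rewrite ?inE.
- exact: measurable_cube.
- apply: measurableI; last exact: measurable_unit_ball.
  by rewrite -[X in measurable X]setTI; exact: measurable_normalize.
- by move=> x xc; split; [exact: cA|exact: cB].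
Qed.

(** Balls of the built-in sup norm are cubes. *)
Lemma nbhs_cube (x : 'rV[R]_n) (A : set 'rV[R]_n) : nbhs x A ->
  exists2 d : R, 0 < d & cube x d `<=` A.
Proof.
move=> /nbhs_ballP[d /= d0 dA]; exists d => // y yd; apply: dA; split => // i j.
by rewrite (ord1 i) /ball /= distrC; exact: yd.
Qed.

(** From essential to pointwise bound: if |p| > c at a point x of the sphere, homogeneity and
    continuity make |p(y)| - c |y|^k positive on a small cube. The radial projection of this cube
    lies in the exceptional null set, although the cone over a null set cannot contain a cube. *)
Lemma sphere_Lnorm_oo k p (Y : 'rV[R]_n -> R) (c : R) : (0 < n)%N -> homog k p ->
  (forall x, unit_sphere x -> Y x = pev p x) ->
  (0 < k)%N -> (sphere_Lnorm +oo Y <= c%:E)%E -> forall x, unit_sphere x -> `|pev p x| <= c.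
Proof.
move=> n0 hp YE k0; rewrite /sphere_Lnorm unlock.
(* The norm of exponent [+oo] is the essential supremum only if the whole space has positive
   measure. *)
have sT : (0 < sigma setT)%E.
  have [|d d0 H] := @nbhs_cube 0 B.
    by apply: near_unit_ball; rewrite /unit_ball /= enorm0.
  by apply: (@sphere_measure_cube 0 d).
rewrite sT => /ess_supP [N [mN N0 HN]] x xS.
rewrite leNgt; apply/negP => cx.
pose h y := `|pev p y| - c * enorm y ^+ k.
have ch : continuous h.
  move=> y; apply: (@continuousB _ _ _ (fun y => `|pev p y|) (fun y => c * enorm y ^+ k)).
    exact: (continuous_comp (@continuous_pev R n p y) (@norm_continuous _ _ _)).
  apply: (@continuousM _ _ (cst c) (fun y => enorm y ^+ k)); first exact: cst_continuous.
  exact: (continuous_comp (@enorm_continuous R n y) (@exprn_continuous R k _)).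
(* The point x/2 is used because the cone measure only sees the interior of the ball. *)
have x2 : 0 < h (2^-1 *: x).
  rewrite /h (pev_homog _ _ hp) enormZ normrM xS mulr1 normrX ger0_norm// mulrC -mulrBl.
  by rewrite mulr_gt0 ?exprn_gt0// subr_gt0.
have nh : \forall y \near (2^-1 *: x), 0 < h y.
  have : h y @[y --> 2^-1 *: x] --> h (2^-1 *: x) by exact: ch.
  by move=> /(_ _ (lt_nbhsr x2)).
have nB : \forall y \near (2^-1 *: x), B y.
  by apply: near_unit_ball; rewrite /unit_ball /= enormZ xS mulr1 ger0_norm//; lra.
have [d d0 H] := nbhs_cube (filterI nh nB).
suff : (0 < sigma N)%E by rewrite N0 ltxx.
apply: (@sphere_measure_cube (2^-1 *: x) d) => //.
  by move=> y /H [].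
move=> y /H [hy By]; apply: HN => /=.
have y0 : y <> 0.
  move=> y0; move: hy; rewrite y0 /h enorm0 -(scale0r (0 : 'rV[R]_n)) (pev_homog _ _ hp).
  by rewrite expr0n gtn_eqF// mul0r mulr0 normr0 subrr ltxx.
rewrite patchE mem_set; last exact: enorm_normalize.
rewrite YE; last exact: enorm_normalize.
apply/negP; rewrite -ltNge lte_fin.
have ey : 0 < enorm y by rewrite lt_def enorm_ge0 andbT; apply/eqP => /enorm_eq0.
rewrite /normalize (pev_homog _ _ hp) normrM normrX ger0_norm ?invr_ge0 ?enorm_ge0//.
rewrite exprVn mulrC ltr_pdivlMr ?exprn_gt0//.
by move: hy; rewrite /h subr_gt0.
Qed.

End sphere.


(** * The lacunary coefficients *)

Section lacunary.
Context (R : realType).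

(** With l = d ln 2 the power is e^(-l j), and e^(l j) >= (l j)^3 / 3! would give l^3 j <= 6 C for
    all j >= 2. *)
Lemma exp_beats_square (C d : R) : 0 < d ->
  ~ (forall j : nat, (2 <= j)%N -> j%:R ^- 2 <= C * (2 ^ j)%:R `^ (- d)).
Proof.
move=> d0 H.
pose l := d * ln 2.
have l0 : 0 < l by rewrite mulr_gt0// ln_gt0// ltr1n.
have key j : (2 <= j)%N -> l ^+ 3 * j%:R <= 6 * C.
  move=> j2; have j0 : (0 : R) < j%:R by rewrite ltr0n (ltn_trans _ j2).
  have lj : 0 <= l * j%:R by rewrite mulr_ge0// ltW.
  have e1 := expR_ge1Dxn 2 lj.
  have e2 : (2 ^ j)%:R `^ (- d) = (expR (l * j%:R))^-1.
    rewrite /powR natrX expf_eq0 pnatr_eq0 andbF lnXn// -expRN; congr expR.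
    by rewrite /l -[ln 2 *+ j]mulr_natr; ring.
  have := H j j2; rewrite e2.
  have E0 : 0 < expR (l * j%:R) by exact: expR_gt0.
  move: (expR (l * j%:R)) E0 e1 => E E0 e1.
  rewrite -(ler_pM2r E0) -[C / E * E]mulrA mulVf ?gt_eqF// mulr1.
  rewrite mulrC ler_pdivrMr ?exprn_gt0// => e3.
  have e4 : (l * j%:R) ^+ 3 / 6 <= C * j%:R ^+ 2.
    by apply: le_trans e3; apply: le_trans e1; rewrite lerDr.
  have j20 : 0 < j%:R ^+ 2 :> R by rewrite exprn_gt0.
  rewrite -(ler_pM2r j20); move: e4; rewrite exprMn.
  have -> : j%:R ^+ 3 = j%:R * j%:R ^+ 2 :> R by rewrite exprS.
  lra.
(* The index [N.+2] is at least 2 and exceeds 6 C / l^3. *)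
pose N := Num.truncn (`|6 * C / l ^+ 3|).
have l3 : 0 < l ^+ 3 by rewrite exprn_gt0.
have := key N.+2 isT; rewrite mulrC -ler_pdivlMr// => h.
have : `|6 * C / l ^+ 3| < N.+1%:R by exact: truncnS_gt.
have := ler_norm (6 * C / l ^+ 3); move: h; rewrite -[N.+2%:R]natr1; lra.
Qed.

(** The discrete form of the primitive -2 t^(-1/2) of t^(-3/2), by which the sum of j^(-3/2)
    telescopes. *)
Lemma sqrt_telescope (J : nat) : (0 < J)%N ->
  J.+1%:R ^- 2 * Num.sqrt J.+1%:R <= 2 * ((Num.sqrt J%:R)^-1 - (Num.sqrt J.+1%:R)^-1) :> R.
Proof.
move=> J0; set r := Num.sqrt J%:R; set t := Num.sqrt J.+1%:R.
have r0 : 0 < r by rewrite sqrtr_gt0 ltr0n.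
have t0 : 0 < t by rewrite sqrtr_gt0.
have rr : r ^+ 2 = J%:R by rewrite sqr_sqrtr.
have tt : t ^+ 2 = J.+1%:R by rewrite sqr_sqrtr.
have tr : (t - r) * (t + r) = 1 by rewrite -subr_sqr rr tt -natr1; ring.
have rt : r <= t by rewrite ler_sqrt// ler_nat.
rewrite -tt.
have -> : t ^+ 2 ^- 2 * t = 1 / t ^+ 3 by field; rewrite gt_eqF.
have -> : 2 * (r^-1 - t^-1) = 2 / (r * t * (t + r)).
  have -> : 2 * (r^-1 - t^-1) = 2 * ((t - r) * (t + r)) / (r * t * (t + r)).
    by field; rewrite !gt_eqF// addr_gt0.
  by rewrite tr mulr1.
rewrite ler_pdivrMr ?exprn_gt0// mulrAC ler_pdivlMr ?mulr_gt0 ?addr_gt0// mul1r.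
have : r * (t + r) <= 2 * t ^+ 2 by rewrite expr2; nra.
move=> /(ler_wpM2l (ltW t0)); have -> : t ^+ 3 = t * t ^+ 2 by rewrite exprS.
lra.
Qed.

Variable a : nat -> R.
Hypothesis a_pow2 : forall j : nat, (0 < j)%N -> a (2 ^ j)%N = j%:R ^- 2.
Hypothesis a_other : forall k : nat, (forall j : nat, (0 < j)%N -> k <> (2 ^ j)%N) -> a k = 0.

Let b k : R := `|a k| * Num.sqrt (ln k%:R).

Lemma lacunary_gap J k : (2 ^ J < k < 2 ^ J.+1)%N -> a k = 0.
Proof.
move=> /andP[h1 h2]; apply: a_other => j _ E; move: h1 h2; rewrite E.
by rewrite !ltn_exp2l// ltnS => h1; rewrite leqNgt h1.
Qed.

Lemma lacunary_coef0 : a 0 = 0.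
Proof. by apply: a_other => j _ /esym/eqP; rewrite expn_eq0. Qed.

(** The exponents start at j = 1, so 1 = 2^0 carries no coefficient. This matters because ln 1 = 0
    leaves the dominating series no room at k = 1. *)
Lemma lacunary_coef1 : a 1 = 0.
Proof.
by apply: a_other => j j0 E; have := ltn_exp2l 0 j (ltnSn 1); rewrite j0 expn0 -E ltnn.
Qed.

Lemma lacunary_term_pow2 j : (0 < j)%N -> b (2 ^ j) = Num.sqrt (ln 2) * (j%:R ^- 2 * Num.sqrt j%:R).
Proof.
move=> j0; rewrite /b a_pow2// ger0_norm ?invr_ge0 ?exprn_ge0//.
by rewrite natrX lnXn// -[ln 2 *+ j]mulr_natl sqrtrM//; ring.
Qed.

(** The constant 3 is fixed by J = 1, where the sum is sqrt(ln 2) and 3 - 2 = 1; the telescoping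
    bound then carries the induction. *)
Lemma lacunary_sum J : (0 < J)%N ->
  \sum_(0 <= k < (2 ^ J).+1) b k <= Num.sqrt (ln 2) * (3 - 2 / Num.sqrt J%:R).
Proof.
case: J => // J _; elim: J => [|J IH].
  rewrite expn1 !big_nat_recr//= big_geq// /b lacunary_coef0 lacunary_coef1 normr0 !mul0r !add0r.
  rewrite -/(b 2) -[2%N]expn1 lacunary_term_pow2// expr1n invr1 mul1r sqrtr1 divr1.
  by rewrite ler_wpM2l ?sqrtr_ge0//; lra.
rewrite (@big_cat_nat _ _ _ (2 ^ J.+1).+1)//=; last by rewrite ltnS leq_exp2l.
rewrite [X in _ + X <= _]big_nat_recr/=; last by rewrite ltn_exp2l.
have -> : \sum_((2 ^ J.+1).+1 <= k < 2 ^ J.+2) b k = 0.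
  rewrite big_nat_cond; apply: big1 => k; rewrite andbT => kJ.
  by rewrite /b (@lacunary_gap J.+1 k kJ) normr0 mul0r.
rewrite add0r lacunary_term_pow2//.
apply: le_trans (lerD IH (ler_wpM2l (sqrtr_ge0 _) (sqrt_telescope (ltn0Sn J)))) _.
by rewrite -mulrDr ler_wpM2l ?sqrtr_ge0//; lra.
Qed.

Lemma lacunary_cvg (D : R) : cvgn (series (fun k => D * b k)).
Proof.
apply: (@is_cvg_seriesZ _ b D).
have b0 k : 0 <= b k by rewrite mulr_ge0// sqrtr_ge0.
apply: nondecreasing_is_cvgn.
  by apply: nondecreasing_series => k _ _; exact: b0.
exists (Num.sqrt (ln 2) * 3) => _ [N _ <-].
apply: (@le_trans _ _ (\sum_(0 <= k < (2 ^ N.+1).+1) b k)).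
  have hN : (N <= (2 ^ N.+1).+1)%N.
    exact: (leqW (ltnW (ltn_trans (ltnSn N) (ltn_expl N.+1 (ltnSn 1))))).
  rewrite seriesEnat /= (big_cat_nat _ hN)//=.
  by rewrite lerDl sumr_ge0.
apply: le_trans (lacunary_sum (ltn0Sn N)) _.
by rewrite ler_wpM2l ?sqrtr_ge0// gerBl divr_ge0// sqrtr_ge0.
Qed.

End lacunary.


(** * Failure of Sobolev and Hölder regularity *)

Section non_membership.
Context (R : realType) (n : nat).
Local Notation B := (@unit_ball R n).
Variables (p : nat -> mpoly.mpoly n R) (a : nat -> R) (M : R^nat).
Hypothesis n2 : (2 <= n)%N.
Hypothesis hp : forall k, homog k (p k).
Hypothesis lp : forall k, lap (p k) = 0.
Hypothesis p_mass : forall k, (0 < k)%N -> mass (sqsph (p k)) 0 = n%:R^-1.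
Hypothesis a_pow2 : forall j : nat, (0 < j)%N -> a (2 ^ j)%N = j%:R ^- 2.
Hypothesis cM : cvgn (series M).
Hypothesis dP : dominated_on (@unit_cball R n) (fun k => a k *: p k) M.
Variable u : 'rV[R]_n -> R.
Hypothesis uE : forall x, unit_cball x -> u x = psum (fun k => a k *: p k) x.

Let n0 : (0 < n)%N. Proof. exact: ltnW. Qed.
Let nR : (0 : R) < n%:R. Proof. by rewrite ltr0n. Qed.

Let mode_const : R := shell_const R n / n%:R.

Let mode_const_gt0 : 0 < mode_const.
Proof. by rewrite divr_gt0// shell_const_gt0. Qed.

Let mode_half_gt0 : 0 < mode_const / 2.
Proof. by rewrite mulr_gt0// ?invr_gt0. Qed.

Lemma bumpmass_ge j : (2 <= j)%N -> mode_const / (2 ^ j)%:R <= bumpmass p (2 ^ j).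
Proof.
move=> j2; have kE : (2 ^ j = 4 * 2 ^ (j - 2))%N by rewrite -(expnD 2 2) subnKC.
have := bump_mass_ge (hp (2 ^ j)) kE (expn_gt0 2 _) n0.
by rewrite p_mass ?expn_gt0// /mode_const mulrAC.
Qed.

Lemma bumpmode_sq_le j : Ib (fun x => bumpmode p (2 ^ j) x ^+ 2) <= 16 / (2 ^ j)%:R.
Proof.
have := bump_sq_le (hp (2 ^ j)) (expn_gt0 2 j) n2.
rewrite p_mass ?expn_gt0// => h; apply: le_trans h _.
by rewrite ler_pM2l// mulrAC mulfV ?mul1r// gt_eqF.
Qed.

(** At r = 1 - 1/k the factor 1 - r^k is at least 1/2, so passing to the difference with the dilate
    costs at most half of the lower bound on the pairing. *)
Lemma coef_diff_ge j : (2 <= j)%N ->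
  j%:R ^- 2 * (mode_const / 2 / (2 ^ j)%:R) <=
  `|a (2 ^ j) * (1 - (1 - (2 ^ j)%:R^-1) ^+ (2 ^ j)) * bumpmass p (2 ^ j)|.
Proof.
move=> j2; have k0 : (0 < 2 ^ j)%N by rewrite expn_gt0.
apply: le_trans (ler_norm _).
rewrite a_pow2; last exact: ltnW.
rewrite -[leRHS]mulrA; apply: ler_wpM2l; first by rewrite invr_ge0 exprn_ge0.
have h := half_power R k0; have m := bumpmass_ge j2.
have m0 : 0 <= mode_const / (2 ^ j)%:R by rewrite divr_ge0// ltW.
have -> : mode_const / 2 / (2 ^ j)%:R = 2^-1 * (mode_const / (2 ^ j)%:R) by ring.
by apply: ler_pM => //; lra.
Qed.

Lemma scale_in01 j : 0 < (1 - (2 ^ j.+1)%:R^-1 : R) <= 1.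
Proof.
have : (2 ^ j.+1)%:R^-1 <= 2^-1 :> R.
  by rewrite lef_pV2 ?posrE ?ltr0n ?expn_gt0// ler_nat -{1}[2%N]expn1 leq_exp2l.
have : 0 < (2 ^ j.+1)%:R^-1 :> R by rewrite invr_gt0 ltr0n expn_gt0.
lra.
Qed.

(** Since |x - r x| <= 1/k and the bump has L^1 norm O(1/k), the tested difference is O(k^(-eps)/k);
    after cancelling 1/k, j^(-2) would be bounded by a multiple of 2^(-j eps). *)
Lemma not_holder (eps : R) : 0 < eps -> ~ holder_on eps (@unit_cball R n) u.
Proof.
move=> e0 [C HC].
pose H : R := 4 * (n%:R * (mass (fun _ : 'rV[R]_n => 1) 0 + n%:R^-1)).
apply: (@exp_beats_square R (`|C| * H / (mode_const / 2)) eps e0) => j j2.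
set k := (2 ^ j)%N; set r : R := 1 - k%:R^-1.
have k0 : (0 < k)%N by rewrite expn_gt0.
have kR : 0 < k%:R :> R by rewrite ltr0n.
have r01 : 0 < r <= 1 by rewrite /r /k; case: (j) j2 => // j' _; exact: scale_in01.
have /andP[r0 r1] := r01.
have r01' : 0 <= r <= 1 by rewrite ltW.
have bb := bndmeas_bumpmode p k0.
have bu := bndmeas_u hp cM dP uE.
have bur := bndmeas_u_scale hp cM dP uE r01'.
have up : `|a k * (1 - r ^+ k) * bumpmass p k| <= `|C| * k%:R `^ (- eps) * Ib (fun x => `|bumpmode p k x|).
  rewrite -(Ib_u_diff hp lp cM dP uE r01' k0).
  have -> : Ib (fun x => u x * bumpmode p k x) = Ib (fun x => (u \_ B) x * bumpmode p k x).
    by apply: eq_Ib => x Bx; rewrite patchE mem_set.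
  have -> : Ib (fun x => u (r *: x) * bumpmode p k x) =
      Ib (fun x => ((fun x => u (r *: x)) \_ B) x * bumpmode p k x).
    by apply: eq_Ib => x Bx; rewrite patchE mem_set.
  rewrite -IbB; try exact: bndmeasM.
  have bd : bndmeas (fun x => (u \_ B) x * bumpmode p k x - ((fun x => u (r *: x)) \_ B) x * bumpmode p k x).
    by apply: bndmeasB; exact: bndmeasM.
  apply: le_trans (ler_norm_Ib bd) _.
  rewrite -IbZ; last exact: bndmeas_norm.
  apply: le_Ib; [exact: bndmeas_norm|by apply: bndmeasZ; exact: bndmeas_norm|].
  move=> x Bx; rewrite !patchE mem_set// -mulrBl normrM ler_wpM2r//.
  have Brx : unit_cball (r *: x).
    rewrite /unit_cball /= enormZ gtr0_norm// mulr_ile1 ?enorm_ge0//; first exact: ltW.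
    exact: ltW.
  apply: le_trans (HC x (r *: x) (ball_cball Bx) Brx) _.
  apply: (@le_trans _ _ (`|C| * enorm (x - r *: x) `^ eps)).
    by rewrite ler_wpM2r ?powR_ge0// ler_norm.
  rewrite ler_wpM2l// powRN -powR_inv1 ?powR_ge0// -powRrM mulrC powRrM.
  apply: ge0_ler_powR; rewrite ?nnegrE ?enorm_ge0 ?powR_ge0 ?(ltW e0)//.
  have -> : x - r *: x = k%:R^-1 *: x by rewrite -{1}(scale1r x) -scalerBl /r opprB addrC subrK.
  rewrite powR_inv1 ?(ltW kR)// enormZ gtr0_norm ?invr_gt0//.
  by rewrite ler_piMr ?invr_ge0 ?(ltW kR)//; exact: ltW.
have low := le_trans (coef_diff_ge j2) up.
have abs := bump_abs_le (hp k) k0 n2; rewrite p_mass// in abs.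
have abs' : Ib (fun x => `|bumpmode p k x|) <= H / k%:R.
  by apply: le_trans abs _; rewrite /H le_eqVlt; apply/orP; left; apply/eqP; ring.
have := le_trans low (ler_wpM2l _ abs').
rewrite mulr_ge0 ?powR_ge0// => /(_ isT).
have -> : `|C| * k%:R `^ (- eps) * (H / k%:R) = (`|C| * H * k%:R `^ (- eps)) / k%:R by ring.
have -> : j%:R ^- 2 * (mode_const / 2 / (2 ^ j)%:R) = (j%:R ^- 2 * (mode_const / 2)) / k%:R :> R.
  by rewrite mulrA.
rewrite ler_pM2r ?invr_gt0// -(ler_pdivlMr _ _ mode_half_gt0) => h.
apply: le_trans h _; rewrite le_eqVlt; apply/orP; left; apply/eqP.
by field; rewrite gt_eqF.
Qed.

Lemma not_sobolev (sigma : R) : 0 < sigma -> ~ sobolev_H (sigma + 2^-1) B u.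
Proof.
move=> s0 [_ HS]; set s := sigma + 2^-1 in HS.
have s0' : 0 < s by rewrite /s; lra.
have [s1|s1] := ltP s 1.
  (* For 0 < s < 1 the integer part is 0, so the empty sequence of directions yields a
     representative of [u] itself with finite seminorm of order s. *)
  have t0 : Num.truncn s = 0%N by apply/eqP; rewrite truncn_eq ?(ltW s0')// ltW.
  have [g [sg wg gg]] := HS [::] (leq0n _).
  rewrite t0 /= subr0 in gg.
  have Goo := gg erefl s0'.
  set G := fine (gagliardo s B g).
  pose E : R := 2 * n%:R ^+ n * (1 + 2 ^+ n) * 2 `^ (2 * s) * G.
  apply: (@exp_beats_square R ((E + 16) / (mode_const / 2)) sigma s0) => j j2.
  set k := (2 ^ j)%N; set r : R := 1 - k%:R^-1.
  have k0 : (0 < k)%N by rewrite expn_gt0.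
  have kR : 0 < k%:R :> R by rewrite ltr0n.
  have r01 : 0 < r <= 1 by rewrite /r /k; case: (j) j2 => // j' _; exact: scale_in01.
  have k2 : (2 <= k)%N by rewrite /k -{1}[2%N]expn1 leq_exp2l// ltnW.
  (* The balancing choice: the seminorm term is of order t k^(-2 sigma - 1) and the bump term of
     order t^(-1) k^(-1), and both become k^(-sigma) / k. *)
  pose t : R := k%:R `^ sigma.
  have t_gt0 : 0 < t by rewrite powR_gt0.
  have up := coef_diff_bound hp lp cM dP uE k0 r01 t_gt0 sg wg (ballint_diff sg r01).
  have gd := gagliardo_diff sg s0' k2 n0 Goo.
  have low := le_trans (coef_diff_ge j2) up.
  have e1 : t * Ib (fun x => (g x - g (r *: x)) ^+ 2) <= E * (k%:R `^ (- sigma) / k%:R).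
    apply: le_trans (ler_wpM2l (ltW t_gt0) gd) _.
    have -> : (2 / k%:R) `^ (2 * s) = 2 `^ (2 * s) * (k%:R `^ (- sigma) / k%:R / t) :> R.
      rewrite powRM ?invr_ge0 ?(ltW kR)//; congr (_ * _).
      have kk : k%:R^-1 = k%:R `^ (-1) :> R by rewrite powR_inv1// ltW.
      have ti : t^-1 = k%:R `^ (- sigma) by rewrite powRN.
      have kn (x y : R) : (x + y == 0) ==> (k%:R != 0 :> R).
        by apply/implyP => _; rewrite gt_eqF.
      rewrite ti kk -powRrM -!powRD//; congr (_ `^ _).
      by rewrite /s; field.
    rewrite -/G /E le_eqVlt; apply/orP; left; apply/eqP.
    by field; rewrite !gt_eqF.
  have e2 : t^-1 * Ib (fun x => bumpmode p k x ^+ 2) <= 16 * (k%:R `^ (- sigma) / k%:R).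
    rewrite powRN -/t mulrCA ler_wpM2l ?invr_ge0 ?(ltW t_gt0)//.
    exact: bumpmode_sq_le.
  have := le_trans low (lerD e1 e2).
  rewrite -mulrDl.
  have -> : (E + 16) * (k%:R `^ (- sigma) / k%:R) = ((E + 16) * k%:R `^ (- sigma)) / k%:R by ring.
  have -> : j%:R ^- 2 * (mode_const / 2 / (2 ^ j)%:R) = (j%:R ^- 2 * (mode_const / 2)) / k%:R :> R.
    by rewrite mulrA.
  rewrite ler_pM2r ?invr_gt0// -(ler_pdivlMr _ _ mode_half_gt0) => h.
  apply: le_trans h _; rewrite le_eqVlt; apply/orP; left; apply/eqP.
  by field; rewrite gt_eqF.
(* For s >= 1, square-integrable first weak derivatives alone give the contradiction. *)
have t1 : (1 <= Num.truncn s)%N by rewrite truncn_gt0.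
have HS1 i : exists g, square_integrable B g /\ weak_partials [:: i] B u g.
  by have [g [sg wg _]] := HS [:: i] t1; exists g.
pose g i := sval (cid (HS1 i)).
have sg i : square_integrable B (g i) by have [] := svalP (cid (HS1 i)).
have wg i : weak_partials [:: i] B u (g i) by have [] := svalP (cid (HS1 i)).
pose G : R := \sum_i Ib (fun x => g i x ^+ 2).
apply: (@exp_beats_square R ((G + n%:R * 16) / mode_const) 2^-1); first by rewrite invr_gt0.
move=> j j2.
set k := (2 ^ j)%N.
have k0 : (0 < k)%N by rewrite expn_gt0.
have kR : 0 < k%:R :> R by rewrite ltr0n.
(* Balances t against t^(-1) / k. *)
pose t : R := k%:R `^ (- 2^-1).
have t_gt0 : 0 < t by rewrite powR_gt0.
have tt : t * t = k%:R^-1.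
  rewrite /t -powRD; last by apply/implyP => _; rewrite gt_eqF.
  by rewrite -[k%:R^-1]powR_inv1 ?(ltW kR)//; congr (_ `^ _); field.
have up := coef_grad_bound hp lp cM dP uE k0 t_gt0 sg wg.
have low : j%:R ^- 2 * mode_const <= `|a k * k%:R * bumpmass p k|.
  apply: le_trans (ler_norm _); rewrite a_pow2; last exact: ltnW.
  rewrite -mulrA; apply: ler_wpM2l; first by rewrite invr_ge0 exprn_ge0.
  by rewrite mulrC -ler_pdivrMr//; exact: bumpmass_ge.
have e2 : t^-1 * Ib (fun x => bumpmode p k x ^+ 2) <= 16 * t.
  rewrite mulrC ler_pdivrMr// -mulrA tt; exact: bumpmode_sq_le.
have := le_trans low up; rewrite -/G => h.
have : j%:R ^- 2 * mode_const <= t * G + n%:R * (16 * t).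
  by apply: le_trans h _; rewrite lerD2l ler_pM2l.
rewrite -ler_pdivlMr// => h'; apply: le_trans h' _.
by rewrite -/t le_eqVlt; apply/orP; left; apply/eqP; field; rewrite gt_eqF.
Qed.

End non_membership.

(** * From the spherical harmonics to the polynomial series *)

Theorem theorem13 (R : realType) (n : nat) (hn : (2 <= n)%N)
    (Y : nat -> 'rV[R]_n -> R)
    (Yharm : forall k : nat, spherical_harmonic k (Y k))
    (Ynorm : forall k : nat, sphere_Lnorm 2%:E (Y k) = 1%E)
    (Ysup : exists C : R, \forall k \near \oo,
       (sphere_Lnorm +oo (Y k) <= (C * Num.sqrt (ln k%:R))%:E)%E)
    (a : nat -> R)
    (a_pow2 : forall j : nat, (0 < j)%N -> a (2 ^ j)%N = j%:R ^- 2)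
    (a_other : forall k : nat,
       (forall j : nat, (0 < j)%N -> k <> (2 ^ j)%N) -> a k = 0) :
  let u := solid_sum a Y in
  [/\ forall x : 'rV[R]_n, unit_cball x -> x <> 0 -> cvgn (solid_series a Y x),
      harmonic_on (@unit_ball R n) u,
      {within (@unit_cball R n), continuous u},
      forall sigma : R, 0 < sigma ->
        ~ sobolev_H (sigma + 2^-1) (@unit_ball R n) u
    & forall eps : R, 0 < eps -> ~ holder_on eps (@unit_cball R n) u].
Proof.
move=> u.
have n0 : (0 < n)%N by exact: ltnW.
pose p k := sval (cid (Yharm k)).
have hp k : homog k (p k) by have [] := svalP (cid (Yharm k)).
have lp k : lap (p k) = 0 by have [] := svalP (cid (Yharm k)).
have Yp k x : unit_sphere x -> Y k x = pev (p k) x.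
  by have [_ _] := svalP (cid (Yharm k)); apply.
have p_mass k : (0 < k)%N -> mass (sqsph (p k)) 0 = n%:R^-1.
  by move=> k0; exact: (mass_sqsph n0 (hp k) k0 (Yp k) (Ynorm k)).
have ln2 : 0 < Num.sqrt (ln 2) :> R by rewrite sqrtr_gt0 ln_gt0// ltr1n.
(* From the rank K on, the bound comes from the hypothesis; the finitely many earlier polynomials
   are bounded crudely, at the price of dividing by sqrt(ln 2), the least value of sqrt(ln k) for k
   >= 2. Homogeneity carries the bound from the sphere into the closed ball. *)
have [D D0 HD] : exists2 D : R, 0 <= D & forall k x, (2 <= k)%N -> unit_cball x ->
    `|pev (p k) x| <= D * Num.sqrt (ln k%:R).
  have [C [K _ HC]] := Ysup.
  have pb k : exists2 b : R, 0 <= b & forall x : 'rV[R]_n, enorm x <= 1 -> `|pev (p k) x| <= b.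
    exact: pev_bounded.
  pose b k := s2val (cid2 (pb k)).
  have b0 k : 0 <= b k by exact: s2valP (cid2 (pb k)).
  have bP k : forall x : 'rV[R]_n, enorm x <= 1 -> `|pev (p k) x| <= b k by exact: s2valP' (cid2 (pb k)).
  have S0 : 0 <= (\sum_(i < K) b i) / Num.sqrt (ln 2).
    by rewrite divr_ge0 ?sumr_ge0// ltW.
  exists (`|C| + (\sum_(i < K) b i) / Num.sqrt (ln 2)) => [|k x k2 x1]; first exact: addr_ge0.
  have k0 : (0 < k)%N by exact: ltnW.
  have lk : Num.sqrt (ln 2) <= Num.sqrt (ln k%:R) :> R.
    by rewrite ler_sqrt ?ln_ge0 ?ler1n// ler_ln ?posrE ?ltr0n// ler_nat.
  have sk : 0 <= Num.sqrt (ln k%:R) :> R by exact: sqrtr_ge0.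
  rewrite mulrDl; have [kK|Kk] := ltnP k K.
    apply: (@le_trans _ _ (b k)); first exact: bP.
    apply: (@le_trans _ _ (\sum_(i < K) b i)).
      by rewrite (bigD1 (Ordinal kK))//= lerDl sumr_ge0.
    apply: (@le_trans _ _ ((\sum_(i < K) b i) / Num.sqrt (ln 2) * Num.sqrt (ln k%:R))).
      rewrite mulrAC ler_pdivlMr//; apply: ler_wpM2l => //; exact: sumr_ge0.
    by rewrite lerDr mulr_ge0.
  apply: (@le_trans _ _ (`|C| * Num.sqrt (ln k%:R))); last by rewrite lerDl mulr_ge0.
  have sup := sphere_Lnorm_oo n0 (hp k) (Yp k) k0 (HC k Kk).
  have CC : C * Num.sqrt (ln k%:R) <= `|C| * Num.sqrt (ln k%:R) by rewrite ler_wpM2r// ler_norm.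
  have [x0|/eqP x0] := eqVneq x 0.
    rewrite (pev_normalize x (hp k) k0) x0 enorm0 expr0n gtn_eqF// mul0r normr0 mulr_ge0//.
  rewrite (pev_normalize x (hp k) k0) normrM; apply: le_trans CC.
  rewrite -[leRHS]mul1r ler_pM//; last by apply: sup; exact: enorm_normalize.
  by rewrite ger0_norm ?exprn_ge0 ?enorm_ge0// exprn_ile1 ?enorm_ge0.
pose M k := D * (`|a k| * Num.sqrt (ln k%:R)).
have cM : cvgn (series M) by exact: lacunary_cvg.
have dP : dominated_on (@unit_cball R n) (fun k => a k *: p k) M.
  move=> [|[|k]] x x1; rewrite pevZ normrM /M mulrCA.
  - by rewrite (lacunary_coef0 a_other) normr0 !mul0r.
  - by rewrite (lacunary_coef1 a_other) normr0 !mul0r.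
  - by rewrite ler_wpM2l// HD.
have serE x : x <> 0 -> solid_series a Y x = series (fun k => pev (a k *: p k) x).
  move=> x0; rewrite /solid_series; congr series; apply/funext => k.
  rewrite Yp; last exact: enorm_normalize.
  rewrite pevZ -mulrA; congr (_ * _); rewrite -(pev_homog _ _ (hp k)) /normalize scalerA.
  by rewrite mulfV ?scale1r//; apply/eqP => /enorm_eq0.
have uE x : unit_cball x -> u x = psum (fun k => a k *: p k) x.
  (* At the origin both sides vanish: a_0 = 0 because 0 is not a power of 2, and terms of positive
     degree are 0 there. *)
  move=> x1; rewrite /u /solid_sum; case: eqVneq => [->|/eqP x0]; last by rewrite serE.
  rewrite (lacunary_coef0 a_other) mul0r /psum (_ : series _ = cst 0) ?lim_cst//.
  apply/funext => N; rewrite seriesEnat /= big1// => -[|k] _.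
    by rewrite (lacunary_coef0 a_other) scale0r pev0.
  rewrite pevZ -(scale0r (0 : 'rV[R]_n)) (pev_homog _ _ (hp k.+1)).
  by rewrite expr0n mul0r mulr0.
split.
- move=> x x1 x0; rewrite serE//.
  by apply: series_dominated_cvg cM _ => k; exact: dP.
- apply: (@harmonic_psum R n (fun k => a k *: p k) M) => //.
  + move=> k; rewrite /lap (eq_bigr (fun i => a k *: mpoly.mderiv i (mpoly.mderiv i (p k)))).
      by rewrite -scaler_sumr -/(lap (p k)) lp scaler0.
    by move=> i _; rewrite !mpoly.mderivZ.
  + by move=> k x Bx; apply: dP; exact: ball_cball.
  + by move=> x Bx; apply: uE; exact: ball_cball.
- have := psum_continuous cM dP; apply: subspace_eq_continuous.
  by move=> x; rewrite inE => x1; exact: (esym (uE x x1)).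
- by move=> sigma s0; exact: (not_sobolev hn hp lp p_mass a_pow2 cM dP uE s0).
- by move=> eps e0; exact: (not_holder hn hp lp p_mass a_pow2 cM dP uE e0).
Qed.
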